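(* Consider the Markov-modulated single-server queue described in the context, with any service requirement distributions $H_d(\cdot)$ and any service discipline that does not depend on the state of the environment. In heavy traffic, i.e. as $N\to\infty$, the scaled workload $\frac1N W^{(N)}$ converges in distribution to $\hat W$, where $\hat W$ is exponentially distributed with mean $$\frac{1}{c_\infty}\sum_{d=1}^D\pi_d\left[\hat\lambda_d h_{d2}/2+a_d(\hat\lambda_d h_{d1}-c_d)\right],$$ and $\boldsymbol{a}=(a_1,\ldots,a_D)^T$ is a solution of $[Q\boldsymbol{a}]_d=c_d-\hat\lambda_d h_{d1}$, $d=1,\ldots,D$.
   Context: Model. A single-server queue is modulated by an independent external environment $Z$, an irreducible continuous-time Markov chain on the finite state space $\{1,\ldots,D\}$ with generator $Q=(q_{d\ell})_{d,\ell=1}^D$ and invariant distribution $\boldsymbol{\pi}=(\pi_1,\ldots,\pi_D)$. While the environment is in state $d$, customers arrive according to a Poisson process with rate $\lambda_d$. A customer arriving while the environment is in state $d$ has a service requirement with distribution function $H_d(\cdot)$, whose first and second moments are $h_{d1}$ and $h_{d2}$; the requirement does not change further with the environment. The service capacity is scaled by a factor $c_d$ while the environment is in state $d$, so it can change during the service of a customer. Set $c_\infty:=\sum_d\pi_d c_d$ and $\rho_\infty:=\sum_d\pi_d\lambda_d h_{d1}/c_\infty$ (the traffic intensity). The workload is defined as the time it takes to empty the system at an arbitrary moment in time given the observed environment; it is considered in steady state. Heavy-traffic scaling. For $N>0$ the arrival rate in environment state $d$ is replaced by $\lambda_d^{(N)}:=\frac{\lambda_d}{\rho_\infty}(1-1/N)$,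 where $\rho_\infty$ is based on the unscaled parameters; as $N\to\infty$ it converges to $\hat\lambda_d:=\lambda_d/\rho_\infty$. The traffic intensity of the $N$-th system is thus $\rho_\infty^{(N)}=1-1/N$. $W^{(N)}$ denotes the workload of the $N$-th system.
   Formalization: The workload is taken as total unfinished work, not the time to empty the system (with D=1, c=2 the stated mean is false for the time), and the service discipline is assumed to use the full capacity whenever customers are present. *)

(* Defs.v *)
From HB Require Import structures.
From mathcomp Require Import all_boot all_order all_algebra.
From mathcomp Require Import all_classical all_reals all_analysis.
Set Implicit Arguments.
Unset Strict Implicit.
Unset Printing Implicit Defensive.
Import Order.TTheory GRing.Theory Num.Theory.
Import numFieldNormedType.Exports.
Local Open Scope classical_set_scope.
Local Open Scope ring_scope.

Definition is_generator (R : realType) (D : nat) (Q : 'M[R]_D) : Prop :=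
  (forall i j, i != j -> 0 <= Q i j) /\ (forall i, \sum_j Q i j = 0).

Definition irreducible_generator (R : realType) (D : nat) (Q : 'M[R]_D) : Prop :=
  forall i j, connect (fun k l => 0 < Q k l) i j.

Definition invariant_distribution (R : realType) (D : nat) (Q : 'M[R]_D)
    (p : 'rV[R]_D) : Prop :=
  (forall d, 0 <= p 0 d) /\ \sum_d p 0 d = 1 /\ p *m Q = 0.

Definition expmx (R : realType) (D : nat) (A : 'M[R]_D) : 'M[R]_D :=
  \matrix_(i, j) limn (fun n => \sum_(k < n) (A ^+ k) i j / k`!%:R).

Definition moment (R : realType) (mu : probability R R) (n : nat) : R :=
  \int[mu]_x x ^+ n.

Definition requirement_distribution (R : realType) (mu : probability R R) : Prop :=
  mu `]-oo, 0[%classic = 0%E /\ (\int[mu]_x (x ^+ 2)%:E < +oo)%E.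

Definition mutually_independent (R : realType) (d : measure_display)
    (T : measurableType d) (P : probability T R) (I : Type)
    (F : I -> set (set T)) : Prop :=
  forall (n : nat) (i : 'I_n -> I) (A : 'I_n -> set T),
    injective i -> (forall k, F (i k) (A k)) ->
    P (\bigcap_k A k) = (\prod_(k < n) P (A k))%E.

Definition events_of (R : realType) (d : measure_display)
    (T : measurableType d) (X : T -> R) : set (set T) :=
  [set X @^-1` B | B in measurable].

(* [inl k]: customers already present at time 0; [inr k]: the k-th customer
   arriving after time 0. *)
Definition customer : Type := (nat + nat)%type.

(* To each customer in the system: arrival time, service requirement, and
   remaining service requirement; [None] for all other customers. *)
Definition queue_state (R : realType) : Type := customer -> option (R * R * R).

(* [sigma u q t k] is the fraction of the service capacity given at time [t] to
   customer [k], when [q] is the history of the queue and [u] an external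
   randomization.  The environment is not an argument. *)
Definition discipline (R : realType) : Type :=
  R -> (R -> queue_state R) -> R -> customer -> R.

(* Disciplines are non-anticipating and use the whole capacity as long as some
   customer is present. *)
Definition is_discipline (R : realType) (sigma : discipline R) : Prop :=
  [/\ forall u q q' t, 0 <= t -> (forall s, 0 <= s <= t -> q s = q' s) ->
        sigma u q t = sigma u q' t,
      forall u q t k, 0 <= t -> 0 <= sigma u q t k,
      forall u q t k, 0 <= t -> q t k = None -> sigma u q t k = 0 &
      forall u q t, 0 <= t -> [set k | q t k <> None] !=set0 ->
        finite_set [set k | q t k <> None] ->
        \sum_(k \in [set k | q t k <> None]) sigma u q t k = 1].

(* The primitives of one queue.  Customers arriving after time 0 form a Cox
   process: the k-th arrival takes place when the integrated intensity
   int_0^t lambda_(env u) du reaches gap 0 + ... + gap k, where the gaps are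
   i.i.d. unit exponentials.  [req k d] is the service requirement of the k-th
   arriving customer if the environment is then in state [d].  The [k]-th
   initial customer arrived at [ini_arr k] with requirement [ini_req k], of
   which [ini_res k] remains at time 0; [ini_res k = 0] means no customer. *)
Record mmqueue (R : realType) (D : nat) (d : measure_display)
    (T : measurableType d) (P : probability T R) : Type := MMQueue {
  env : R -> T -> 'I_D;
  ini_arr : nat -> {RV P >-> R};
  ini_req : nat -> {RV P >-> R};
  ini_res : nat -> {RV P >-> R};
  gap : nat -> {RV P >-> R};
  req : nat -> 'I_D -> {RV P >-> R};
  seed : {RV P >-> R};
  residual : customer -> R -> T -> R }.

Section model.
Context (R : realType) (D : nat) (d : measure_display) (T : measurableType d)
  (P : probability T R) (Q : 'M[R]_D) (lam : 'I_D -> R)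
  (H : 'I_D -> probability R R) (c : 'I_D -> R) (sigma : discipline R)
  (X : mmqueue D P).

Definition arrived (k : nat) (t : R) (w : T) : bool :=
  \sum_(i < k.+1) gap X i w <= \int[lebesgue_measure]_(u in `[0, t]) lam (env X u w).

Definition arrival_time (k : nat) (w : T) : R :=
  inf [set t | 0 <= t /\ arrived k t w].

Definition arrival (k : customer) (w : T) : R :=
  match k with inl j => ini_arr X j w | inr j => arrival_time j w end.

Definition requirement (k : customer) (w : T) : R :=
  match k with
  | inl j => ini_req X j w
  | inr j => req X j (env X (arrival_time j w) w) w
  end.

Definition offered (k : customer) (t : R) (w : T) : R :=
  match k with
  | inl j => ini_res X j w
  | inr j => if arrived j t w then requirement k w else 0
  end.

Definition queue (w : T) (t : R) : queue_state R := fun k =>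
  if 0 < residual X k t w
  then Some (arrival k w, requirement k w, residual X k t w) else None.

(* fraction of the capacity, not rate: customer [k] is served at rate
   c_(env t) * share w t k *)
Definition share (w : T) (t : R) (k : customer) : R :=
  sigma (seed X w) (queue w) t k.

(* total unfinished work, in units of service requirement, hence unaffected by
   the speed at which it is going to be processed *)
Definition workload (t : R) (w : T) : R :=
  \sum_(k \in [set: customer]) residual X k t w.

(* sigma-algebra of the initial customers and of the environment at the times
   in [I] *)
Definition info (I : set R) : set (set T) :=
  <<s [set A | (exists u i, I u /\ A = env X u @^-1` [set i]) \/
       exists k, [\/ events_of (ini_arr X k) A, events_of (ini_req X k) A
                   | events_of (ini_res X k) A]] >>.

Definition environment_law : Prop :=
  (forall t i, 0 <= t -> measurable (env X t @^-1` [set i])) /\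
  (forall s t i j A, 0 <= s -> s <= t -> info `[0, s]%classic A ->
     P (A `&` env X s @^-1` [set i] `&` env X t @^-1` [set j]) =
     (P (A `&` env X s @^-1` [set i]) * (expmx ((t - s) *: Q) i j)%:E)%E).

Definition environment_path (w : T) : Prop :=
  (forall t, 0 <= t -> \forall s \near t^'+, env X s w = env X t w) /\
  (forall t, 0 < t -> exists i, \forall s \near t^'-, env X s w = i).

Definition initial_path (w : T) : Prop :=
  (forall k, [/\ ini_arr X k w <= 0, 0 <= ini_res X k w &
                 ini_res X k w <= ini_req X k w]) /\
  finite_set [set k | ini_res X k w != 0].

Definition residual_path (w : T) : Prop :=
  forall k, measurable_fun (`[0, +oo[%classic : set R) (fun u : R => share w u k) /\
    (forall t, 0 <= t -> residual X k t w =
       offered k t w -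
       \int[lebesgue_measure]_(u in `[0, t]) (c (env X u w) * share w u k)).

Definition requirement_laws : Prop :=
  (forall k B, measurable B ->
     distribution P (gap X k) B = exponential_prob 1 B) /\
  (forall k i B, measurable B -> distribution P (req X k i) B = H i B).

Inductive source : Type :=
  | Environment | Gap of nat | Req of nat & 'I_D | Seed.

Definition source_events (s : source) : set (set T) :=
  match s with
  | Environment => info `[0, +oo[%classic
  | Gap k => events_of (gap X k)
  | Req k i => events_of (req X k i)
  | Seed => events_of (seed X)
  end.

Definition is_mmqueue : Prop :=
  [/\ environment_law, requirement_laws, mutually_independent P source_events &
      {ae P, forall w,
         [/\ environment_path w, initial_path w & residual_path w]}].

(* Steady state: the law of workload and environment does not depend on time. *)
Definition stationary_workload (W : R -> {RV P >-> R}) : Prop :=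
  [/\ is_mmqueue,
      forall t, 0 <= t -> {ae P, forall w, W t w = workload t w} &
      forall t i B, 0 <= t -> measurable B ->
        P (W t @^-1` B `&` env X t @^-1` [set i]) =
        P (W 0 @^-1` B `&` env X 0 @^-1` [set i])].

End model.

Section parameters.
Context (R : realType) (D : nat) (p : 'rV[R]_D) (lam : 'I_D -> R)
  (H : 'I_D -> probability R R) (c : 'I_D -> R).

Definition c_infty : R := \sum_d p 0 d * c d.

Definition rho_infty : R := (\sum_d p 0 d * lam d * moment (H d) 1) / c_infty.

Definition lam_hat (d : 'I_D) : R := lam d / rho_infty.

Definition lam_scaled (N : R) (d : 'I_D) : R := lam d / rho_infty * (1 - N^-1).

Definition mean_limit (a : 'cV[R]_D) : R :=
  c_infty^-1 * \sum_d p 0 d *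
    (lam_hat d * moment (H d) 2 / 2 + a d 0 * (lam_hat d * moment (H d) 1 - c d)).

End parameters.

(* Pointwise convergence of distribution functions at the continuity points of
   the limit, for random variables on possibly different probability spaces. *)
Definition cvg_in_distribution (R : realType) (dT : R -> measure_display)
    (T : forall N, measurableType (dT N)) (P : forall N, probability (T N) R)
    (Y : forall N, {RV (P N) >-> R}) (nu : set R -> \bar R) : Prop :=
  forall x : R, {for x, continuous (fun y => nu `]-oo, y]%classic)} ->
    cdf (Y N) x @[N --> +oo] --> nu `]-oo, x]%classic.
Arguments cvg_in_distribution {R dT T} P Y nu.

(* Main.v *)
(** Let [J] be the environment and [W] the stationary workload.  As long as
    customers are present the whole capacity is used, whatever the discipline,
    so that [W] decreases at rate [c_J] while positive and jumps by the
    requirements of the arrivals.  Since the expectation of [exp (- s W) g(J)] is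
    constant in time, expanding it over a short interval gives, for all [s >= 0]
    and all [g],
      [sum_i phi_i (Q g)_i + s sum_i c_i g_i (phi_i - e_i)
        = sum_i lam_i g_i phi_i (1 - beta_i s)],
    where [phi_i] is the expectation of [exp (- s W)] on [J = i], [e_i] is the
    probability of [W = 0, J = i] and [beta_i] is the Laplace transform of [H_i].
    With [g = 1] and [s] tending to [0], [sum_i c_i e_i = c_infty / N].  With
    [s = theta / N] and [g = 1 - s a], the terms of order [s] cancel because
    [(Q a)_i = c_i - lam_hat_i h_i1].  By irreducibility [phi_i] is asymptotically
    [pi_i sum_j phi_j], and the terms of order [s ^ 2] leave
    [(1 + theta m) sum_j phi_j -> 1], that is, the Laplace transform of [W / N]
    converges to that of the exponential distribution with mean [m]. *)

Require Import Defs.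
From HB Require Import structures.
From mathcomp Require Import all_boot all_order all_algebra.
From mathcomp Require Import all_classical all_reals all_analysis.
From mathcomp Require Import measurable_realfun ring lra zify.
Set Implicit Arguments.
Unset Strict Implicit.
Unset Printing Implicit Defensive.
Import Order.TTheory GRing.Theory Num.Theory.
Import numFieldNormedType.Exports.
Local Open Scope classical_set_scope.
Local Open Scope ring_scope.

(** * Expectations of bounded functions *)

(** The expansion over a short interval must hold for every discipline. Until the second arrival
    only finitely many customers can be present, and only their total share of the capacity enters
    the workload. Arrivals are compared with a clock of constant dominating rate, so that an early
    arrival is an event of the first gap alone, independent of the environment and of probability of
    order [t] on an interval of length [t]. What is not computed exactly involves, besides an early
    gap, a second early gap, a move of the environment, or work processed meanwhile. Each gives a
    factor tending to 0, so the error is [o(t)], without any rate for the moves of the environment.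
    The relation between [phi_i] and [pi_i sum_j phi_j] is the balance equation again, for a test
    function solving the Poisson equation whose right-hand side is the centred indicator of [i]: all
    other terms carry a factor [s]. The passage from transforms to distribution functions uses
    polynomials in [exp (- x)] close to indicators, hence transforms at integers only. The mean [m]
    is positive because its part in [a] is a Dirichlet form. *)

Lemma cvg_natV (R : realType) : n%:R^-1 @[n --> \oo] --> (0 : R).
Proof. by rewrite -(cvg_shiftn 1); under eq_fun do rewrite addn1; exact: cvg_harmonic. Qed.

Lemma cvg_dist_le (R : realType) (u v : nat -> R) (l : R) :
  (\forall n \near \oo, `|u n - l| <= v n) -> v n @[n --> \oo] --> (0 : R) ->
  u n @[n --> \oo] --> l.
Proof.
move=> uv v0; apply/subr_cvg0/norm_cvg0P.
apply: (@squeeze_cvgr _ _ _ _ (cst 0) v) => //; last exact: cvg_cst.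
by apply: filterS uv => n h; rewrite normr_ge0.
Qed.

Lemma cvg_sumr (R : realType) (I : Type) (s : seq I) (F : I -> nat -> R) (l : I -> R) :
  (forall i, F i n @[n --> \oo] --> l i) ->
  \sum_(i <- s) F i n @[n --> \oo] --> \sum_(i <- s) l i.
Proof.
move=> Fl; elim: s => [|i s IH].
  by under eq_fun do rewrite big_nil; rewrite big_nil; exact: cvg_cst.
under eq_fun do rewrite big_cons; rewrite big_cons; exact: cvgD.
Qed.

Section integrable_EFin.
Context (R : realType) (d : measure_display) (T : measurableType d).
Context (mu : {measure set T -> \bar R}) (D : set T) (mD : measurable D).

Lemma integrable_EFinD (f g : T -> R) : mu.-integrable D (EFin \o f) ->
  mu.-integrable D (EFin \o g) -> mu.-integrable D (EFin \o (fun x => f x + g x)).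
Proof.
move=> i1 i2; have := integrableD mD i1 i2; apply: eq_integrable => //.
Qed.

Lemma integrable_EFinZ (r : R) (f : T -> R) : mu.-integrable D (EFin \o f) ->
  mu.-integrable D (EFin \o (fun x => r * f x)).
Proof.
by move=> i1; have := integrableZl mD r i1; apply: eq_integrable.
Qed.

End integrable_EFin.

Section bounded_functions.
Context (R : realType) (d : measure_display) (T : measurableType d).
Implicit Types (f g : T -> R) (A : set T).

(** Boundedness is required everywhere and not almost surely: such functions form an algebra and are
    integrable for every probability measure, so that the real-valued integral is linear on them. *)
Definition bounded_measurable f :=
  measurable_fun setT f /\ exists M, forall x, `|f x| <= M.

Lemma bounded_measurable_cst (r : R) : bounded_measurable (fun=> r).
Proof. by split; [exact: measurable_cst|exists `|r|]. Qed.

Lemma bounded_measurableD f g : bounded_measurable f -> bounded_measurable g ->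
  bounded_measurable (fun x => f x + g x).
Proof.
move=> [mf [M fM]] [mg [K gK]]; split; first exact: measurable_funD.
by exists (M + K) => x; rewrite (le_trans (ler_normD _ _))// lerD.
Qed.

Lemma bounded_measurableN f : bounded_measurable f ->
  bounded_measurable (fun x => - f x).
Proof.
move=> [mf [M fM]]; split; first exact: measurableT_comp.
by exists M => x; rewrite normrN.
Qed.

Lemma bounded_measurableB f g : bounded_measurable f -> bounded_measurable g ->
  bounded_measurable (fun x => f x - g x).
Proof. by move=> bf bg; apply/bounded_measurableD/bounded_measurableN. Qed.

Lemma bounded_measurableM f g : bounded_measurable f -> bounded_measurable g ->
  bounded_measurable (fun x => f x * g x).
Proof.
move=> [mf [M fM]] [mg [K gK]]; split; first exact: measurable_funM.
by exists (M * K) => x; rewrite normrM ler_pM.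
Qed.

Lemma bounded_measurableX f n : bounded_measurable f ->
  bounded_measurable (fun x => f x ^+ n).
Proof.
move=> bf; elim: n => [|n IH].
  by under eq_fun do rewrite expr0; exact: bounded_measurable_cst.
by under eq_fun do rewrite exprS; exact: bounded_measurableM.
Qed.

Lemma bounded_measurable_norm f : bounded_measurable f ->
  bounded_measurable (fun x => `|f x|).
Proof.
move=> [mf [M fM]]; split; first exact: measurableT_comp.
by exists M => x; rewrite normr_id.
Qed.

Lemma bounded_measurable_sum (I : Type) (s : seq I) (F : I -> T -> R) :
  (forall i, bounded_measurable (F i)) ->
  bounded_measurable (fun x => \sum_(i <- s) F i x).
Proof.
move=> bF; elim: s => [|i s IH].
  by under eq_fun do rewrite big_nil; exact: bounded_measurable_cst.
by under eq_fun do rewrite big_cons; exact: bounded_measurableD.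
Qed.

Lemma bounded_measurable_indic A : measurable A -> bounded_measurable \1_A.
Proof.
move=> mA; split; first exact: measurable_indic.
by exists 1 => x; rewrite indicE; case: (_ \in _); rewrite ?normr1 ?normr0.
Qed.

Variable P : probability T R.

Lemma bounded_measurable_integrable f : bounded_measurable f ->
  P.-integrable setT (EFin \o f).
Proof.
move=> [mf [M fM]]; apply: measurable_bounded_integrable => //.
  by rewrite (le_lt_trans (probability_le1 _ _))// ltry.
exists M; split; first exact: num_real.
by move=> y My x _; exact: le_trans (fM x) (ltW My).
Qed.

Lemma expectedD f g : bounded_measurable f -> bounded_measurable g ->
  \int[P]_x (f x + g x) = \int[P]_x f x + \int[P]_x g x.
Proof. by move=> bf bg; rewrite RintegralD//; exact: bounded_measurable_integrable. Qed.

Lemma expectedB f g : bounded_measurable f -> bounded_measurable g ->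
  \int[P]_x (f x - g x) = \int[P]_x f x - \int[P]_x g x.
Proof. by move=> bf bg; rewrite RintegralB//; exact: bounded_measurable_integrable. Qed.

Lemma expectedZ (r : R) f : bounded_measurable f ->
  \int[P]_x (r * f x) = r * \int[P]_x f x.
Proof. by move=> bf; rewrite RintegralZl//; exact: bounded_measurable_integrable. Qed.

Lemma expected_cst (r : R) : \int[P]_x r = r.
Proof. rewrite Rintegral_cst//; have := probability_setT P; rewrite /= => ->; by rewrite mulr1. Qed.

Lemma expected_sum (I : Type) (s : seq I) (F : I -> T -> R) :
  (forall i, bounded_measurable (F i)) ->
  \int[P]_x (\sum_(i <- s) F i x) = \sum_(i <- s) \int[P]_x F i x.
Proof.
move=> bF; elim: s => [|i s IH].
  by under eq_Rintegral do rewrite big_nil; rewrite big_nil expected_cst.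
under eq_Rintegral do rewrite big_cons.
by rewrite big_cons expectedD ?IH//; exact: bounded_measurable_sum.
Qed.

Lemma expected_indic A : measurable A -> \int[P]_x \1_A x = fine (P A).
Proof. by move=> mA; rewrite /Rintegral integral_indic// setIT. Qed.

Lemma expected_ae_le f g : bounded_measurable f -> bounded_measurable g ->
  {ae P, forall x, f x <= g x} -> \int[P]_x f x <= \int[P]_x g x.
Proof.
move=> bf bg fg.
have ih := bounded_measurable_integrable (bounded_measurableB bg bf).
rewrite -subr_ge0 -expectedB//.
(* The integrand is nonnegative only almost surely; its absolute value has the same integral and is
   nonnegative everywhere. *)
have -> : \int[P]_x (g x - f x) = \int[P]_x `|g x - f x|.
  congr fine; apply: ae_eq_integral => //.
  - exact: measurable_int ih.
  - case: (bounded_measurable_norm (bounded_measurableB bg bf)) => h _.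
    exact/measurable_EFinP.
  - by apply: filterS fg => x fgx _ /=; rewrite ger0_norm// subr_ge0.
by apply: Rintegral_ge0.
Qed.

Lemma expected_ae_eq f g : bounded_measurable f -> bounded_measurable g ->
  {ae P, forall x, f x = g x} -> \int[P]_x f x = \int[P]_x g x.
Proof.
move=> bf bg fg; apply/eqP; rewrite eq_le !expected_ae_le//.
  by apply: filterS fg => x ->.
by apply: filterS fg => x ->.
Qed.

Lemma expected_norm_le f g : bounded_measurable f -> bounded_measurable g ->
  {ae P, forall x, `|f x| <= g x} -> `|\int[P]_x f x| <= \int[P]_x g x.
Proof.
move=> bf bg fg; rewrite (le_trans (le_normr_Rintegral _ _))//.
  exact: bounded_measurable_integrable.
by apply: expected_ae_le => //; exact: bounded_measurable_norm.
Qed.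

Lemma expected_dominated_cvg (F : nat -> T -> R) f (g : T -> R) :
  (forall n, measurable_fun setT (F n)) -> measurable_fun setT f ->
  P.-integrable setT (EFin \o g) ->
  {ae P, forall x n, `|F n x| <= g x} ->
  {ae P, forall x, F n x @[n --> \oo] --> f x} ->
  \int[P]_x F n x @[n --> \oo] --> \int[P]_x f x.
Proof.
move=> mF mf ig Fg Ff.
have [] := @dominated_convergence _ _ _ P setT measurableT
  (fun n x => (F n x)%:E) (EFin \o f) (EFin \o g).
- by move=> n; exact/measurable_EFinP.
- exact/measurable_EFinP.
- by apply: filterS Ff => x Fx _; apply: cvg_EFin => //; exact: nearW.
- exact: ig.
- by apply: filterS Fg => x Fx n _; rewrite /= lee_fin.
move=> iF _; rewrite -(fineK (integrable_fin_num measurableT iF)).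
by move=> /fine_cvgP[].
Qed.

Lemma expected_bounded_cvg (F : nat -> T -> R) f (M : R) :
  (forall n, measurable_fun setT (F n)) -> measurable_fun setT f ->
  {ae P, forall x n, `|F n x| <= M} ->
  {ae P, forall x, F n x @[n --> \oo] --> f x} ->
  \int[P]_x F n x @[n --> \oo] --> \int[P]_x f x.
Proof.
move=> mF mf FM Ff; apply: (@expected_dominated_cvg _ _ (fun=> M)) => //.
exact/bounded_measurable_integrable/bounded_measurable_cst.
Qed.

End bounded_functions.

(** The sum counts the positive integers up to [n * x], so it is the integer part of [n * x]; the
    bound [x <= 1] ensures that the range [k < n] misses none of them. *)
Lemma staircase (R : realType) (n : nat) (x : R) : (0 < n)%N -> 0 <= x <= 1 ->
  0 <= x - n%:R^-1 * \sum_(k < n) (k.+1%:R <= n%:R * x)%R%:R <= n%:R^-1.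
Proof.
move=> n0 /andP[x0 x1].
have n0R : (0 : R) < n%:R by rewrite ltr0n.
have nx0 : 0 <= n%:R * x by rewrite mulr_ge0.
pose m := Num.truncn (n%:R * x).
have /andP[m1 m2] := Num.Theory.truncn_itv nx0; rewrite -/m in m1 m2.
have mn : (m <= n)%N.
  by rewrite -(ler_nat R) (le_trans m1)// ler_piMr.
have -> : \sum_(k < n) (k.+1%:R <= n%:R * x)%R%:R = m%:R :> R.
  transitivity (\sum_(k < n) (k < m)%N%:R : R).
    apply: eq_bigr => k _; congr (nat_of_bool _)%:R; apply/idP/idP => h.
      by rewrite -ltnS -(ltr_nat R) (le_lt_trans h).
    by rewrite (le_trans _ m1)// ler_nat.
  rewrite -natr_sum; congr _%:R.
  rewrite -(big_mkord xpredT (fun k => nat_of_bool (k < m)%N)) (big_cat_nat (n := m))//=.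
  rewrite big_nat (eq_bigr (fun=> 1%N)); last by move=> i /andP[_ ->].
  rewrite -big_nat sum_nat_const_nat subn0 muln1.
  rewrite big_nat big1 ?addn0// => i /andP[mi _].
  by rewrite ltnNge mi.
rewrite -(ler_pM2l n0R) mulr0 mulrBr mulrA divff ?gt_eqF// mul1r subr_ge0 m1/=.
rewrite -(ler_pM2l n0R) mulrBr mulrA divff ?gt_eqF// mul1r.
by rewrite lerBlDr nat1r ltW.
Qed.

(* Functions of [U] are approximated by staircases, so that an identity between
   [U] and [U'] on events extends to bounded functions. *)
Lemma expected_comp_eq (R : realType) (d : measure_display) (T : measurableType d)
    (P : probability T R) (U U' h h' : T -> R) (phi : R -> R) :
  measurable_fun setT U -> measurable_fun setT U' ->
  bounded_measurable h -> bounded_measurable h' ->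
  measurable_fun setT phi -> (forall x, 0 <= phi x <= 1) ->
  (forall B, measurable B ->
     \int[P]_x (\1_B (U x) * h x) = \int[P]_x (\1_B (U' x) * h' x)) ->
  \int[P]_x (phi (U x) * h x) = \int[P]_x (phi (U' x) * h' x).
Proof.
move=> mU mU' bh bh' mphi phi01 H.
have [M0 hM] : exists M, forall x, `|h x| + `|h' x| <= M.
  have [_ [M hM]] := bh; have [_ [M' hM']] := bh'.
  by exists (M + M') => x; rewrite lerD.
pose B n k : set R := [set x | k.+1%:R <= n%:R * phi x].
have mB n k : measurable (B n k).
  rewrite -[X in measurable X]setTI.
  have -> : B n k = (fun x => n%:R * phi x) @^-1` `[k.+1%:R, +oo[.
    by apply/seteqP; split => x; rewrite /B /= in_itv /= andbT.
  by apply: measurable_funM => //; exact: measurable_cst.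
have bphi (V : T -> R) : measurable_fun setT V -> bounded_measurable (fun x : T => phi (V x)).
  move=> mV; split; first exact: measurableT_comp.
  by exists 1 => x; rewrite ger0_norm; case/andP: (phi01 (V x)).
have bB (V : T -> R) n k : measurable_fun setT V ->
    bounded_measurable (fun x : T => \1_(B n k) (V x) : R).
  move=> mV; split; first exact: measurableT_comp.
  by exists 1 => x; rewrite indicE; case: (_ \in _); rewrite ?normr1 ?normr0.
pose st n (V : T -> R) x : R := n%:R^-1 * \sum_(k < n) \1_(B n k) (V x).
have bst (V : T -> R) n : measurable_fun setT V -> bounded_measurable (st n V).
  move=> mV; apply: bounded_measurableM; first exact: bounded_measurable_cst.
  by apply: bounded_measurable_sum => k; exact: bB.
have stE V n x : (0 < n)%N -> `|phi (V x) - st n V x| <= n%:R^-1.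
  move=> n0; have := staircase n0 (phi01 (V x)).
  under eq_bigr => k _.
    have -> : (k.+1%:R <= n%:R * phi (V x))%R%:R = \1_(B n k) (V x) :> R.
      rewrite indicE; congr (nat_of_bool _)%:R.
      by apply/idP/idP; rewrite /B inE.
    over.
  by move=> /andP[h1 h2]; rewrite ger0_norm.
have eq_st n : \int[P]_x (st n U x * h x) = \int[P]_x (st n U' x * h' x).
  rewrite /st; under eq_Rintegral do rewrite -mulrA mulr_suml.
  under [RHS]eq_Rintegral do rewrite -mulrA mulr_suml.
  rewrite !expectedZ; last 2 first.
  - by apply: bounded_measurable_sum => k; apply: bounded_measurableM => //; exact: bB.
  - by apply: bounded_measurable_sum => k; apply: bounded_measurableM => //; exact: bB.
  congr (_ * _); rewrite !expected_sum.
  - by apply: eq_bigr => k _; exact: H.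
  - by move=> k; apply: bounded_measurableM => //; exact: bB.
  - by move=> k; apply: bounded_measurableM => //; exact: bB.
(* The staircases converge uniformly, at rate [n%:R^-1], so the integrals converge for any bounded
   weight. *)
have lim (V g : T -> R) : measurable_fun setT V -> bounded_measurable g ->
    (forall x, `|g x| <= M0) ->
    \int[P]_x (st n V x * g x) @[n --> \oo] --> \int[P]_x (phi (V x) * g x).
  move=> mV bg gM.
  have M00 : 0 <= M0 := le_trans (normr_ge0 _) (gM point).
  apply: (@cvg_dist_le _ _ (fun n => n%:R^-1 * M0)).
  - near=> n.
    rewrite distrC -expectedB; [|by apply: bounded_measurableM => //; exact: bphi
                         |by apply: bounded_measurableM => //; exact: bst].
    rewrite -[leRHS](expected_cst P); apply: expected_norm_le.
    + apply: bounded_measurableB; apply: bounded_measurableM => //.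
      exact: bphi. exact: bst.
    + exact: bounded_measurable_cst.
    + apply: aeW => x; rewrite -mulrBl normrM ler_pM// stE//.
      by near: n; exact: nbhs_infty_gt.
  - rewrite -[X in _ --> X](mul0r M0); apply: cvgM; last exact: cvg_cst.
    exact: cvg_natV.
have lU : \int[P]_x (st n U x * h x) @[n --> \oo] --> \int[P]_x (phi (U x) * h x).
  by apply: lim => // x; rewrite (le_trans _ (hM x))// lerDl.
have lU' : \int[P]_x (st n U' x * h' x) @[n --> \oo] --> \int[P]_x (phi (U' x) * h' x).
  by apply: lim => // x; rewrite (le_trans _ (hM x))// lerDr.
rewrite (_ : (fun n => \int[P]_x (st n U x * h x)) =
  (fun n => \int[P]_x (st n U' x * h' x))) in lU; last exact/funext.
exact: cvg_unique lU lU'.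
Unshelve. all: by end_near.
Qed.

(** * Generators and the Poisson equation *)

Section generators.
Context (R : realType) (D : nat).
Implicit Types (Q A : 'M[R]_D) (p : 'rV[R]_D).

(** Maximum principle: where [g] is maximal, [Q *m g = 0] is a vanishing sum of nonnegative terms,
    so [g] is also maximal at every state reached at a positive rate. Irreducibility propagates this
    to all states. *)
Lemma generator_ker_const Q (g : 'cV[R]_D) :
  is_generator Q -> irreducible_generator Q -> Q *m g = 0 ->
  forall i j, g i 0 = g j 0.
Proof.
move=> [Qge0 Qsum] irr Qg i0 j0.
have [m _ mP] := @arg_maxP _ _ 'I_D i0 xpredT (fun k => g k 0) isT.
suff H x : g x 0 = g m 0 by rewrite (H i0) (H j0).
have step (k l : 'I_D) : g k 0 = g m 0 -> 0 < Q k l -> g l 0 = g m 0.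
  move=> gk Qkl.
  have s0 : \sum_j Q k j * (g m 0 - g j 0) = 0.
    under eq_bigr do rewrite mulrBr.
    rewrite sumrB -mulr_suml Qsum mul0r sub0r.
    by move/matrixP/(_ k 0): Qg; rewrite !mxE => ->; rewrite oppr0.
  have t0 j : j \in 'I_D -> 0 <= Q k j * (g m 0 - g j 0).
    move=> _; have [<-|kj] := eqVneq k j; first by rewrite gk subrr mulr0.
    by rewrite mulr_ge0 ?Qge0// subr_ge0; exact: mP.
  have /(_ l) := psumr_eq0P t0 s0.
  move=> /(_ isT)/eqP; rewrite mulf_eq0 gt_eqF//= subr_eq0 => /eqP.
  by [].
have walk s : forall k, g k 0 = g m 0 -> path (fun k l => 0 < Q k l) k s ->
    g (last k s) 0 = g m 0.
  elim: s => [//|l s IH] k gk /= /andP[Qkl]; exact/IH/(step k).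
by have /connectP[s ps ->] := irr m x; exact: walk ps.
Qed.

(* By irreducibility [Q] has rank [D - 1], so that its range is the annihilator
   of the invariant distribution. *)
Lemma poisson_equation Q p (v : 'cV[R]_D) :
  is_generator Q -> irreducible_generator Q -> invariant_distribution Q p ->
  p *m v = 0 -> exists g : 'cV[R]_D, Q *m g = v.
Proof.
move=> genQ irr [_ [p1 pQ]] pv.
have p_neq0 : p != 0.
  apply: contra_eq_neq p1 => ->; rewrite big1 1?eq_sym ?oner_eq0// => i _.
  by rewrite mxE.
have rp : \rank p^T = 1%N.
  apply/eqP; rewrite mxrank_tr eqn_leq rank_leq_row lt0n mxrank_eq0 //.
have ker1 : (kermx Q^T <= (const_mx 1 : 'rV[R]_D))%MS.
  apply/row_subP => i.
  set u := row i _.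
  have uQ : u *m Q^T = 0 by apply/sub_kermxP; exact: row_sub.
  have Qu : Q *m u^T = 0 by rewrite -[Q]trmxK -trmx_mul uQ trmx0.
  have cst := generator_ker_const genQ irr Qu.
  have -> : u = u 0 i *: const_mx 1.
    apply/rowP => j; rewrite [RHS]mxE [const_mx 1 _ _]mxE mulr1.
    by have := cst i j; rewrite ![u^T _ _]mxE.
  exact: scalemx_sub.
(* The kernel lies in the line of constant vectors, so its dimension is at most 1. *)
have rQ : (D.-1 <= \rank Q^T)%N.
  have := mxrank_ker Q^T; have := mxrankS ker1.
  have := rank_leq_row (const_mx 1 : 'rV[R]_D).
  have := rank_leq_row Q^T.
  move: (\rank _) (\rank _) (\rank _) => a b e; lia.
have QK : (Q^T <= kermx p^T)%MS.
  by apply/sub_kermxP; rewrite -trmx_mul pQ trmx0.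
(* One inclusion is invariance of [p]; the two spaces coincide because the annihilator of [p] has
   dimension [D - 1]. *)
have QKe : (kermx p^T <= Q^T)%MS.
  rewrite -(geq_leqif (mxrank_leqif_sup QK)) mxrank_ker rp.
  by rewrite (leq_trans _ rQ)// subn1.
have : (v^T <= Q^T)%MS.
  apply: submx_trans QKe; apply/sub_kermxP.
  by rewrite -trmx_mul pv trmx0.
case/submxP => w vw; exists w^T.
by rewrite -[v]trmxK vw trmx_mul trmxK.
Qed.

(** The entries of [Q ^+ k] are at most [(1 + M) ^+ k], where [M] sums the absolute values of the
    entries of [Q]. For [t <= 1] the exponential series from its quadratic term on is therefore at
    most [t ^+ 2] times the exponential of [1 + M]. *)
Lemma expmx_le Q : exists C : R, forall t i j, 0 <= t <= 1 ->
  `|expmx (t *: Q) i j - (i == j)%:R - t * Q i j| <= t ^+ 2 * C.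
Proof.
pose M : R := \sum_i \sum_j `|Q i j|.
have M0 : 0 <= M by apply: sumr_ge0 => i _; apply: sumr_ge0.
have QM k i j : `|(Q ^+ k) i j| <= (1 + M) ^+ k.
  elim: k i j => [|k IH] i j.
    by rewrite expr0 mxE; case: (_ == _); rewrite ?normr1 ?normr0.
  rewrite exprSr mxE; apply: (le_trans (ler_norm_sum _ _ _)).
  rewrite exprSr.
  under eq_bigr do rewrite normrM.
  apply: (@le_trans _ _ (\sum_l (1 + M) ^+ k * `|Q l j|)).
    by apply: ler_sum => l _; rewrite ler_wpM2r.
  rewrite -mulr_sumr ler_wpM2l ?exprn_ge0 ?addr_ge0//.
  rewrite (@le_trans _ _ M)// ?lerDr//.
  apply: ler_sum => l _; rewrite (bigD1 j)//= lerDl.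
  exact: sumr_ge0.
exists (expR (1 + M)) => t i j /andP[t0 t1].
pose a k := ((t *: Q) ^+ k) i j / k`!%:R.
have aE k : a k = t ^+ k * (Q ^+ k) i j / k`!%:R.
  rewrite /a; congr (_ / _).
  elim: k i j {a} => [|k IH] i j; first by rewrite !expr0 mul1r.
  rewrite !exprSr !mxE mulr_sumr; apply: eq_bigr => l _.
  by rewrite IH mxE; ring.
have ab k : `|a k| <= exp_coeff (1 + M) k.
  rewrite aE /exp_coeff /= normrM normrV ?unitfE ?pnatr_eq0 -?lt0n ?fact_gt0//.
  rewrite normr_nat ler_wpM2r ?invr_ge0// normrM ger0_norm ?exprn_ge0//.
  rewrite -[leRHS]mul1r ler_pM ?exprn_ge0//.
  by rewrite exprn_ile1.
have ab2 k : (2 <= k)%N -> `|a k| <= t ^+ 2 * exp_coeff (1 + M) k.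
  move=> k2; rewrite aE /exp_coeff /= normrM normrV ?unitfE ?pnatr_eq0 -?lt0n ?fact_gt0//.
  rewrite normr_nat mulrA ler_wpM2r ?invr_ge0// normrM ger0_norm ?exprn_ge0//.
  by rewrite ler_pM ?exprn_ge0// -(subnKC k2) exprD ler_piMr ?exprn_ge0// exprn_ile1.
have cv : cvgn (series a).
  apply: normed_cvg; apply: (@series_le_cvg _ _ (exp_coeff (1 + M))) => //=.
  - by move=> n; rewrite exp_coeff_ge0// addr_ge0.
  - exact: is_cvg_series_exp_coeff.
have -> : expmx (t *: Q) i j = limn (series a).
  rewrite mxE; congr (limn _); apply/funext => n.
  by rewrite /series /= big_mkord.
have -> : limn (series a) - (i == j)%:R - t * Q i j =
    limn (fun n => series a n - ((i == j)%:R + t * Q i j)).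
  rewrite limB//; last exact: is_cvg_cst.
  by rewrite lim_cst//; ring.
rewrite -lim_norm; last by apply: is_cvgB => //; exact: is_cvg_cst.
apply: limr_le; first by apply: is_cvg_norm; apply: is_cvgB => //; exact: is_cvg_cst.
exists 2%N => // n /= n2.
have -> : series a n = a 0%N + (a 1%N + \sum_(2 <= k < n) a k).
  by rewrite /series /= big_ltn ?(ltn_trans _ n2)// big_ltn.
rewrite !aE !expr0 !expr1 mxE !divr1 mul1r.
have -> : forall x y z : R, x + (y + z) - (x + y) = z by move=> *; ring.
apply: (le_trans (ler_norm_sum _ _ _)).
apply: (@le_trans _ _ (\sum_(2 <= k < n) t ^+ 2 * exp_coeff (1 + M) k)).
  rewrite !big_nat; apply: ler_sum => k /andP[k2 _]; exact: ab2.
rewrite -mulr_sumr ler_wpM2l ?exprn_ge0//.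
apply: (@le_trans _ _ (series (exp_coeff (1 + M)) n)).
  rewrite /series /= [leRHS](@big_cat_nat _ _ _ 2)//= lerDr.
  by apply: sumr_ge0 => k _; rewrite exp_coeff_ge0// addr_ge0.
apply: nondecreasing_cvgn_le; last exact: is_cvg_series_exp_coeff.
apply: nondecreasing_series => k _ _; by rewrite exp_coeff_ge0// addr_ge0.
Qed.

Lemma expmx_derivative0 Q (u : nat -> R) i j :
  (forall n, 0 < u n <= 1) -> u @ \oo --> 0 ->
  (expmx (u n *: Q) i j - (i == j)%:R) / u n @[n --> \oo] --> Q i j.
Proof.
move=> u01 u0; have [C HC] := expmx_le Q.
have -> : (fun n => (expmx (u n *: Q) i j - (i == j)%:R) / u n) =
   (fun n => Q i j + (expmx (u n *: Q) i j - (i == j)%:R - u n * Q i j) / u n).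
  apply/funext => n; have /andP[un0 _] := u01 n.
  by field; rewrite gt_eqF.
rewrite -[X in _ --> X]addr0; apply: cvgD; first exact: cvg_cst.
apply/norm_cvg0P.
apply: (@squeeze_cvgr _ _ _ _ (cst 0) (fun n => u n * C)).
- apply: nearW => n; rewrite normr_ge0 /=.
  have /andP[un0 un1] := u01 n.
  rewrite normrM normfV (gtr0_norm un0) ler_pdivrMr//.
  rewrite (le_trans (HC _ _ _ _)) ?(ltW un0) ?un1//.
  by rewrite expr2; lra.
- exact: cvg_cst.
- rewrite -[X in _ --> X](mul0r C); apply: cvgM => //; exact: cvg_cst.
Qed.

End generators.

(** * Laplace transforms *)

Section damping.
Context (R : realType).
Implicit Types s x : R.

(* The absolute value makes [damp s] bounded; only its values on [0, +oo[
   matter. *)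
Definition damp s x : R := expR (- (s * `|x|)).

Lemma damp_ge0 s x : 0 <= damp s x.
Proof. exact: expR_ge0. Qed.

Lemma damp_le1 s x : 0 <= s -> damp s x <= 1.
Proof. by move=> s0; rewrite -expR0 ler_expR oppr_le0 mulr_ge0. Qed.

Lemma damp0 s : damp s 0 = 1.
Proof. by rewrite /damp normr0 mulr0 oppr0 expR0. Qed.

Lemma damp0l x : damp 0 x = 1.
Proof. by rewrite /damp mul0r oppr0 expR0. Qed.

Lemma dampD s x y : 0 <= x -> 0 <= y -> damp s (x + y) = damp s x * damp s y.
Proof. by move=> x0 y0; rewrite /damp !ger0_norm ?addr_ge0// -expRD; congr expR; ring. Qed.

Lemma dampX s x n : damp s x ^+ n = damp (n%:R * s) x.
Proof. by rewrite /damp -expRM_natl; congr expR; ring. Qed.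

Lemma damp_scale s r x : 0 <= r -> damp s (r * x) = damp (s * r) x.
Proof. by move=> r0; rewrite /damp normrM (ger0_norm r0) mulrA. Qed.

Lemma measurable_damp s : measurable_fun setT (damp s).
Proof.
apply: measurableT_comp => //; apply: measurableT_comp => //.
by apply: measurable_funM => //; exact: measurableT_comp.
Qed.

Lemma bounded_measurable_damp s d (T : measurableType d) (f : T -> R) : 0 <= s ->
  measurable_fun setT f -> bounded_measurable (fun w : T => damp s (f w)).
Proof.
move=> s0 mf; split; first exact: (measurableT_comp (measurable_damp s)).
by exists 1 => w; rewrite ger0_norm ?damp_ge0// damp_le1.
Qed.

(** The smaller of the two values is the larger one times an exponential, which lies above its
    tangent at 0; the larger value is at most 1. *)
Lemma damp_lipschitz s x y : 0 <= s -> `|damp s x - damp s y| <= s * `|x - y|.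
Proof.
move=> s0; wlog xy : x y / damp s y <= damp s x.
  move=> H; have /orP[h|h] := le_total (damp s y) (damp s x); first exact: H.
  by rewrite distrC (distrC x); exact: H.
rewrite ger0_norm ?subr_ge0//.
have h : 1 + (s * `|x| - s * `|y|) <= expR (s * `|x| - s * `|y|) by exact: expR_ge1Dx.
have yx : damp s y = damp s x * expR (s * `|x| - s * `|y|).
  by rewrite /damp -expRD; congr expR; ring.
have d1 := damp_le1 x s0; have d0 := damp_ge0 s x.
have n1 : `|y| - `|x| <= `|x - y|.
  by rewrite distrC (le_trans (lerB_dist _ _)).
apply: (@le_trans _ _ (damp s x * (s * (`|y| - `|x|)))).
  by rewrite yx; have := ler_wpM2l d0 h; lra.
apply: (@le_trans _ _ (damp s x * (s * `|x - y|))).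
  by rewrite !ler_wpM2l.
by rewrite ler_piMl// mulr_ge0.
Qed.

End damping.

(** * Continuity theorem for Laplace transforms *)

Section laplace_continuity.
Context (R : realType).

Lemma bernoulli_inequality (z : R) n : -1 <= z -> 1 + n%:R * z <= (1 + z) ^+ n.
Proof.
move=> z1; elim: n => [|n IH]; first by rewrite mul0r addr0 expr0.
have h : 0 <= 1 + z by lra.
rewrite exprS (le_trans _ (ler_wpM2l h IH))// -natr1.
have : 0 <= n%:R * z ^+ 2 by rewrite mulr_ge0// sqr_ge0.
by rewrite expr2; lra.
Qed.

(** The device of elementary proofs of the Stone-Weierstrass theorem: take [N] close to [K ^ n] with
    [K * b < 1 < K * a]. Bernoulli gives [(1 - y ^ n) ^ N >= 1 - N y ^ n >= 1 - (K b) ^ n] for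
    [y <= b]. For [y >= a], the product of [(1 - y ^ n) ^ N] and [(1 + y ^ n) ^ N] is at most 1, and
    the second factor is at least [N y ^ n], which is large. *)
Lemma polynomial_step (a b e : R) : 0 < b -> b < a -> 0 < e ->
  exists n N, forall y : R, 0 <= y <= 1 ->
    [/\ 0 <= (1 - y ^+ n) ^+ N <= 1,
        a <= y -> (1 - y ^+ n) ^+ N <= e &
        y <= b -> 1 - e <= (1 - y ^+ n) ^+ N].
Proof.
move=> b0 ba e0; pose K := 2 / (a + b).
have a0 : 0 < a by lra.
have ab0 : 0 < a + b by lra.
have K0 : 0 < K by rewrite divr_gt0.
have Kb : K * b < 1 by rewrite /K mulrAC ltr_pdivrMr//; lra.
have Ka : 1 < K * a by rewrite /K mulrAC ltr_pdivlMr//; lra.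
have Ka0 : 0 < K * a by lra.
(* The additional 1 in the second bound pays for rounding [K ^+ n] down to the integer [N]. *)
have [n [n1 n2]] : exists n, (K * b) ^+ n <= e /\ 1 + e^-1 <= (K * a) ^+ n.
  have c1 : (K * b) ^+ n @[n --> \oo] --> 0.
    by apply: cvg_expr; rewrite ger0_norm// mulr_ge0 ?(ltW K0) ?(ltW b0).
  have c2 : (K * a)^-1 ^+ n @[n --> \oo] --> 0.
    apply: cvg_expr; rewrite ger0_norm ?invr_ge0 ?(ltW Ka0)//.
    by rewrite invf_lt1.
  have e1 : 0 < (1 + e^-1)^-1 by rewrite invr_gt0 addr_gt0 ?invr_gt0.
  near \oo => n; exists n; split.
    by near: n; apply: (cvgr_le 0 c1).
  rewrite -lef_pV2 ?posrE ?exprn_gt0 ?mulr_gt0 ?addr_gt0 ?invr_gt0//.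
  by rewrite -exprVn; near: n; apply: (cvgr_le 0 c2).
exists n, (Num.truncn (K ^+ n)) => y /andP[y0 y1].
have Kn : 0 <= K ^+ n by rewrite exprn_ge0// ltW.
have /andP[N1 N2] := Num.Theory.truncn_itv Kn.
set N := Num.truncn _ in N1 N2 *.
set z := y ^+ n.
have z0 : 0 <= z by rewrite exprn_ge0.
have z1 : z <= 1 by rewrite exprn_ile1.
have q0 : 0 <= (1 - z) ^+ N by rewrite exprn_ge0// subr_ge0.
split.
- by rewrite q0 exprn_ile1 ?subr_ge0// gerBl.
- move=> ay.
  have h1 : 1 + N%:R * z <= (1 + z) ^+ N by apply: bernoulli_inequality; lra.
  have h2 : e^-1 <= N%:R * z.
    have : (K * a) ^+ n <= K ^+ n * z.
      by rewrite exprMn ler_wpM2l// /z lerXn2r ?nnegrE ?(ltW a0).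
    move=> h; have : K ^+ n * z <= (N%:R + 1) * z by rewrite ler_wpM2r// natr1 ltW.
    by lra.
  have h3 : (1 - z) ^+ N * (1 + z) ^+ N <= 1.
    rewrite -exprMn exprn_ile1//; last nra.
    by rewrite mulr_ge0; lra.
  have h4 : (1 - z) ^+ N * e^-1 <= 1.
    by apply: le_trans h3; rewrite ler_wpM2l//; lra.
  by rewrite ler_pdivrMr// mul1r in h4.
- move=> yb.
  have h1 : 1 + N%:R * (- z) <= (1 + - z) ^+ N by apply: bernoulli_inequality; lra.
  have h2 : z <= b ^+ n by rewrite /z lerXn2r ?nnegrE ?(ltW b0).
  have h3 : N%:R * z <= (K * b) ^+ n by rewrite exprMn ler_pM.
  by lra.
Unshelve. all: by end_near.
Qed.

(** With [y = exp (- x)], the points [x <= u] become [y >= exp (- u)] and the points [x > v] become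
    [y < exp (- v)], so one minus the polynomial step lies between the indicators of the two
    half-lines up to [e]. The exponents are chosen before [mu]: one polynomial serves a whole
    sequence of laws and its limit. *)
Lemma laplace_sandwich (u v e : R) : u < v -> 0 < e ->
  exists n N, forall mu : probability R R, mu `]-oo, 0[%classic = 0%E ->
    let q := \int[mu]_x (1 - damp 1 x ^+ n) ^+ N in
    fine (mu `]-oo, u]%classic) <= 1 - q + e /\
    1 - q <= fine (mu `]-oo, v]%classic) + e.
Proof.
move=> uv e0.
have [|n [N H]] := @polynomial_step (expR (- u)) (expR (- v)) e (expR_gt0 _) _ e0.
  by rewrite ltr_expR ltrN2.
exists n, N => mu mu0 /=.
have bq : bounded_measurable (fun x : R => (1 - damp 1 x ^+ n) ^+ N).
  apply: bounded_measurableX; apply: bounded_measurableB.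
    exact: bounded_measurable_cst.
  by apply: bounded_measurableX; exact: bounded_measurable_damp.
have b1 := @bounded_measurable_cst R _ R 1.
have be := @bounded_measurable_cst R _ R e.
have bi (w : R) : bounded_measurable (\1_(`]-oo, w]%classic : set R) : R -> R).
  exact: bounded_measurable_indic.
have pos : {ae mu, forall x, 0 <= x}.
  exists `]-oo, 0[%classic; split => // x /= /negP.
  by rewrite in_itv/= -ltNge.
have q1 : 1 - \int[mu]_x (1 - damp 1 x ^+ n) ^+ N =
    \int[mu]_x (1 - (1 - damp 1 x ^+ n) ^+ N).
  by rewrite expectedB// expected_cst.
have fE w : fine (mu `]-oo, w]%classic) = \int[mu]_x \1_(`]-oo, w]%classic) x.
  by rewrite expected_indic.
rewrite q1 !fE; split.
- rewrite -[e in leRHS](expected_cst mu) -expectedD//; last exact: bounded_measurableB.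
  apply: expected_ae_le => //.
    by apply: bounded_measurableD => //; exact: bounded_measurableB.
  apply: filterS pos => x x0.
  have [] := H (damp 1 x); first by rewrite damp_ge0 damp_le1.
  move=> /andP[qx0 qx1] Ha _; rewrite indicE mem_setE in_itv/=.
  case: (leP x u) => xu /=; last lra.
  have : expR (- u) <= damp 1 x by rewrite /damp ger0_norm// mul1r ler_expR lerN2.
  by move=> /Ha; lra.
- rewrite -[e in leRHS](expected_cst mu) -expectedD//.
  apply: expected_ae_le => //; first exact: bounded_measurableB.
    by apply: bounded_measurableD => //; exact: bounded_measurableB.
  apply: filterS pos => x x0.
  have [] := H (damp 1 x); first by rewrite damp_ge0 damp_le1.
  move=> /andP[qx0 qx1] _ Hb; rewrite indicE mem_setE in_itv/=.
  case: (leP x v) => xv /=; first lra.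
  have : damp 1 x <= expR (- v) by rewrite /damp ger0_norm// mul1r ler_expR lerN2 ltW.
  by move=> /Hb; lra.
Qed.

Lemma laplace_continuity (mu : nat -> probability R R) (nu : probability R R) :
  (forall k, mu k `]-oo, 0[%classic = 0%E) -> nu `]-oo, 0[%classic = 0%E ->
  (forall n, (0 < n)%N ->
     \int[mu k]_x damp n%:R x @[k --> \oo] --> \int[nu]_x damp n%:R x) ->
  forall x : R, {for x, continuous (fun y => nu `]-oo, y]%classic)} ->
  mu k `]-oo, x]%classic @[k --> \oo] --> nu `]-oo, x]%classic.
Proof.
move=> mu0 nu0 cv x cx.
have fnu (m : probability R R) y : m `]-oo, y]%classic \is a fin_num.
  exact: fin_num_measure.
have qcv n N : \int[mu k]_x (1 - damp 1 x ^+ n) ^+ N @[k --> \oo] -->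
    \int[nu]_x (1 - damp 1 x ^+ n) ^+ N.
  (* Expanding the polynomial makes the integral a linear combination of transforms at integers; the
     index 0 gives the constant 1. *)
  pose p : {poly R} := (1 - 'X^n) ^+ N.
  have bd i : bounded_measurable (fun x : R => p`_i * damp 1 x ^+ i).
    apply: bounded_measurableM; first exact: bounded_measurable_cst.
    by apply: bounded_measurableX; exact: bounded_measurable_damp.
  have E (m : probability R R) : \int[m]_x (1 - damp 1 x ^+ n) ^+ N =
      \sum_(i < size p) p`_i * \int[m]_x damp i%:R x.
    transitivity (\int[m]_x (\sum_(i < size p) p`_i * damp 1 x ^+ i)).
      apply: eq_Rintegral => y _; rewrite -horner_coef /p horner_exp.
      by rewrite hornerD hornerN hornerXn hornerC.
    rewrite expected_sum//; apply: eq_bigr => i _.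
    rewrite expectedZ; last by apply: bounded_measurableX; exact: bounded_measurable_damp.
    by congr (_ * _); apply: eq_Rintegral => y _; rewrite dampX mulr1.
  under eq_fun do rewrite E.
  rewrite E; apply: cvg_sumr => i; apply: cvgM; first exact: cvg_cst.
  case: i => -[|i] ip /=; last exact: cv.
  have D1 (m : probability R R) : \int[m]_x damp 0%:R x = 1.
    by under eq_Rintegral do rewrite damp0l; exact: expected_cst.
  by under eq_fun do rewrite D1; rewrite D1; exact: cvg_cst.
have fcx : fine (nu `]-oo, y]%classic) @[y --> x] --> fine (nu `]-oo, x]%classic).
  apply: fine_cvg; rewrite fineK//; exact: cx.
rewrite -(fineK (fnu nu x)); apply/fine_cvgP; split; first exact: nearW.
apply/cvgrPdist_le => /= e e0.
(* One quarter each for the sandwich of [mu k], the convergence of the polynomial integrals, the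
   sandwich of [nu], and the continuity of the limit at [x]. *)
pose e' := e / 4.
have e'0 : 0 < e' by rewrite divr_gt0.
have /cvgrPdist_le/(_ _ e'0)[dl /= dl0 Hdl] := fcx.
have near_x y : `|x - y| <= dl / 2 ->
    `|fine (nu `]-oo, x]%classic) - fine (nu `]-oo, y]%classic)| <= e'.
  by move=> h; apply: Hdl; rewrite /ball/=; lra.
have xv : x < x + dl / 2 by rewrite ltrDl divr_gt0.
have ux : x - dl / 2 < x by rewrite gtrBl divr_gt0.
have [n [N H]] := laplace_sandwich xv e'0.
have [n' [N' H']] := laplace_sandwich ux e'0.
have := near_x (x + dl / 2); rewrite opprD addNKr normrN gtr0_norm ?divr_gt0//.
move=> /(_ (lexx _)); rewrite ler_norml => /andP[hv _].
have := near_x (x - dl / 2); rewrite opprB addrC subrK gtr0_norm ?divr_gt0//.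
move=> /(_ (lexx _)); rewrite ler_norml => /andP[_ hu].
have [h1 h2] := H _ nu0.
have [h1' h2'] := H' _ nu0.
have /cvgrPdist_le/(_ _ e'0) c := qcv n N.
have /cvgrPdist_le/(_ _ e'0) c' := qcv n' N'.
near=> k.
have [g1 g2] := H _ (mu0 k).
have [g1' g2'] := H' _ (mu0 k).
have : `|\int[nu]_x (1 - damp 1 x ^+ n) ^+ N -
    \int[mu k]_x (1 - damp 1 x ^+ n) ^+ N| <= e' by near: k.
rewrite ler_norml => /andP[m1 m2].
have : `|\int[nu]_x (1 - damp 1 x ^+ n') ^+ N' -
    \int[mu k]_x (1 - damp 1 x ^+ n') ^+ N'| <= e' by near: k.
rewrite ler_norml => /andP[m1' m2'].
have -> : e = 4 * e' by rewrite /e'; field.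
by rewrite ler_norml; apply/andP; split; lra.
Unshelve. all: by end_near.
Qed.

End laplace_continuity.

(** * Expansion of the transform of a requirement at 0 *)

Section taylor_expRN.
Context (R : realType).

Lemma ge0_antiderivative (f df : R -> R) :
  (forall x : R, is_derive x 1 f (df x)) -> f 0 = 0 ->
  (forall x, 0 <= x -> 0 <= df x) -> forall x, 0 <= x -> 0 <= f x.
Proof.
move=> fdf f0 df0 x; rewrite le_eqVlt => /predU1P[<-|x0]; first by rewrite f0.
have [] := @MVT R f df 0 x x0 (fun y _ => fdf y).
  apply: continuous_subspaceT => y; apply: differentiable_continuous.
  by apply/derivable1_diffP; apply: ex_derive.
move=> c; rewrite in_itv/= => /andP[c0 _]; rewrite f0 !subr0 => ->.
by rewrite mulr_ge0 ?df0// ltW.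
Qed.

(** Each of the three differences vanishes at 0, and the second and the third have the preceding one
    as derivative, so positivity passes along. *)
Lemma taylor_expRN (y : R) : 0 <= y ->
  [/\ 0 <= expR (- y) - 1 + y, expR (- y) - 1 + y <= y ^+ 2 / 2 &
      y ^+ 2 / 2 - y ^+ 3 / 6 <= expR (- y) - 1 + y].
Proof.
move=> y0.
have h1 (x : R) : 0 <= x -> 0 <= expR (- x) - 1 + x.
  by move=> _; have := expR_ge1Dx (- x); lra.
have h2 : forall x : R, 0 <= x -> 0 <= x ^+ 2 / 2 - (expR (- x) - 1 + x).
  apply: (@ge0_antiderivative (fun x : R => x ^+ 2 / 2 - (expR (- x) - 1 + x))
    (fun x => expR (- x) - 1 + x)) => //; last first.
    by rewrite expr0n/= mul0r oppr0 expR0; lra.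
  move=> z; apply: is_derive_eq; rewrite /GRing.scale /=; lra.
have h3 : forall x : R, 0 <= x -> 0 <= (expR (- x) - 1 + x) - (x ^+ 2 / 2 - x ^+ 3 / 6).
  apply: (@ge0_antiderivative
    (fun x : R => (expR (- x) - 1 + x) - (x ^+ 2 / 2 - x ^+ 3 / 6))
    (fun x => x ^+ 2 / 2 - (expR (- x) - 1 + x))) => //; last first.
    by rewrite !expr0n/= !mul0r oppr0 expR0; lra.
  move=> z; apply: is_derive_eq; rewrite /GRing.scale /=; lra.
have := h1 _ y0; have := h2 _ y0; have := h3 _ y0.
by split; lra.
Qed.

End taylor_expRN.

Section requirement.
Context (R : realType) (H : probability R R).
Hypothesis hH : requirement_distribution H.

Let ae_ge0 : {ae H, forall x, 0 <= x}.
Proof.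
have [H0 _] := hH; exists `]-oo, 0[%classic; split => // x /= /negP.
by rewrite in_itv/= -ltNge.
Qed.

Let integrable2 : H.-integrable setT (EFin \o (fun x : R => x ^+ 2)).
Proof.
have [_ H2] := hH; apply/integrableP; split.
  by apply/measurable_EFinP; exact: measurable_funX.
by under eq_integral do rewrite /= ger0_norm ?sqr_ge0//.
Qed.

Let integrable1 : H.-integrable setT (EFin \o (fun x : R => x)).
Proof.
apply: (@le_integrable _ _ _ _ _ measurableT _ (EFin \o (fun x : R => 1 + x ^+ 2))) => //.
- by apply/measurable_EFinP; exact: measurable_id.
- move=> x _ /=; rewrite lee_fin [leRHS]ger0_norm ?addr_ge0 ?sqr_ge0//.
  by rewrite ler_norml; apply/andP; split; nra.
- by apply: integrable_EFinD => //; exact/bounded_measurable_integrable/bounded_measurable_cst.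
Qed.

Let moment_ge0 n : 0 <= moment H n.
Proof.
have -> : moment H n = \int[H]_x (`|x| ^+ n).
  congr fine; apply: ae_eq_integral => //.
  - by apply/measurable_EFinP; exact: measurable_funX.
  - by apply/measurable_EFinP; apply: measurable_funX; exact: normr_measurable.
  - by apply: filterS ae_ge0 => x x0 _ /=; rewrite ger0_norm.
by apply: Rintegral_ge0.
Qed.

Lemma moment1_ge0 : 0 <= moment H 1. Proof. exact: moment_ge0. Qed.

Lemma moment2_ge0 : 0 <= moment H 2. Proof. exact: moment_ge0. Qed.

(** With [e] the mean, [x <= x ^ 2 / (2 e) + e / 2]; integrating when the second moment is 0 would
    give [e <= e / 2]. *)
Lemma moment2_gt0 : 0 < moment H 1 -> 0 < moment H 2.
Proof.
move=> m1; rewrite lt_neqAle moment2_ge0 andbT; apply/negP => /eqP m2.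
suff : moment H 1 <= moment H 1 / 2 by lra.
set e := moment H 1 in m1 *.
have ie : H.-integrable setT (EFin \o (fun x : R => (2 * e)^-1 * x ^+ 2)).
  exact: integrable_EFinZ.
have ic : H.-integrable setT (EFin \o (fun _ : R => e / 2)).
  exact/bounded_measurable_integrable/bounded_measurable_cst.
apply: (@le_trans _ _ (\int[H]_x ((2 * e)^-1 * x ^+ 2 + e / 2))).
  apply: le_Rintegral => //.
    exact: integrable_EFinD.
  move=> x _; rewrite expr1.
  have : 0 <= (x - e) ^+ 2 / (2 * e) by rewrite divr_ge0 ?sqr_ge0//; lra.
  have -> : (x - e) ^+ 2 / (2 * e) = (2 * e)^-1 * x ^+ 2 + e / 2 - x.
    by field; rewrite gt_eqF.
  by lra.
rewrite RintegralD// (expected_cst H (e / 2)) RintegralZl//.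
by move: m2; rewrite /moment => <-; rewrite mulr0 add0r.
Qed.

Definition laplace s := \int[H]_x damp s x.

(** The remainder of the first-order expansion of the transform at 0, divided by [s ^+ 2]. It
    carries the second moment into the limit. *)
Definition laplace_rem s := (laplace s - 1 + s * moment H 1) / s ^+ 2.

Lemma laplaceE (s : R) : 0 < s -> 1 - laplace s = s * moment H 1 - s ^+ 2 * laplace_rem s.
Proof. by move=> s0; rewrite /laplace_rem; field; rewrite gt_eqF. Qed.

Let remE (s : R) : 0 < s -> laplace_rem s =
  \int[H]_x ((damp s x - 1 + s * `|x|) / s ^+ 2).
Proof.
move=> s0.
have i1 : H.-integrable setT (EFin \o (fun x : R => damp s x - 1)).
  apply/bounded_measurable_integrable/bounded_measurableB.
    by apply: bounded_measurable_damp => //; exact: ltW.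
  exact: bounded_measurable_cst.
have ix : H.-integrable setT (EFin \o (fun x : R => `|x|)).
  exact: (integrable_norm integrable1).
have i2 : H.-integrable setT (EFin \o (fun x : R => s * `|x|)).
  exact: integrable_EFinZ.
have i3 : H.-integrable setT (EFin \o (fun x : R => damp s x - 1 + s * `|x|)).
  exact: integrable_EFinD.
rewrite RintegralZr// /laplace_rem; congr (_ / _).
rewrite RintegralD// RintegralZl// expectedB; last 2 first.
- by apply: bounded_measurable_damp => //; exact: ltW.
- exact: bounded_measurable_cst.
rewrite expected_cst; congr (_ + s * _); congr fine; apply: ae_eq_integral => //.
- by apply/measurable_EFinP; exact: measurable_funX.
- by apply/measurable_EFinP; exact: normr_measurable.
- by apply: filterS ae_ge0 => x x0 _ /=; rewrite expr1 ger0_norm.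
Qed.

Let rem_bound (s x : R) : 0 < s ->
  0 <= (damp s x - 1 + s * `|x|) / s ^+ 2 <= x ^+ 2 / 2.
Proof.
move=> s0; have [h1 h2 _] := @taylor_expRN _ (s * `|x|) (mulr_ge0 (ltW s0) (normr_ge0 x)).
rewrite divr_ge0 ?exprn_ge0 ?(ltW s0)//= ler_pdivrMr ?exprn_gt0//.
by rewrite (le_trans h2)// exprMn real_normK ?num_real//; lra.
Qed.

Lemma laplace_rem_ge0 (s : R) : 0 < s -> 0 <= laplace_rem s.
Proof.
move=> s0; rewrite remE//; apply: Rintegral_ge0 => x _.
by case/andP: (rem_bound x s0).
Qed.

(** Dominated convergence: the integrand lies between 0 and [x ^ 2 / 2], which is integrable. The
    cubic term of the Taylor bound serves only for the convergence at each fixed [x]. *)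
Lemma laplace_rem_cvg (s : nat -> R) : (forall n, 0 < s n) -> s n @[n --> \oo] --> 0 ->
  laplace_rem (s n) @[n --> \oo] --> moment H 2 / 2.
Proof.
move=> s0 cs; under eq_fun do rewrite remE//.
rewrite /moment -RintegralZr//.
apply: (@expected_dominated_cvg _ _ _ H
  (fun n x => (damp (s n) x - 1 + s n * `|x|) / s n ^+ 2) (fun x => x ^+ 2 / 2)
  (fun x => x ^+ 2)) => //.
- move=> n; apply: measurable_funM; last exact: measurable_cst.
  apply: measurable_funD.
    by apply: measurable_funB; [exact: measurable_damp|exact: measurable_cst].
  by apply: measurable_funM; [exact: measurable_cst|exact: normr_measurable].
- by apply: measurable_funM; [exact: measurable_funX|exact: measurable_cst].
- apply: aeW => x n; have /andP[h1 h2] := rem_bound x (s0 n).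
  rewrite ger0_norm// (le_trans h2)//.
  by have := sqr_ge0 x; lra.
- apply: aeW => x.
  apply: (@cvg_dist_le _ _ (fun n => s n * (`|x| ^+ 3 / 6))); last first.
    by rewrite -[X in _ --> X](mul0r (`|x| ^+ 3 / 6)); apply: cvgM => //; exact: cvg_cst.
  apply: nearW => n.
  have /andP[_ h2] := rem_bound x (s0 n).
  have [_ _ h3] := @taylor_expRN _ (s n * `|x|) (mulr_ge0 (ltW (s0 n)) (normr_ge0 x)).
  rewrite distrC ger0_norm ?subr_ge0// lerBlDr -lerBlDl.
  rewrite ler_pdivlMr ?exprn_gt0//; apply: le_trans h3.
  rewrite !exprMn real_normK ?num_real//; lra.
Qed.

Lemma laplace_bound (s : R) : 0 < s -> 0 <= 1 - laplace s <= s * moment H 1.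
Proof.
move=> s0; apply/andP; split.
  rewrite subr_ge0 -[leRHS](expected_cst H); apply: expected_ae_le.
  - by apply: bounded_measurable_damp => //; exact: ltW.
  - exact: bounded_measurable_cst.
  - by apply: aeW => x; rewrite damp_le1// ltW.
rewrite laplaceE// gerBl mulr_ge0 ?exprn_ge0 ?laplace_rem_ge0// ltW//.
Qed.

Lemma laplace0 : laplace 0 = 1.
Proof. by rewrite /laplace; under eq_Rintegral do rewrite damp0l; exact: expected_cst. Qed.

End requirement.

(** * The workload along a path *)

Section time_integrals.
Context (R : realType).
Local Notation leb := (@lebesgue_measure R).
Implicit Types (f : R -> R) (t u M : R).

Lemma integrable_time f t M : measurable_fun (`[0, +oo[%classic : set R) f ->
  (forall u, 0 <= u <= t -> 0 <= f u <= M) ->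
  leb.-integrable `[0, t] (EFin \o f).
Proof.
move=> mf fM; apply: measurable_bounded_integrable => //.
- by rewrite /= lebesgue_measure_itv /=; case: ifP => // _; rewrite -EFinB ltry.
- by apply: measurable_funS mf => // x /=; rewrite !in_itv/= andbT => /andP[].
- exists M; split; first exact: num_real.
  move=> y My x /=; rewrite in_itv/= => /fM/andP[h1 h2].
  by rewrite ger0_norm// (le_trans h2)// ltW.
Qed.

Lemma Rintegral_time_cst t r : 0 <= t -> \int[leb]_(u in `[0, t]) r = r * t.
Proof.
move=> t0; rewrite Rintegral_cst// /= lebesgue_measure_itv /= lte_fin.
move: t0; rewrite le_eqVlt => /predU1P[<-|t0]; first by rewrite ltxx.
by rewrite t0 oppr0 adde0.
Qed.

Lemma Rintegral_time_le f t M : 0 <= t -> measurable_fun (`[0, +oo[%classic : set R) f ->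
  (forall u, 0 <= u <= t -> 0 <= f u <= M) ->
  0 <= \int[leb]_(u in `[0, t]) f u <= M * t.
Proof.
move=> t0 mf fM; apply/andP; split.
  by apply: Rintegral_ge0 => x /=; rewrite in_itv/= => /fM/andP[].
rewrite -Rintegral_time_cst//; apply: le_Rintegral => //.
- exact: integrable_time fM.
- apply: (@integrable_time _ _ M) => // u /fM/andP[h1 h2].
  by rewrite lexx andbT (le_trans h1).
- by move=> x /=; rewrite in_itv/= => /fM/andP[].
Qed.

Lemma Rintegral_time_sum (I : Type) (s : seq I) (F : I -> R -> R) t :
  (forall i, leb.-integrable `[0, t] (EFin \o F i)) ->
  leb.-integrable `[0, t] (EFin \o (fun u => \sum_(i <- s) F i u)) /\
  \int[leb]_(u in `[0, t]) (\sum_(i <- s) F i u) =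
  \sum_(i <- s) \int[leb]_(u in `[0, t]) F i u.
Proof.
move=> iF; elim: s => [|i s [IH1 IH2]].
  split.
    rewrite (_ : _ \o _ = cst 0%E); first exact: integrable0.
    by apply/funext => u /=; rewrite big_nil.
  under eq_Rintegral do rewrite big_nil; rewrite big_nil.
  by rewrite /Rintegral integral0.
split.
  rewrite (_ : (fun u => _) = fun u => F i u + \sum_(i <- s) F i u); last first.
    by apply/funext => u; rewrite big_cons.
  exact: (integrable_EFinD _ (iF i) IH1).
under eq_Rintegral do rewrite big_cons.
by rewrite big_cons RintegralD// IH2.
Qed.

(* A reserve fed by the nondecreasing [off] and depleted at rate [f] only while
   it is positive stays nonnegative: look at the last time it was so. *)
Lemma regulated_ge0 f off t M : 0 <= t -> measurable_fun (`[0, +oo[%classic : set R) f ->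
  (forall u, 0 <= u <= t -> 0 <= f u <= M) ->
  (forall u, 0 <= u <= t -> off u <= off t) -> 0 <= off t ->
  (forall u, 0 <= u <= t ->
     off u - \int[leb]_(v in `[0, u]) f v <= 0 -> f u = 0) ->
  0 <= off t - \int[leb]_(v in `[0, t]) f v.
Proof.
move=> t0 mf fM mono off0 f0; rewrite leNgt; apply/negP => neg.
pose F u := \int[leb]_(v in `[0, u]) f v.
have itv : leb.-integrable `[0, t] (EFin \o f) by exact: integrable_time fM.
have split u : 0 <= u <= t -> F t - F u = \int[leb]_(v in `]u, t]) f v.
  move=> ut; have /andP[u0 ut'] := ut.
  by rewrite /F Rintegral_itvB ?bnd_simp//; exact: itv.
(* [S] contains the times at which consumption has not exceeded the final supply. Beyond its
   supremum the reserve is nonpositive, so nothing more is consumed. *)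
pose S := [set u | 0 <= u <= t /\ F u <= off t].
have S0 : S 0.
  by split; [rewrite lexx|rewrite /F set_itv1 Rintegral_set1].
have hS : has_sup S.
  by split; [exists 0|exists t => u [/andP[]]].
pose tau := sup S.
have tau0 : 0 <= tau by apply: ub_le_sup => //; case: hS.
have taut : tau <= t by apply: ge_sup; [exists 0|move=> u [/andP[]]].
have M0 : 0 <= M.
  by have /andP[h1 h2] := fM 0 (ltac:(by rewrite lexx t0)); exact: le_trans h1 h2.
have M1 : 0 < M + 1 by lra.
have Ft : off t < F t by move: neg; rewrite subr_lt0.
(* A point [u] of [S] this close to [tau] replaces the continuity of [F]: from [u] on at most
   [M * (tau - u)] is consumed, which is less than the supposed excess [F t - off t]. *)
have gap0 : 0 < (F t - off t) / (M + 1) by rewrite divr_gt0// subr_gt0.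
have [u Su] := sup_adherent gap0 hS; rewrite -/tau => tauu.
have [ut Fu] := Su; have /andP[u0 ut'] := ut.
have utau : u <= tau by apply: ub_le_sup => //; case: hS.
have f_gt v : tau < v -> v <= t -> f v = 0.
  move=> tv vt; have v0t : 0 <= v <= t by rewrite vt andbT (le_trans tau0)// ltW.
  apply: f0 => //; rewrite -/(F v) subr_le0 (le_trans (mono _ v0t))//.
  apply: ltW; rewrite ltNge; apply/negP => Fv.
  suff : v <= tau by rewrite leNgt tv.
  by apply: ub_le_sup; [case: hS|].
have iu : leb.-integrable `]u, t] (EFin \o f).
  apply: integrableS itv => // x /=; rewrite !in_itv/= => /andP[h1 ->].
  by rewrite (le_trans u0)// ltW.
have : F t - F u <= M * (tau - u).
  rewrite split//.
  have -> : \int[leb]_(v in `]u, t]) f v = \int[leb]_(v in `]u, tau]) f v.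
    apply/eqP; rewrite -subr_eq0 Rintegral_itvB ?bnd_simp//.
    apply/eqP; rewrite (_ : \int[leb]_(v in _) f v = \int[leb]_(v in `]tau, t]) 0).
      by rewrite /Rintegral integral0.
    apply: eq_Rintegral => v; rewrite inE /= in_itv/= => /andP[h1 h2]; exact: f_gt.
  have -> : M * (tau - u) = \int[leb]_(v in `]u, tau]) M.
    rewrite Rintegral_cst//= lebesgue_measure_itv /= lte_fin.
    move: utau; rewrite le_eqVlt => /predU1P[->|utau]; first by rewrite ltxx subrr.
    by rewrite utau.
  have sub : `]u, tau] `<=` `[0, t].
    move=> x /=; rewrite !in_itv/= => /andP[h1 h2].
    by rewrite (le_trans u0 (ltW h1)) (le_trans h2).
  apply: le_Rintegral => //.
  - exact: integrableS itv.
  - have iM : leb.-integrable `[0, t] (EFin \o (fun=> M)).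
      by apply: (@integrable_time _ _ M) => // v _; rewrite lexx andbT.
    exact: integrableS iM.
  - by move=> x /sub /=; rewrite in_itv/= => /fM/andP[].
have : M * (tau - u) <= M * ((F t - off t) / (M + 1)).
  by rewrite ler_wpM2l//; lra.
have : M * ((F t - off t) / (M + 1)) < F t - off t.
  have -> : M * ((F t - off t) / (M + 1)) = F t - off t - (F t - off t) / (M + 1).
    by field; rewrite gt_eqF.
  by rewrite gtrBl.
by lra.
Qed.

(* A right-continuous step function is the pointwise limit of its values at the
   grid points immediately to the right. *)
Lemma measurable_right_continuous_steps (I : Type) (J : R -> I) (f : I -> R) :
  (forall t, 0 <= t -> \forall s \near t^'+, J s = J t) ->
  measurable_fun (`[0, +oo[%classic : set R) (fun u => f (J u)).
Proof.
move=> rc.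
pose g (n : nat) (u : R) : R :=
  (Num.truncn (n.+1%:R * u)).+1%:R / n.+1%:R.
have trunc_itv (n : nat) (u : R) : 0 <= u ->
    (Num.truncn (n.+1%:R * u))%:R <= n.+1%:R * u < (Num.truncn (n.+1%:R * u)).+1%:R.
  by move=> u0; apply: Num.Theory.truncn_itv; rewrite mulr_ge0.
apply: (@measurable_fun_cvg _ _ _ _ (fun n u => f (J (g n u)))).
- move=> n _ Y mY.
  pose A (k : nat) : set R := [set u | 0 <= u /\ k%:R <= n.+1%:R * u < k.+1%:R].
  rewrite (_ : _ `&` _ =
    \bigcup_(k in [set k | Y (f (J (k.+1%:R / n.+1%:R)))]) A k); last first.
    apply/seteqP; split => u.
      move=> [/=]; rewrite in_itv/= andbT => u0 Yu.
      by exists (Num.truncn (n.+1%:R * u)) => //; split => //; exact: trunc_itv.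
    move=> [k /= Yk [u0 /andP[k1 k2]]]; split; first by rewrite /= in_itv/= u0.
    have -> : f (J (g n u)) = f (J (k.+1%:R / n.+1%:R)); last by [].
    rewrite /g; congr (f (J (_.+1%:R / _))).
    by apply/eqP; rewrite Num.Theory.truncn_eq ?k1// mulr_ge0.
  apply: bigcup_measurable => k _.
  rewrite (_ : A k = `[0, +oo[ `&` `[k%:R / n.+1%:R, k.+1%:R / n.+1%:R[); last first.
    apply/seteqP; split => u; rewrite /A /= !in_itv/= andbT.
      by move=> [u0 /andP[h1 h2]]; split=> //; rewrite ler_pdivrMr// ltr_pdivlMr// mulrC h1.
    by move=> [u0]; rewrite ler_pdivrMr// ltr_pdivlMr// mulrC.
  by apply: measurableI.
- move=> u /=; rewrite in_itv/= andbT => u0.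
  apply: cvg_near_cst.
  have [e /= e0 He] := rc u u0.
  near=> n.
  have gu : u < g n u by rewrite /g ltr_pdivlMr// mulrC; case/andP: (trunc_itv n u u0).
  congr f; apply: He => //=.
  rewrite distrC gtr0_norm ?subr_gt0//.
  apply: (@le_lt_trans _ _ n.+1%:R^-1); last first.
    near: n; exact: (cvgr_lt 0 (@cvg_harmonic R) _ e0).
  rewrite lerBlDr /g ler_pdivrMr// mulrDl mulVf ?pnatr_eq0// -natr1 addrC lerD2l.
  by rewrite [leRHS]mulrC; case/andP: (trunc_itv n u u0).
Unshelve. all: by end_near.
Qed.

End time_integrals.

(** * The workload up to the second arrival *)

Section workload_path.
Context (R : realType) (D : nat) (d : measure_display) (T : measurableType d)
  (P : probability T R) (lam c : 'I_D -> R) (sigma : discipline R)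
  (X : mmqueue D P) (w : T) (lm cm : R).
Hypotheses (lam_ge0 : forall i, 0 <= lam i) (lam_le : forall i, lam i <= lm)
  (c_ge0 : forall i, 0 <= c i) (c_le : forall i, c i <= cm)
  (hsigma : is_discipline sigma)
  (env_rc : forall t, 0 <= t -> \forall s \near t^'+, env X s w = env X t w)
  (hini : initial_path X w) (hres : residual_path lam c sigma X w)
  (gap_gt0 : forall k, 0 < gap X k w) (req_ge0 : forall k i, 0 <= req X k i w).
Implicit Types (t u : R) (k : customer) (j : nat).
Local Notation leb := (@lebesgue_measure R).

Let measurable_env (f : 'I_D -> R) :
  measurable_fun (`[0, +oo[%classic : set R) (fun u => f (env X u w)).
Proof. exact: (@measurable_right_continuous_steps _ _ (fun u => env X u w)). Qed.

Let intensity t := \int[leb]_(u in `[0, t]) lam (env X u w).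

Let intensity_le t : 0 <= t -> 0 <= intensity t <= lm * t.
Proof. by move=> t0; apply: Rintegral_time_le => // u _; rewrite lam_ge0 lam_le. Qed.

Let intensity_mono u t : 0 <= u -> u <= t -> intensity u <= intensity t.
Proof.
move=> u0 ut; rewrite -subr_ge0 /intensity Rintegral_itvB ?bnd_simp//.
- by apply: Rintegral_ge0.
- by apply: (@integrable_time _ _ _ lm) => // v _; rewrite lam_ge0 lam_le.
Qed.

(** The integrated intensity is at most [lm * t], which has not reached the second threshold: of the
    later customers, only [inr 0] can have arrived. This window is the one in which the workload is
    analysed. *)
Let not_arrived j t : 0 <= t -> lm * t < gap X 0 w + gap X 1 w -> (0 < j)%N ->
  arrived lam X j t w = false.
Proof.
move=> t0 tg; case: j => // j _; apply/negbTE; rewrite /arrived -ltNge.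
have /andP[_ h] := intensity_le t0; apply: (le_lt_trans h).
rewrite big_ord_recl big_ord_recl /= addrA (lt_le_trans tg)// lerDl.
by apply: sumr_ge0 => i _; exact: ltW.
Qed.

Let not_arrived0 j : arrived lam X j 0 w = false.
Proof.
apply/negbTE; rewrite /arrived -ltNge set_itv1 Rintegral_set1 big_ord_recl.
by rewrite ltr_pwDl// sumr_ge0// => i _; exact: ltW.
Qed.

Lemma no_arrival t : 0 <= t -> lm * t < gap X 0 w ->
  offered lam X (inr 0%N) t w = 0.
Proof.
move=> t0 tg; rewrite /= (_ : arrived _ _ _ _ _ = false)//.
apply/negbTE; rewrite /arrived -ltNge big_ord_recl big_ord0 addr0.
by have /andP[_ h] := intensity_le t0; exact: le_lt_trans tg.
Qed.

Let offered_ge0 k t : 0 <= offered lam X k t w.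
Proof.
by case: k => j /=; [case: hini => /(_ j)[]|case: ifP => // _; exact: req_ge0].
Qed.

Let offered_mono k u t : 0 <= u -> u <= t ->
  offered lam X k u w <= offered lam X k t w.
Proof.
case: k => j //= u0 ut; case: ifP => [au|_]; last first.
  by case: ifP => // _; exact: req_ge0.
have -> : arrived lam X j t w = true; last by [].
by apply: le_trans au _; exact: intensity_mono.
Qed.

Let service k u := c (env X u w) * share lam sigma X w u k.

Let residualE k t : 0 <= t ->
  residual X k t w = offered lam X k t w - \int[leb]_(u in `[0, t]) service k u.
Proof. by move=> t0; case: (hres k) => _; exact. Qed.

Let share_ge0 k u : 0 <= u -> 0 <= share lam sigma X w u k.
Proof. by move=> u0; case: hsigma => _ h _ _; exact: h. Qed.

(** Stated for a nonpositive remainder because it is not yet known that remainders are nonnegative;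
    that is deduced from this fact by [regulated_ge0]. *)
Let share_out k u : 0 <= u -> residual X k u w <= 0 -> share lam sigma X w u k = 0.
Proof.
move=> u0 r0; case: hsigma => _ _ h _; apply: h => //.
by rewrite /queue ltNge r0.
Qed.

Let service_ge0 k u : 0 <= u -> 0 <= service k u.
Proof. by move=> u0; rewrite mulr_ge0// share_ge0. Qed.

Let residual_le k t : 0 <= t -> residual X k t w <= offered lam X k t w.
Proof.
move=> t0; rewrite residualE// gerBl; apply: Rintegral_ge0 => u /=.
by rewrite in_itv/= => /andP[u0 _]; exact: service_ge0.
Qed.

(** A finite set outside which nothing is offered before the second arrival. It turns the sum over
    all customers into a finite one that is the same at all times of the window. *)
Let K : set customer :=
  [set inl j | j in [set j | ini_res X j w != 0]] `|` [set inr 0%N].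

Let finite_K : finite_set K.
Proof.
rewrite finite_setU; split; last exact: finite_set1.
by apply: finite_image; case: hini.
Qed.

Let offered_out k t : 0 <= t -> lm * t < gap X 0 w + gap X 1 w -> ~ K k ->
  offered lam X k t w = 0.
Proof.
move=> t0 tg; case: k => j /= nK.
  apply/eqP; apply: contra_notT nK => r0; left; by exists j.
rewrite not_arrived// lt0n; apply/eqP => j0; apply: nK; right; by rewrite j0.
Qed.

(** Writes the initial workload as a limit of sums over a fixed enumeration, from which its
    measurability with respect to the initial information is obtained. *)
Lemma initial_workload_cvg :
  \sum_(0 <= j < n) ini_res X j w @[n --> \oo] --> workload X 0 w.
Proof.
have [_ ini_fin] := hini.
have [n0 n0P] : exists n, forall j, (n <= j)%N -> ini_res X j w = 0.
  pose A := [set j : nat | ini_res X j w != 0].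
  exists (\max_(i <- finmap.enum_fset (fset_set A)) i)%N.+1.
  move=> j; apply: contraTeq => r0; rewrite -ltnNge ltnS.
  by apply: (@leq_bigmax_seq _ _ xpredT id) => //; rewrite in_fset_set// inE.
have r0E k : residual X k 0 w = offered lam X k 0 w.
  by rewrite residualE// set_itv1 Rintegral_set1 subr0.
apply: cvg_near_cst; exists n0 => // n /= n0n.
rewrite /workload -(fsbig_widen [set` [seq (inl j : customer) | j <- iota 0 n]] setT)//.
- rewrite -fsbig_seq; last by rewrite map_inj_uniq ?iota_uniq// => i j [].
  rewrite big_map /index_iota subn0; apply: eq_bigr => j _; by rewrite r0E.
- move=> k [_ nk]; rewrite /= r0E; case: k nk => j nk /=; last by rewrite not_arrived0.
  apply: n0P; rewrite leqNgt; apply/negP => jn; apply: nk => /=.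
  apply/mapP; exists j => //; rewrite mem_iota /=; exact: leq_trans n0n.
Qed.

Let present u := [set k | queue lam X w u k <> None].

Let presentE u k : present u k <-> 0 < residual X k u w.
Proof. by rewrite /present /queue /=; case: ifP. Qed.

Variable t : R.
Hypotheses (t_ge0 : 0 <= t) (t_lt : lm * t < gap X 0 w + gap X 1 w).

Let tg u : 0 <= u <= t -> lm * u < gap X 0 w + gap X 1 w.
Proof.
move=> /andP[u0 ut]; apply: le_lt_trans t_lt.
have [i|noi] := pselect (exists i : 'I_D, True).
  by case: i => i _; rewrite ler_wpM2l// (le_trans (lam_ge0 i)).
by exfalso; apply: noi; exists (env X 0 w).
Qed.

Let present_K u : 0 <= u <= t -> present u `<=` K.
Proof.
move=> ut k /presentE r0; have /andP[u0 _] := ut.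
apply: contrapT => nK; move: r0; rewrite ltNge => /negP; apply.
by rewrite (le_trans (residual_le _ u0))// offered_out// tg.
Qed.

Let present_sum u : 0 <= u <= t -> present u !=set0 ->
  \sum_(k \in present u) share lam sigma X w u k = 1.
Proof.
move=> ut p0; have /andP[u0 _] := ut; case: hsigma => _ _ _ h; apply: h => //.
exact: sub_finite_set (present_K ut) finite_K.
Qed.

Let share_le1 k u : 0 <= u <= t -> share lam sigma X w u k <= 1.
Proof.
move=> ut; have /andP[u0 _] := ut.
have [pk|/presentE/negP] := pselect (present u k); last first.
  by rewrite -leNgt => r0; rewrite share_out.
have pfin := sub_finite_set (present_K ut) finite_K.
rewrite -(present_sum ut); last by exists k.
rewrite fsbig_finite// (big_rem k)/=; last by rewrite in_fset_set// inE.
by rewrite lerDl sumr_ge0// => i _; exact: share_ge0.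
Qed.

Let service_bound k u : 0 <= u <= t -> 0 <= service k u <= cm.
Proof.
move=> ut; have /andP[u0 _] := ut.
by rewrite service_ge0//= -[leRHS]mulr1 ler_pM// ?share_ge0// share_le1.
Qed.

Let measurable_service k :
  measurable_fun (`[0, +oo[%classic : set R) (service k).
Proof. by apply: measurable_funM; [exact: measurable_env|case: (hres k)]. Qed.

Let residual_ge0 k u : 0 <= u <= t -> 0 <= residual X k u w.
Proof.
move=> ut; have /andP[u0 ut'] := ut; rewrite residualE//.
apply: (@regulated_ge0 _ (service k) (fun u => offered lam X k u w) u cm) => //.
- move=> v /andP[v0 vu]; apply: service_bound.
  by rewrite v0 (le_trans vu).
- by move=> v /andP[v0 vu]; exact: offered_mono.
- move=> v /andP[v0 vu] r0; rewrite /service share_out ?mulr0// residualE//.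
Qed.

Let residual_out k u : 0 <= u <= t -> ~ K k -> residual X k u w = 0.
Proof.
move=> ut nK; have /andP[u0 _] := ut; apply/le_anti.
by rewrite residual_ge0// andbT (le_trans (residual_le _ u0))// offered_out// tg.
Qed.

Let s := finmap.enum_fset (fset_set K).

Let workload_sum u : 0 <= u <= t -> workload X u w = \sum_(k <- s) residual X k u w.
Proof.
move=> ut; rewrite /workload -(fsbig_widen K setT)//; first exact: fsbig_finite.
by move=> k [_ nK] /=; exact: residual_out.
Qed.

Lemma workload_ge0 : 0 <= workload X t w.
Proof.
rewrite workload_sum ?t_ge0 ?lexx//; apply: sumr_ge0 => k _.
by rewrite residual_ge0// t_ge0 lexx.
Qed.

Let busy u := \sum_(k <- s) share lam sigma X w u k.

Let busyE u : 0 <= u <= t -> busy u = \sum_(k \in present u) share lam sigma X w u k.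
Proof.
move=> ut; have /andP[u0 _] := ut.
rewrite (fsbig_widen (present u) K) ?fsbig_finite//; first exact: present_K.
move=> k [_ /presentE/negP]; rewrite -leNgt => r0 /=; exact: share_out.
Qed.

Let busy_bound u : 0 <= u <= t -> 0 <= busy u <= 1.
Proof.
move=> ut; have /andP[u0 _] := ut.
rewrite {1}/busy sumr_ge0 => [|k _]; last exact: share_ge0.
rewrite busyE//; have [p0|p0] := pselect (present u !=set0).
  by rewrite present_sum//= lexx.
by move/set0P/negP/negPn/eqP : p0 => ->; rewrite fsbig_set0 ler01.
Qed.

Let busy1 u : 0 <= u <= t -> 0 < workload X u w -> busy u = 1.
Proof.
move=> ut W0; rewrite busyE// present_sum//; apply: contrapT => np.
suff W1 : workload X u w = 0 by rewrite W1 ltxx in W0.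
rewrite workload_sum// big1// => k _; apply/le_anti; rewrite residual_ge0// andbT.
by rewrite leNgt; apply/negP => r0; apply: np; exists k; exact/presentE.
Qed.

Let offered_sum : \sum_(k <- s) offered lam X k t w =
  workload X 0 w + offered lam X (inr 0%N) t w.
Proof.
rewrite workload_sum ?lexx ?t_ge0// addrC; apply/eqP; rewrite -subr_eq -sumrB.
rewrite -fsbig_finite// -(fsbig_widen [set inr 0%N] K)//=.
- rewrite fsbig_set1 residualE// set_itv1 Rintegral_set1 subr0 /=.
  by rewrite not_arrived0 subr0.
- by move=> k ->; right.
- move=> k [Kk k0] /=; rewrite residualE// set_itv1 Rintegral_set1 subr0.
  case: k Kk k0 => j Kk k0 /=; first by rewrite subrr.
  by case: Kk => [[]//|jz]; case: k0.
Qed.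

(** After summation over the customers, the discipline enters only through the total share [busy],
    which is 1 as long as the workload is positive. *)
Let workload_eq : workload X t w = workload X 0 w + offered lam X (inr 0%N) t w -
  \int[leb]_(u in `[0, t]) (c (env X u w) * busy u).
Proof.
rewrite workload_sum ?t_ge0 ?lexx// -offered_sum.
have [|_ i2] := @Rintegral_time_sum R _ s service t.
  by move=> k; apply: (@integrable_time _ _ _ cm) => // u; exact: service_bound.
under [in RHS]eq_Rintegral do rewrite /busy mulr_sumr.
by rewrite i2 -sumrB; apply: eq_bigr => k _; rewrite residualE.
Qed.

Let measurable_busy :
  measurable_fun (`[0, +oo[%classic : set R) (fun u => c (env X u w) * busy u).
Proof.
apply: measurable_funM; first exact: measurable_env.
by apply: measurable_sum => k; case: (hres k).
Qed.

Lemma workload_bounds :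
  workload X 0 w + offered lam X (inr 0%N) t w - cm * t <= workload X t w <=
  workload X 0 w + offered lam X (inr 0%N) t w.
Proof.
have /andP[h1 h2] : 0 <= \int[leb]_(u in `[0, t]) (c (env X u w) * busy u) <= cm * t.
  apply: Rintegral_time_le => // u ut; have /andP[b0 b1] := busy_bound ut.
  by rewrite mulr_ge0//= -[leRHS]mulr1 ler_pM.
by rewrite workload_eq; apply/andP; split; lra.
Qed.

Lemma workload_busy i : (forall u, 0 <= u <= t -> env X u w = i) ->
  (forall u, 0 <= u <= t -> 0 < workload X u w) ->
  workload X t w = workload X 0 w + offered lam X (inr 0%N) t w - c i * t.
Proof.
move=> Ji Wpos; rewrite workload_eq -Rintegral_time_cst//; congr (_ - _).
apply: eq_Rintegral => u; rewrite inE/= in_itv/= => ut.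
by rewrite Ji// busy1 ?mulr1//; exact: Wpos.
Qed.

(** The requirement is selected by the environment at the arrival time, an infimum lying in
    [[0, t]]. The factor 2 makes room for a half-open interval around [[0, t]]: on such an interval
    constancy of a right-continuous path can be tested at rational times. *)
Lemma offered_first_arrival i : 0 < t ->
  (forall u, 0 <= u < 2 * t -> env X u w = i) ->
  offered lam X (inr 0%N) t w =
    if gap X 0 w <= lam i * t then req X 0 i w else 0.
Proof.
move=> t0 Ji.
have intE u : 0 <= u <= t -> intensity u = lam i * u.
  move=> /andP[u0 ut]; rewrite -Rintegral_time_cst//.
  apply: eq_Rintegral => v; rewrite inE/= in_itv/= => /andP[v0 vu].
  by rewrite Ji// v0/=; lra.
have arrE u : 0 <= u <= t -> arrived lam X 0 u w = (gap X 0 w <= lam i * u).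
  by move=> ut; rewrite /arrived -/(intensity u) intE// big_ord_recl big_ord0 addr0.
have tt : 0 <= t <= t by rewrite lexx ltW.
rewrite /= arrE//; case: ifP => // g.
suff -> : env X (arrival_time lam X 0 w) w = i by [].
apply: Ji; apply/andP; split.
  apply: lb_le_inf; last by move=> u [].
  by exists t; split; [exact: ltW|rewrite arrE].
apply: (@le_lt_trans _ _ t); last lra.
apply: ge_inf; first by exists 0 => u [].
by split; [exact: ltW|rewrite arrE].
Qed.

End workload_path.

(** * Independence and the law of the queue *)

Section independent_events.
Context (R : realType) (d : measure_display) (T : measurableType d)
  (P : probability T R) (I : Type) (F : I -> set (set T)).
Hypothesis indF : mutually_independent P F.

Lemma independent2 (i1 i2 : I) (A1 A2 : set T) : i1 <> i2 -> F i1 A1 -> F i2 A2 ->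
  P (A1 `&` A2) = (P A1 * P A2)%E.
Proof.
move=> i12 F1 F2.
have := @indF 2 (fun k => if val k == 0%N then i1 else i2)
  (fun k => if val k == 0%N then A1 else A2).
rewrite big_ord_recl big_ord1 /=.
rewrite (_ : \bigcap_k _ = A1 `&` A2).
  apply; last by case=> -[|[|]].
  by case=> -[|[|]] // h1 [] [|[|]] //= h2 e; apply: val_inj => //=; exfalso; exact: i12.
apply/seteqP; split => [w Aw|w [w1 w2] k _]; last by case: ifP.
by split; [exact: (Aw ord0)|exact: (Aw (lift ord0 ord0))].
Qed.

Lemma independent3 (i1 i2 i3 : I) (A1 A2 A3 : set T) :
  i1 <> i2 -> i1 <> i3 -> i2 <> i3 -> F i1 A1 -> F i2 A2 -> F i3 A3 ->
  P (A1 `&` A2 `&` A3) = (P A1 * P A2 * P A3)%E.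
Proof.
move=> i12 i13 i23 F1 F2 F3.
have := @indF 3 (fun k => if val k == 0%N then i1 else if val k == 1%N then i2 else i3)
  (fun k => if val k == 0%N then A1 else if val k == 1%N then A2 else A3).
rewrite big_ord_recl big_ord_recl big_ord1 /= muleA.
rewrite (_ : \bigcap_k _ = A1 `&` A2 `&` A3).
  apply; last by case=> -[|[|[|]]].
  by case=> -[|[|[|]]] // h1 [] [|[|[|]]] //= h2 e; apply: val_inj => //=; exfalso;
    first [exact: i12|exact: i13|exact: i23|exact: i12 (esym e)|exact: i13 (esym e)
      |exact: i23 (esym e)].
apply/seteqP; split => [w Aw|w [[w1 w2] w3] k _]; last by do 2 case: ifP => //.
split; last exact: (Aw (lift ord0 (lift ord0 ord0))).
by split; [exact: (Aw ord0)|exact: (Aw (lift ord0 ord0))].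
Qed.

End independent_events.

Section queue_law.
Context (R : realType) (D : nat) (d : measure_display) (T : measurableType d)
  (P : probability T R) (Q : 'M[R]_D) (lam c : 'I_D -> R)
  (H : 'I_D -> probability R R) (sigma : discipline R) (X : mmqueue D P).
Hypotheses (hH : forall i, requirement_distribution (H i))
  (hX : is_mmqueue Q lam H c sigma X).
Implicit Types (t u x : R) (i : 'I_D) (w : T).

Let measurable_preimage (Y : {RV P >-> R}) (B : set R) :
  measurable B -> measurable (Y @^-1` B).
Proof. by move=> mB; rewrite -[X in measurable X]setTI; exact: measurable_funP. Qed.

Lemma measurable_env_event t i : 0 <= t -> measurable (env X t @^-1` [set i]).
Proof. by case: hX => -[h _] _ _ _; exact: h. Qed.

Lemma info_measurable I A : I `<=` `[0, +oo[%classic -> info X I A -> measurable A.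
Proof.
move=> I0; apply: smallest_sub; first exact: sigma_algebra_measurable.
have mE (Y : {RV P >-> R}) B : events_of Y B -> measurable B.
  by move=> [C mC <-]; exact: measurable_preimage.
move=> B [[u [i [Iu ->]]]|[k []]]; [|exact: mE..].
by apply: measurable_env_event; move: (I0 _ Iu); rewrite /= in_itv/= andbT.
Qed.

Lemma info_mono I J : I `<=` J -> info X I `<=` info X J.
Proof.
move=> IJ; apply: smallest_sub; first exact: smallest_sigma_algebra.
move=> A [[u [i [Iu ->]]]|h]; apply: sub_sigma_algebra; last by right.
by left; exists u, i; split => //; exact: IJ.
Qed.

Lemma info_env (I : set R) u i : I u -> info X I (env X u @^-1` [set i]).
Proof. by move=> Iu; apply: sub_sigma_algebra; left; exists u, i. Qed.

Lemma infoI I A B : info X I A -> info X I B -> info X I (A `&` B).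
Proof. exact: (@measurableI _ (g_sigma_algebraType _)). Qed.

Let gap_cdf0 k : P [set w | gap X k w <= 0] = 0%E.
Proof.
have [_ [hg _] _ _] := hX.
have -> : P [set w | gap X k w <= 0] = distribution P (gap X k) `]-oo, 0]%classic.
  by rewrite /distribution /pushforward; congr (P _); apply/seteqP; split => w /=;
    rewrite in_itv/=.
rewrite hg// /exponential_prob -integral_itv_bndo_bndc; last first.
  apply/measurable_funTS/measurable_EFinP; exact: measurable_exponential_pdf.
apply: integral0_eq => x /=; rewrite in_itv/= => x0.
by rewrite lt0_exponential_pdf.
Qed.

Lemma measurable_gap_le k x : measurable [set w | gap X k w <= x].
Proof.
have -> : [set w | gap X k w <= x] = gap X k @^-1` `]-oo, x]%classic.
  by apply/seteqP; split => w /=; rewrite in_itv/=.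
exact: measurable_preimage.
Qed.

Lemma gap_cdf k x : 0 <= x -> fine (P [set w | gap X k w <= x]) = 1 - expR (- x).
Proof.
rewrite le_eqVlt => /predU1P[<-|x0]; first by rewrite gap_cdf0 oppr0 expR0 subrr.
have [_ [hg _] _ _] := hX.
have m0x : measurable [set w | 0 <= gap X k w <= x].
  have -> : [set w | 0 <= gap X k w <= x] = gap X k @^-1` `[0, x]%classic.
    by apply/seteqP; split => w /=; rewrite in_itv/=.
  exact: measurable_preimage.
transitivity (fine (P [set w | 0 <= gap X k w <= x])).
  rewrite -!expected_indic//; last exact: measurable_gap_le.
  apply: expected_ae_eq; [exact/bounded_measurable_indic/measurable_gap_le
    |exact: bounded_measurable_indic|].
  exists [set w | gap X k w <= 0]; split=> //; first exact: measurable_gap_le.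
  move=> w /=; apply: contra_notT; rewrite -ltNge => g0.
  rewrite !indicE; congr (nat_of_bool _)%:R.
  by apply/idP/idP; rewrite !inE /= (ltW g0).
have -> : P [set w | 0 <= gap X k w <= x] = distribution P (gap X k) `[0, x]%classic.
  by rewrite /distribution /pushforward; congr (P _); apply/seteqP; split => w /=;
    rewrite in_itv/=.
by rewrite hg// exponential_prob_itv0c// mulN1r.
Qed.

Lemma gap_cdf_le k x : 0 <= x -> fine (P [set w | gap X k w <= x]) <= x.
Proof. by move=> x0; rewrite gap_cdf//; have := expR_ge1Dx (- x); lra. Qed.

(** Collects the almost sure properties on which the pathwise results rest, so that a single null
    set is discarded. *)
Definition regular_path w : Prop :=
  [/\ forall t, 0 <= t -> \forall s \near t^'+, env X s w = env X t w,
      initial_path X w, residual_path lam c sigma X w,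
      forall k, 0 < gap X k w & forall k i, 0 <= req X k i w].

Lemma ae_regular_path : {ae P, forall w, regular_path w}.
Proof.
have [_ [_ hr] _ hp] := hX.
have hg : {ae P, forall w k, 0 < gap X k w}.
  apply: ae_foralln => k; exists [set w | gap X k w <= 0]; split.
  - exact: measurable_gap_le.
  - exact: gap_cdf0.
  - by move=> w /= /negP; rewrite -leNgt.
have hq : {ae P, forall w k i, 0 <= req X k i w}.
  apply: ae_foralln => k; apply: filter_forall => i.
  exists (req X k i @^-1` `]-oo, 0[%classic); split.
  - exact: measurable_preimage.
  - have := hr k i `]-oo, 0[%classic (measurable_itv _).
    by have [-> _] := hH i.
  - by move=> w /= /negP; rewrite in_itv/= -ltNge.
apply: filterS3 hp hg hq => w [[rc _] ini res] g r; by split.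
Qed.

(* A version of the initial workload that is measurable with respect to the
   initial information. *)
Definition initial_work w : R :=
  fine (limn_esup (fun n => (\sum_(0 <= j < n) ini_res X j w)%:E)).

Lemma initial_workE w : regular_path w -> initial_work w = workload X 0 w.
Proof.
move=> [rc ini res g r]; rewrite /initial_work; have [|_ ->] := @cvg_limn_einf_sup _
  (fun n => (\sum_(0 <= j < n) ini_res X j w)%:E) (workload X 0 w)%:E; last by [].
apply: cvg_EFin; first exact: nearW.
exact: (@initial_workload_cvg _ _ _ _ _ lam c sigma).
Qed.

(** The Markov property and the independence of the sources concern events of [info]. The variable
    [W 0] only agrees almost surely with the workload, so both are applied to [initial_work], an
    upper limit of sums of initial remainders. *)
Lemma info_initial_work (B : set R) : measurable B ->
  info X `[0, 0]%classic (initial_work @^-1` B).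
Proof.
move=> mB.
pose G := [set A | (exists u i, `[0, 0]%classic u /\ A = env X u @^-1` [set i]) \/
  exists k, [\/ events_of (ini_arr X k) A, events_of (ini_req X k) A
    | events_of (ini_res X k) A]].
have mini j : @measurable_fun _ _ (g_sigma_algebraType G) _ setT (ini_res X j).
  move=> _ C mC; rewrite setTI; apply: sub_sigma_algebra; right; exists j.
  by apply: Or33; exists C.
have : @measurable_fun _ _ (g_sigma_algebraType G) _ setT initial_work.
  apply: measurableT_comp => //.
  apply: (@measurable_fun_limn_esup _ (g_sigma_algebraType G)) => n.
  by apply/measurable_EFinP; apply: measurable_sum => j; exact: mini.
by move=> /(_ measurableT _ mB); rewrite setTI.
Qed.

Lemma measurable_initial_work : measurable_fun setT initial_work.
Proof.
move=> _ B mB; rewrite setTI.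
apply: (@info_measurable `[0, 0]%classic); last exact: info_initial_work.
by move=> u /=; rewrite !in_itv/= andbT => /andP[].
Qed.

End queue_law.

(** * The balance equation *)

Section step_limits.
Context (R : realType).
Implicit Types (r : R).

(** Time derivatives at 0 are taken along one sequence: dominated convergence is sequential, and [W]
    agrees with the workload almost surely at countably many times simultaneously. *)
Definition step n : R := n.+1%:R^-1.

Lemma step_gt0 n : 0 < step n. Proof. by rewrite invr_gt0. Qed.

Lemma step_le1 n : step n <= 1.
Proof. by rewrite invf_le1// ler1n. Qed.

Lemma step_cvg : step n @[n --> \oo] --> (0 : R).
Proof. exact: cvg_harmonic. Qed.

Lemma expRN_step r : 0 <= r -> (step n)^-1 * (1 - expR (- (r * step n))) @[n --> \oo] --> r.
Proof.
move=> r0; apply: (@cvg_dist_le _ _ (fun n => step n * (r ^+ 2 / 2))); last first.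
  by rewrite -[X in _ --> X](mul0r (r ^+ 2 / 2)); apply: cvgM; [exact: step_cvg|exact: cvg_cst].
apply: nearW => n; have s0 := step_gt0 n.
have [h1 h2 _] := taylor_expRN (mulr_ge0 r0 (ltW s0)).
rewrite distrC ger0_norm.
  rewrite -(ler_pM2l s0) mulrBr mulVKf ?gt_eqF//.
  by apply: le_trans (le_trans h2 _); [lra|rewrite exprMn expr2; lra].
by rewrite subr_ge0 -(ler_pM2l s0) mulVKf ?gt_eqF//; lra.
Qed.

Lemma expR_step r : 0 <= r -> (step n)^-1 * (expR (r * step n) - 1) @[n --> \oo] --> r.
Proof.
move=> r0; apply: (@squeeze_cvgr _ _ _ _ (cst r) (fun n => r * expR (r * step n))).
- apply: nearW => n; have s0 := step_gt0 n; rewrite /=.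
  apply/andP; split; rewrite -(ler_pM2l s0) mulVKf ?gt_eqF//.
    by have := expR_ge1Dx (r * step n); lra.
  have := expR_ge1Dx (- (r * step n)); have := expR_ge0 (r * step n).
  have := expRxMexpNx_1 (r * step n).
  set x := expR (r * step n); set y := expR (- _) => xy x0 h.
  have := ler_wpM2l x0 h; rewrite xy; lra.
- exact: cvg_cst.
- rewrite -[X in _ --> X]mulr1; apply: cvgM; first exact: cvg_cst.
  rewrite -expR0; apply: continuous_cvg; first exact: continuous_expR.
  rewrite -[X in _ --> X](mulr0 r); apply: cvgM; [exact: cvg_cst|exact: step_cvg].
Qed.

End step_limits.

Section boolean_indicators.
Context (R : realType) (d : measure_display) (T : measurableType d).
Implicit Types p q : T -> bool.

Let boolE p : (fun w => (p w)%:R) = \1_[set w | p w] :> (T -> R).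
Proof.
apply/funext => w; rewrite indicE; congr (nat_of_bool _)%:R.
by apply/idP/idP; rewrite inE.
Qed.

Lemma bounded_measurable_bool p : measurable [set w | p w] ->
  bounded_measurable (fun w => (p w)%:R : R).
Proof. by move=> mp; rewrite boolE; exact: bounded_measurable_indic. Qed.

End boolean_indicators.

Section balance.
Context (R : realType) (D : nat) (d : measure_display) (T : measurableType d)
  (P : probability T R) (Q : 'M[R]_D) (lam c : 'I_D -> R)
  (H : 'I_D -> probability R R) (sigma : discipline R) (X : mmqueue D P)
  (W : R -> {RV P >-> R}).
Hypotheses (hlam : forall i, 0 <= lam i) (hc : forall i, 0 <= c i)
  (hH : forall i, requirement_distribution (H i)) (hsigma : is_discipline sigma)
  (hW : stationary_workload Q lam H c sigma X W).
Implicit Types (t u x : R) (i j : 'I_D) (w : T).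

(** This is [phi_i] of the overview; [idle i] is [e_i]. *)
Definition damped (s : R) i : R :=
  \int[P]_w (damp s (W 0 w) * (env X 0 w == i)%:R).

Definition idle i : R := \int[P]_w ((W 0 w == 0) && (env X 0 w == i))%:R.

Let hX : is_mmqueue Q lam H c sigma X. Proof. by case: hW. Qed.

Let mW u : measurable_fun setT (W u). Proof. exact: measurable_funP. Qed.

Let mWpre u (B : set R) : measurable B -> measurable (W u @^-1` B).
Proof. by move=> mB; rewrite -[X in measurable X]setTI; exact: measurable_funP. Qed.

Let env_eqE u i : [set w | env X u w == i] = env X u @^-1` [set i].
Proof. by apply/seteqP; split => w /eqP. Qed.

Let env_info u i : 0 <= u -> info X `[0, +oo[%classic [set w | env X u w == i].
Proof. by move=> u0; rewrite env_eqE; apply: info_env; rewrite /= in_itv/= u0. Qed.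

Let env_meas u i : 0 <= u -> measurable [set w | env X u w == i].
Proof. by move=> u0; rewrite env_eqE; exact: (measurable_env_event hX). Qed.

Let env2_meas u i j : 0 <= u -> measurable [set w | (env X 0 w == i) && (env X u w == j)].
Proof.
move=> u0; have := measurableI _ _ (env_meas i (lexx 0)) (env_meas j u0).
by congr measurable; apply/seteqP; split => w /=; [move=> [-> ->]|move=> /andP[]].
Qed.

Let ae_work u : 0 <= u -> {ae P, forall w, W u w = workload X u w}.
Proof. by case: hW => _ h _; exact: h. Qed.

Let M := @initial_work R D d T P X.

Let mM : measurable_fun setT M. Proof. exact: (measurable_initial_work hX). Qed.

Let ae_M : {ae P, forall w, M w = W 0 w}.
Proof.
have r := ae_regular_path hH hX; apply: filterS2 (ae_work (lexx 0)) r => w -> r.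
by move: r; apply: initial_workE.
Qed.

Section fixed_test_function.
Variables (s : R) (g : 'I_D -> R).
Hypothesis s_ge0 : 0 <= s.

Let dampM (h : T -> R) : bounded_measurable h ->
  \int[P]_w (damp s (W 0 w) * h w) = \int[P]_w (damp s (M w) * h w).
Proof.
move=> bh; apply: expected_ae_eq.
- by apply: bounded_measurableM => //; exact: bounded_measurable_damp.
- by apply: bounded_measurableM => //; exact: bounded_measurable_damp.
- by apply: filterS ae_M => w ->.
Qed.

Let damp01 (r : R) : 0 <= damp s r <= 1.
Proof. by rewrite damp_ge0 damp_le1. Qed.

Let bool_meas u i : 0 <= u -> bounded_measurable (fun w => (env X u w == i)%:R : R).
Proof. by move=> u0; apply: bounded_measurable_bool; exact: env_meas. Qed.

(** The Markov property at time 0, for initial events that fix the range of the initial workload,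
    extends by [expected_comp_eq] to the weight [damp s]. *)
Let markov i j t : 0 <= t ->
  \int[P]_w (damp s (W 0 w) * ((env X 0 w == i) && (env X t w == j))%:R) =
  expmx (t *: Q) i j * damped s i.
Proof.
move=> t0.
have b2 : bounded_measurable (fun w => ((env X 0 w == i) && (env X t w == j))%:R : R).
  by apply: bounded_measurable_bool; exact: env2_meas.
rewrite dampM//.
have be := bounded_measurableM (@bounded_measurable_cst R _ T (expmx (t *: Q) i j))
  (bool_meas i (lexx 0)).
rewrite (@expected_comp_eq _ _ _ P M M _ _ (damp s) mM mM b2 be)//.
- rewrite -dampM// /damped.
  rewrite -expectedZ; last first.
    by apply: bounded_measurableM; [exact: bounded_measurable_damp|exact: bool_meas].
  by apply: eq_Rintegral => w _; ring.
- exact: measurable_damp.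
move=> B mB.
have iA : info X `[0, 0]%classic (M @^-1` B) by exact: info_initial_work.
have mA : measurable (M @^-1` B) by rewrite -[X in measurable X]setTI; exact: mM.
have [[_ mk] _ _ _] := hX.
have := mk 0 t i j _ (lexx 0) t0 iA; rewrite subr0 => mk'.
transitivity (fine (P (M @^-1` B `&` env X 0 @^-1` [set i] `&` env X t @^-1` [set j]))).
  rewrite -expected_indic; last first.
    apply: measurableI; last exact: (measurable_env_event hX).
    by apply: measurableI => //; exact: (measurable_env_event hX).
  apply: eq_Rintegral => w _; rewrite !indicE -natrM mulnb; congr (nat_of_bool _)%:R.
  apply/idP/idP; rewrite !inE.
    by move=> /andP[/set_mem h /andP[/eqP h1 /eqP h2]].
  by move=> [[h /= ->] ->]; rewrite !eqxx !andbT; apply/mem_set.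
rewrite mk' fineM//; last first.
  by apply: fin_num_measure; apply: measurableI => //; exact: (measurable_env_event hX).
rewrite mulrC -expected_indic; last first.
  by apply: measurableI => //; exact: (measurable_env_event hX).
rewrite -expectedZ; last first.
  apply: bounded_measurable_indic.
  by apply: measurableI => //; exact: (measurable_env_event hX).
apply: eq_Rintegral => w _; rewrite mulrCA; congr (_ * _).
rewrite !indicE -natrM mulnb; congr (nat_of_bool _)%:R.
apply/idP/idP; rewrite !inE.
  by move=> [h /= ->]; rewrite eqxx !andbT; apply/mem_set.
by move=> /andP[/set_mem h /eqP].
Qed.

Let stationary i t : 0 <= t ->
  \int[P]_w (damp s (W t w) * (env X t w == i)%:R) = damped s i.
Proof.
move=> t0; apply: expected_comp_eq => //; [exact: bool_meas|exact: bool_meas|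
  exact: measurable_damp|].
move=> B mB.
have E u : 0 <= u -> \int[P]_w (\1_B (W u w) * (env X u w == i)%:R) =
    fine (P (W u @^-1` B `&` env X u @^-1` [set i])).
  move=> u0; rewrite -expected_indic; last first.
    by apply: measurableI; [exact: mWpre|exact: (measurable_env_event hX)].
  apply: eq_Rintegral => w _; rewrite !indicE -natrM mulnb; congr (nat_of_bool _)%:R.
  apply/idP/idP; rewrite !inE.
    by move=> /andP[/set_mem h /eqP].
  by move=> [h /= ->]; rewrite eqxx !andbT; apply/mem_set.
by rewrite !E//; case: hW => _ _ st; rewrite st.
Qed.

(** The initial workload and environment, the first gap and the requirement in state [i] come from
    three distinct sources. The product formula for events is extended by [expected_comp_eq] twice,
    in the requirement and in the initial workload. *)
Let first_arrival i x (f : R -> R) : 0 <= x -> measurable_fun setT f ->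
  (forall r, 0 <= f r <= 1) ->
  \int[P]_w (damp s (W 0 w) *
    (((env X 0 w == i) && (gap X 0 w <= x))%:R * f (req X 0 i w))) =
  (1 - expR (- x)) * \int[H i]_r f r * damped s i.
Proof.
move=> x0 mf f01.
have mg := @measurable_gap_le _ _ _ _ _ X 0 x.
have meg : measurable [set w | (env X 0 w == i) && (gap X 0 w <= x)].
  have := measurableI _ _ (env_meas i (lexx 0)) mg.
  by congr measurable; apply/seteqP; split => w /=; [move=> [-> ->]|move=> /andP[]].
have beg := @bounded_measurable_bool R _ _ _ meg.
have mreq : measurable_fun setT (req X 0 i) by exact: measurable_funP.
have bf : bounded_measurable (fun w => f (req X 0 i w)).
  split; first exact: measurableT_comp.
  by exists 1 => w; have /andP[h1 h2] := f01 (req X 0 i w); rewrite ger0_norm.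
have bfr : bounded_measurable f.
  by split => //; exists 1 => r; have /andP[h1 h2] := f01 r; rewrite ger0_norm.
set C := (1 - expR (- x)) * \int[H i]_r f r.
have bC := bounded_measurableM (@bounded_measurable_cst R _ T C) (bool_meas i (lexx 0)).
have begf := bounded_measurableM beg bf.
rewrite dampM// (@expected_comp_eq _ _ _ P M M _ _ (damp s) mM mM begf bC)//.
- rewrite -dampM// /damped.
  rewrite -expectedZ; last first.
    by apply: bounded_measurableM; [exact: bounded_measurable_damp|exact: bool_meas].
  by apply: eq_Rintegral => w _; ring.
- exact: measurable_damp.
move=> B mB.
have iA : info X `[0, 0]%classic (M @^-1` B) by exact: info_initial_work.
have mA : measurable (M @^-1` B) by rewrite -[X in measurable X]setTI; exact: mM.
pose A := M @^-1` B `&` env X 0 @^-1` [set i].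
have mA' : measurable A by apply: measurableI => //; exact: (measurable_env_event hX).
have iA' : info X `[0, +oo[%classic A.
  apply: infoI; last by apply: info_env; rewrite /= in_itv/= lexx.
  by apply: info_mono iA => u /=; rewrite !in_itv/= andbT => /andP[].
have AE w : \1_B (M w) * (env X 0 w == i)%:R = \1_A w :> R.
  rewrite !indicE -natrM mulnb; congr (nat_of_bool _)%:R.
  apply/idP/idP; rewrite !inE.
    by move=> /andP[/set_mem h /eqP].
  by move=> [h /= ->]; rewrite eqxx !andbT; apply/mem_set.
pose G := [set w | gap X 0 w <= x].
have GE w : (gap X 0 w <= x)%R%:R = \1_G w :> R.
  rewrite indicE; congr (nat_of_bool _)%:R; by apply/idP/idP; rewrite inE.
have bA := @bounded_measurable_indic R _ _ _ mA'.
have bG := @bounded_measurable_indic R _ _ _ mg.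
have bAG := bounded_measurableM bA bG.
have bc := @bounded_measurable_cst R _ T (fine (P A) * fine (P G)).
transitivity (\int[P]_w (f (req X 0 i w) * (\1_A w * \1_G w))).
  apply: eq_Rintegral => w _; rewrite -AE -GE -mulnb natrM; ring.
rewrite (@expected_comp_eq _ _ _ P (req X 0 i) (req X 0 i) _ _ f mreq mreq bAG bc)//.
- rewrite (_ : \int[P]_w _ = fine (P A) * fine (P G) * \int[P]_w f (req X 0 i w)).
    rewrite (gap_cdf hX)// (_ : \int[P]_w f (req X 0 i w) = \int[H i]_r f r).
      rewrite -expected_indic//; transitivity (C * \int[P]_w \1_A w).
        by rewrite /C; ring.
      rewrite -expectedZ//; apply: eq_Rintegral => w _; rewrite -AE; ring.
    congr fine.
    transitivity (\int[distribution P (req X 0 i)]_r (f r)%:E)%E.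
      rewrite ge0_integral_pushforward//; first exact/measurable_EFinP.
      by move=> r _; rewrite lee_fin; case/andP: (f01 r).
    apply: eq_measure_integral => E mE _.
    by have [_ [_ hr] _ _] := hX; exact: hr.
  by rewrite -expectedZ//; apply: eq_Rintegral => w _; rewrite mulrC.
move=> E mE.
have mreqE : measurable (req X 0 i @^-1` E).
  by rewrite -[X in measurable X]setTI; exact: measurable_funP.
have [_ _ ind _] := hX.
have := independent3 ind (i1 := Environment D) (i2 := Gap D 0) (i3 := Req 0 i)
  (A1 := A) (A2 := G) (A3 := req X 0 i @^-1` E).
move=> /(_ (ltac:(by [])) (ltac:(by [])) (ltac:(by [])) iA' _ _) ind3.
transitivity (fine (P (A `&` G `&` req X 0 i @^-1` E))).
  rewrite -expected_indic; last by apply: measurableI => //; exact: measurableI.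
  apply: eq_Rintegral => w _; rewrite !indicI /=.
  by rewrite !indicE mulrC.
rewrite ind3; last 2 first.
- by exists `]-oo, x]%classic.
- by exists E.
rewrite !fineM ?fin_numM ?fin_num_measure//.
rewrite -[fine (P (req X 0 i @^-1` E))]expected_indic//.
rewrite -expectedZ; last exact: bounded_measurable_indic.
by apply: eq_Rintegral => w _; rewrite !indicE mulrC.
Qed.

Let lm := 1 + \sum_i lam i.
Let cm := \sum_i c i.
Let Gm := \sum_i `|g i|.
Local Notation tau := (step R).

Let sum_ge_term (f : 'I_D -> R) i : (forall i, 0 <= f i) -> f i <= \sum_i f i.
Proof. by move=> f0; rewrite (bigD1 i)//= lerDl; exact: sumr_ge0. Qed.

Let lam_le i : lam i <= lm.
Proof. by rewrite /lm (le_trans (sum_ge_term i hlam))// lerDr. Qed.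

Let c_le i : c i <= cm. Proof. exact: sum_ge_term. Qed.

Let g_le i : `|g i| <= Gm. Proof. exact: (@sum_ge_term (fun i => `|g i|)). Qed.

Let lm_gt0 : 0 < lm. Proof. by rewrite ltr_pwDl// sumr_ge0. Qed.

Let cm_ge0 : 0 <= cm. Proof. exact: sumr_ge0. Qed.

Let Gm_ge0 : 0 <= Gm. Proof. exact: sumr_ge0. Qed.

Let tau0 n : 0 < tau n. Proof. exact: step_gt0. Qed.

Let initial_ge0 w : regular_path lam c sigma X w -> 0 <= workload X 0 w.
Proof.
move=> [rc ini res gp rq].
apply: (@workload_ge0 _ _ _ _ _ lam c sigma X w lm cm) => //.
by rewrite mulr0 addr_gt0.
Qed.

Let quiet_bounds w t : regular_path lam c sigma X w -> 0 <= t -> lm * t < gap X 0 w ->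
  workload X 0 w - cm * t <= workload X t w <= workload X 0 w /\ 0 <= workload X t w.
Proof.
move=> [rc ini res gp rq] t0 tg.
have tg2 : lm * t < gap X 0 w + gap X 1 w by rewrite (lt_trans tg)// ltrDl.
have := @workload_bounds _ _ _ _ _ lam c sigma X w lm cm hlam lam_le hc c_le hsigma
  rc ini res gp rq t t0 tg2.
rewrite (@no_arrival _ _ _ _ _ lam X w lm)// addr0 => h; split => //.
exact: (@workload_ge0 _ _ _ _ _ lam c sigma X w lm cm).
Qed.

(** A workload above [cm * t] cannot be exhausted by time [t], so the server works at full capacity
    throughout. *)
Let quiet_work w t i : regular_path lam c sigma X w -> 0 <= t -> lm * t < gap X 0 w ->
  (forall u, 0 <= u <= t -> env X u w = i) -> cm * t < workload X 0 w ->
  workload X t w = workload X 0 w - c i * t.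
Proof.
move=> reg t0 tg Ji cW; have [rc ini res gp rq] := reg.
have tg2 : lm * t < gap X 0 w + gap X 1 w by rewrite (lt_trans tg)// ltrDl.
rewrite (@workload_busy _ _ _ _ _ lam c sigma X w lm cm hlam lam_le hc c_le hsigma
  rc ini res gp rq t t0 tg2 i)//.
  by rewrite (@no_arrival _ _ _ _ _ lam X w lm)// addr0.
move=> u /andP[u0 ut].
have ug : lm * u < gap X 0 w by rewrite (le_lt_trans _ tg)// ler_wpM2l// ltW.
have [/andP[h _] _] := quiet_bounds reg u0 ug.
apply: lt_le_trans h; rewrite subr_gt0 (le_lt_trans _ cW)//.
by rewrite ler_wpM2l.
Qed.

(** The work processed is simply bounded by [cm * t]: this is used only when the first gap is early,
    which has probability of order [t], so the resulting error is of order [t ^ 2]. *)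
Let one_arrival w t i : regular_path lam c sigma X w -> 0 < t ->
  lm * t < gap X 0 w + gap X 1 w -> (forall u, 0 <= u < 2 * t -> env X u w = i) ->
  let S := workload X 0 w + (if gap X 0 w <= lam i * t then req X 0 i w else 0) in
  `|workload X t w - S| <= cm * t.
Proof.
move=> [rc ini res gp rq] t0 tg Ji /=.
have := @workload_bounds _ _ _ _ _ lam c sigma X w lm cm hlam lam_le hc c_le hsigma
  rc ini res gp rq t (ltW t0) tg.
rewrite (@offered_first_arrival _ _ _ _ _ lam X w t i)// => /andP[h1 h2].
move: (workload X 0 w + _) h1 h2 => S h1 h2; have := mulr_ge0 cm_ge0 (ltW t0).
by rewrite ler_norml; move=> ?; apply/andP; split; lra.
Qed.

Let ae_good : {ae P, forall w, [/\ regular_path lam c sigma X w,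
  W 0 w = workload X 0 w & forall n, W (tau n) w = workload X (tau n) w]}.
Proof.
have h : {ae P, forall w n, W (tau n) w = workload X (tau n) w}.
  by apply: ae_foralln => n; exact: ae_work (ltW (tau0 n)).
by apply: filterS3 (ae_regular_path hH hX) (ae_work (lexx 0)) h.
Qed.

Let gE u w : g (env X u w) = \sum_i g i * (env X u w == i)%:R.
Proof.
rewrite (bigD1 (env X u w))//= eqxx mulr1 big1 ?addr0// => i.
by rewrite eq_sym => /negbTE ->; rewrite mulr0.
Qed.

Let bG u : 0 <= u -> bounded_measurable (fun w => g (env X u w)).
Proof.
move=> u0; under eq_fun do rewrite gE.
apply: bounded_measurable_sum => i; apply: bounded_measurableM.
  exact: bounded_measurable_cst.
exact: bool_meas.
Qed.

Let bW u : bounded_measurable (fun w => damp s (W u w)).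
Proof. exact: bounded_measurable_damp. Qed.

Let E_stationary t : 0 <= t ->
  \int[P]_w (damp s (W t w) * g (env X t w)) = \sum_i g i * damped s i.
Proof.
move=> t0; under eq_Rintegral do rewrite gE mulr_sumr.
rewrite expected_sum => [|i]; last first.
  apply: bounded_measurableM; first exact: bW.
  by apply: bounded_measurableM; [exact: bounded_measurable_cst|exact: bool_meas].
apply: eq_bigr => i _; rewrite -(stationary i t0) -expectedZ; last first.
  by apply: bounded_measurableM; [exact: bW|exact: bool_meas].
by apply: eq_Rintegral => w _; rewrite mulrCA.
Qed.

Let E_markov t : 0 <= t ->
  \int[P]_w (damp s (W 0 w) * g (env X t w)) =
  \sum_i \sum_j g j * (expmx (t *: Q) i j * damped s i).
Proof.
move=> t0.
have b2 i j : bounded_measurable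
    (fun w => damp s (W 0 w) * ((env X 0 w == i) && (env X t w == j))%:R : R).
  by apply: bounded_measurableM; [exact: bW|
     apply: bounded_measurable_bool; exact: env2_meas].
transitivity (\int[P]_w (\sum_i \sum_j g j *
    (damp s (W 0 w) * ((env X 0 w == i) && (env X t w == j))%:R))).
  apply: eq_Rintegral => w _.
  rewrite (bigD1 (env X 0 w))//= [X in _ = _ + X]big1 ?addr0 => [|i]; last first.
    rewrite eq_sym => /negbTE ni; apply: big1 => j _.
    by rewrite ni /= !mulr0.
  rewrite gE mulr_sumr; apply: eq_bigr => j _.
  by rewrite eqxx /= mulrCA.
rewrite expected_sum => [|i]; last first.
  apply: bounded_measurable_sum => j; apply: bounded_measurableM => //.
  exact: bounded_measurable_cst.
apply: eq_bigr => i _; rewrite expected_sum => [|j]; last first.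
  by apply: bounded_measurableM => //; exact: bounded_measurable_cst.
by apply: eq_bigr => j _; rewrite expectedZ// markov.
Qed.

(** The workload is frozen at its initial value while the environment moves, so that only the
    derivative of the transition matrix at 0 is involved. *)
Let environment_term :
  (tau n)^-1 * (\int[P]_w (damp s (W 0 w) * g (env X (tau n) w)) -
    \int[P]_w (damp s (W 0 w) * g (env X 0 w))) @[n --> \oo] -->
  \sum_i damped s i * (\sum_j Q i j * g j).
Proof.
have -> : \sum_i damped s i * (\sum_j Q i j * g j) =
    \sum_i \sum_j Q i j * (g j * damped s i).
  by apply: eq_bigr => i _; rewrite mulr_sumr; apply: eq_bigr => j _; ring.
rewrite (_ : (fun n => _) = fun n => \sum_i \sum_j
    (expmx (tau n *: Q) i j - (i == j)%:R) / tau n * (g j * damped s i)).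
  apply: cvg_sumr => i; apply: cvg_sumr => j.
  apply: cvgM; last exact: cvg_cst.
  apply: expmx_derivative0; last exact: step_cvg.
  by move=> n; rewrite tau0 step_le1.
apply/funext => n; rewrite (E_markov (ltW (tau0 n))) (E_stationary (lexx 0)).
rewrite -sumrB mulr_sumr; apply: eq_bigr => i _.
have -> : g i * damped s i = \sum_j g j * ((i == j)%:R * damped s i).
  rewrite (bigD1 i)//= eqxx mul1r big1 ?addr0// => j.
  by rewrite eq_sym => /negbTE ->; rewrite mul0r mulr0.
rewrite -sumrB mulr_sumr; apply: eq_bigr => j _; ring.
Qed.

(** The threshold uses the dominating rate [lm]: quietness excludes arrivals before [tau n] and is
    still an event of the first gap alone, whereas the true intensity depends on the path of the
    environment. *)
Let quiet n w : R := (~~ (gap X 0 w <= lm * tau n))%:R.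

Let bquiet n : bounded_measurable (quiet n).
Proof.
apply: bounded_measurable_bool.
have := measurableC (@measurable_gap_le _ _ _ _ _ X 0 (lm * tau n)).
by congr measurable; apply/seteqP; split => w /negP.
Qed.

Let env_near0 w : regular_path lam c sigma X w ->
  \forall n \near \oo, forall u, 0 <= u <= 2 * tau n -> env X u w = env X 0 w.
Proof.
move=> [rc _ _ _ _]; have [e /= e0 He] := rc 0 (lexx 0).
have e2 : 0 < e / 2 by rewrite divr_gt0.
near=> n => u /andP[]; rewrite le_eqVlt => /predU1P[<-//|u0] un.
apply: He => //=; rewrite sub0r normrN gtr0_norm//.
apply: (le_lt_trans un).
suff : tau n < e / 2 by lra.
by near: n; exact: (cvgr_lt 0 (@step_cvg R)).
Unshelve. all: by end_near.
Qed.

Let near_step_lt (r K : R) : 0 < r -> 0 <= K -> \forall n \near \oo, K * tau n < r.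
Proof.
move=> r0 K0.
have : K * tau n @[n --> \oo] --> K * 0.
  by apply: cvgM; [exact: cvg_cst|exact: step_cvg].
by rewrite mulr0 => h; exact: (cvgr_lt 0 h).
Qed.

(** The factor [(tau n)^-1] is kept inside the integral: without arrivals the workload changes by at
    most [cm * tau n], so the quotient is bounded and bounded convergence applies. *)
Let service_integrand n w : R := (tau n)^-1 *
  ((damp s (W (tau n) w) - damp s (W 0 w)) * g (env X (tau n) w)) * quiet n w.

Let bserv n : bounded_measurable (service_integrand n).
Proof.
apply: bounded_measurableM => //; apply: bounded_measurableM.
  exact: bounded_measurable_cst.
apply: bounded_measurableM; last exact/bG/ltW/tau0.
exact: bounded_measurableB.
Qed.

Let idle_bool i : measurable [set w | (W 0 w == 0) && (env X 0 w == i)].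
Proof.
have := measurableI _ _ (@mWpre 0 [set 0] (measurable_set1 0)) (env_meas i (lexx 0)).
by congr measurable; apply/seteqP; split => w /=;
  [move=> [-> ->]; rewrite eqxx|move=> /andP[/eqP]].
Qed.

(** Since [damp s 0 = 1], subtracting the indicator of an empty system leaves [damp s] exactly where
    the server is busy. *)
Let service_limit w : R := \sum_i s * c i * g i *
  (damp s (W 0 w) * (env X 0 w == i)%:R - ((W 0 w == 0) && (env X 0 w == i))%:R).

Let bterm i : bounded_measurable (fun w => damp s (W 0 w) * (env X 0 w == i)%:R -
  ((W 0 w == 0) && (env X 0 w == i))%:R).
Proof.
apply: bounded_measurableB; last by apply: bounded_measurable_bool; exact: idle_bool.
by apply: bounded_measurableM => //; exact: bool_meas.
Qed.

Let blim : bounded_measurable service_limit.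
Proof.
apply: bounded_measurable_sum => i; apply: bounded_measurableM => //.
exact: bounded_measurable_cst.
Qed.

Let service_limitE w : service_limit w = s * c (env X 0 w) * g (env X 0 w) *
  (damp s (W 0 w) - (W 0 w == 0)%:R).
Proof.
rewrite /service_limit (bigD1 (env X 0 w))//= eqxx mulr1 andbT big1 ?addr0// => i.
by rewrite eq_sym => /negbTE ->; rewrite andbF mulr0 subr0 mulr0.
Qed.

Let service_term : \int[P]_w service_integrand n w @[n --> \oo] -->
  s * \sum_i c i * g i * (damped s i - idle i).
Proof.
have -> : s * (\sum_i c i * g i * (damped s i - idle i)) = \int[P]_w service_limit w.
  rewrite expected_sum => [|i]; last first.
    by apply: bounded_measurableM => //; exact: bounded_measurable_cst.
  rewrite mulr_sumr; apply: eq_bigr => i _; rewrite expectedZ// expectedB.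
  - by rewrite -/(damped s i) -/(idle i); ring.
  - by apply: bounded_measurableM => //; exact: bool_meas.
  - by apply: bounded_measurable_bool; exact: idle_bool.
apply: (@expected_bounded_cvg _ _ _ P service_integrand service_limit (s * cm * Gm)).
- by move=> n; case: (bserv n).
- by case: blim.
- apply: filterS ae_good => w [reg W0 Wn] n.
  rewrite /service_integrand /quiet.
  have [q|q] := boolP (gap X 0 w <= lm * tau n).
    by rewrite mulr0 normr0 !mulr_ge0.
  rewrite -ltNge in q; rewrite mulr1.
  have [/andP[h1 h2] _] := quiet_bounds reg (ltW (tau0 n)) q.
  rewrite !normrM normfV (gtr0_norm (tau0 n)) mulrC -mulrA.
  rewrite -!mulrA [leRHS]mulrA.
  have : `|damp s (W (tau n) w) - damp s (W 0 w)| <= s * (cm * tau n).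
    apply: (le_trans (damp_lipschitz _ _ s_ge0)); rewrite ler_wpM2l//.
    by rewrite Wn W0 ler_norml; apply/andP; split; [lra|
       have := mulr_ge0 cm_ge0 (ltW (tau0 n)); lra].
  move=> h; apply: (@le_trans _ _ (s * (cm * tau n) * (Gm * (tau n)^-1))).
    apply: ler_pM => //; first by rewrite mulr_ge0// invr_ge0 ltW.
    by rewrite ler_wpM2r// invr_ge0 ltW.
  by rewrite [leLHS](_ : _ = s * cm * Gm)// mulrA; field; rewrite gt_eqF.
- apply: filterS ae_good => w [reg W0 Wn].
  have [rc ini res gp rq] := reg.
  have W00 := initial_ge0 reg; rewrite -W0 in W00.
  set i := env X 0 w.
  have near_env := env_near0 reg.
  have near_quiet := near_step_lt (gp 0%N) (ltW lm_gt0).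
  rewrite service_limitE -/i.
  move: W00; rewrite le_eqVlt => /predU1P[W00|Wpos].
    (* An empty system stays empty as long as nobody arrives. *)
    rewrite -W00 damp0 eqxx subrr mulr0.
    apply: cvg_near_cst; near=> n.
    have q : lm * tau n < gap X 0 w by near: n.
    have [/andP[_ h2] h3] := quiet_bounds reg (ltW (tau0 n)) q.
    have Wt : W (tau n) w = 0 by apply/le_anti; rewrite Wn h3 (le_trans h2)// -W0 -W00 lexx.
    by rewrite /service_integrand Wt -W00 subrr mul0r mulr0 mul0r.
  rewrite gt_eqF// subr0.
  (* From some [n] on, depending on the path, the environment has not moved and the workload is not
     exhausted, so the quotient is explicit. *)
  apply: (@cvg_trans _ ((damp s (W 0 w) * g i * ((tau n)^-1 * (expR (s * c i * tau n) - 1)))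
     @[n --> \oo])).
    apply: near_eq_cvg; near=> n.
    have q : lm * tau n < gap X 0 w by near: n.
    have q2 : cm * tau n < W 0 w by near: n; exact: near_step_lt.
    have Ji : forall u, 0 <= u <= 2 * tau n -> env X u w = i by near: n.
    have Ji' u : 0 <= u <= tau n -> env X u w = i.
      by move=> /andP[u0 un]; apply: Ji; rewrite u0 (le_trans un)// mulr2n mulrDl mul1r lerDl ltW.
    rewrite /service_integrand /quiet leNgt q /= mulr1 Ji' ?lexx ?ltW//.
    have cmW : c i * tau n <= W 0 w.
      by rewrite (le_trans _ (ltW q2))// ler_wpM2r// ltW.
    rewrite Wn (quiet_work reg (ltW (tau0 n)) q Ji') -?W0//.
    rewrite /damp !ger0_norm ?subr_ge0 ?(ltW Wpos)//.
    have -> : - (s * (W 0 w - c i * tau n)) = - (s * W 0 w) + s * c i * tau n by ring.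
    by rewrite expRD; ring.
  have -> : s * c i * g i * damp s (W 0 w) = damp s (W 0 w) * g i * (s * c i) by ring.
  apply: cvgM; first exact: cvg_cst.
  by apply: expR_step; rewrite mulr_ge0.
Unshelve. all: by end_near.
Qed.

(** Here the rate is the one of the initial state [i]: this is an arrival before [tau n] provided
    that the environment stays put. Moves are accounted for by [moved]. *)
Let arrive n i w : R := ((env X 0 w == i) && (gap X 0 w <= lam i * tau n))%R%:R.

Let barrive n i : bounded_measurable (arrive n i).
Proof.
apply: bounded_measurable_bool.
have := measurableI _ _ (env_meas i (lexx 0))
  (@measurable_gap_le _ _ _ _ _ X 0 (lam i * tau n)).
by congr measurable; apply/seteqP; split => w /=; [move=> [-> ->]|move=> /andP[]].
Qed.

Let jump n w : R := \sum_i g i *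
  (damp s (W 0 w) * (arrive n i w * (damp s (req X 0 i w) - 1))).

Let breq i : bounded_measurable (fun w => damp s (req X 0 i w)).
Proof. exact: bounded_measurable_damp. Qed.

Let breq1 i : bounded_measurable (fun w => damp s (req X 0 i w) - 1).
Proof.
by apply: bounded_measurableB => //; exact: bounded_measurable_cst.
Qed.

Let bjump_term n i : bounded_measurable (fun w =>
  damp s (W 0 w) * (arrive n i w * (damp s (req X 0 i w) - 1))).
Proof. by do 2 apply: bounded_measurableM => //. Qed.

Let bjump n : bounded_measurable (jump n).
Proof.
apply: bounded_measurable_sum => i; apply: bounded_measurableM => //.
exact: bounded_measurable_cst.
Qed.

Let jump_term : (tau n)^-1 * \int[P]_w jump n w @[n --> \oo] -->
  \sum_i g i * (lam i * (laplace (H i) s - 1) * damped s i).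
Proof.
rewrite (_ : (fun n => _) = fun n => \sum_i g i *
    ((tau n)^-1 * (1 - expR (- (lam i * tau n))) * (laplace (H i) s - 1) * damped s i)).
  apply: cvg_sumr => i; apply: cvgM; first exact: cvg_cst.
  do 2 (apply: cvgM; last exact: cvg_cst); exact: expRN_step.
apply/funext => n; rewrite expected_sum => [|i]; last first.
  by apply: bounded_measurableM => //; exact: bounded_measurable_cst.
rewrite mulr_sumr; apply: eq_bigr => i _; rewrite expectedZ//.
have lt0 : 0 <= lam i * tau n by rewrite mulr_ge0// ltW.
(* The factor [damp s (req X 0 i w) - 1] does not take values in the unit interval, so its two terms
   are treated separately. *)
have h1 := @first_arrival i (lam i * tau n) (damp s) lt0 (@measurable_damp R s) damp01.
have h2 := @first_arrival i (lam i * tau n) (fun=> 1) lt0 (measurable_cst _).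
rewrite (expected_cst (H i)) mulr1 in h2.
rewrite (_ : \int[P]_w _ = \int[P]_w (damp s (W 0 w) *
    (arrive n i w * damp s (req X 0 i w))) -
  \int[P]_w (damp s (W 0 w) * (arrive n i w * 1))).
  rewrite h1 h2; last by move=> _; rewrite ler01 lexx.
  by rewrite -/(laplace (H i) s); ring.
rewrite -expectedB.
- by apply: eq_Rintegral => w _; ring.
- by do 2 apply: bounded_measurableM => //.
- by do 2 apply: bounded_measurableM => //; exact: bounded_measurable_cst.
Qed.

(** Rational times make this a countable union, hence an event of the environment; by
    right-continuity they detect any move before [2 * tau n]. *)
Let moved n := [set w | exists q : rat,
  [/\ 0 <= ratr q :> R, ratr q < 2 * tau n & env X (ratr q) w != env X 0 w]].

Let moved_info n : info X `[0, +oo[%classic (moved n).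
Proof.
pose S (q : rat) : set T := if (0 <= ratr q :> R) && (ratr q < 2 * tau n)
  then ~` \bigcup_i ([set w | env X 0 w == i] `&` [set w | env X (ratr q) w == i])
  else set0.
have -> : moved n = \bigcup_q S q.
  apply/seteqP; split => w.
    move=> [q [q0 qn ne]]; exists q => //; rewrite /S q0 qn /= => -[i _ [/= /eqP e1 /eqP e2]].
    by rewrite e1 e2 eqxx in ne.
  move=> [q _]; rewrite /S; case: ifP => // /andP[q0 qn] nb; exists q; split => //.
  apply/eqP => e; apply: nb; exists (env X 0 w) => //=.
  by rewrite e eqxx.
apply: (@bigcupT_measurable_rat _ (g_sigma_algebraType _)) => q.
rewrite /S; case: ifP => [/andP[q0 _]|_]; last exact: measurable0.
apply: measurableC; apply: fin_bigcup_measurable; first exact: finite_finset.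
move=> i _.
by apply: infoI; exact: env_info.
Qed.

Let moved_meas n : measurable (moved n).
Proof. exact: (info_measurable hX (subset_refl _) (moved_info n)). Qed.

Let not_moved n w : regular_path lam c sigma X w -> ~ moved n w ->
  forall u, 0 <= u < 2 * tau n -> env X u w = env X 0 w.
Proof.
move=> [rc _ _ _ _] nm u /andP[u0 un].
have [e /= e0 He] := rc u u0.
have lt_u : u < Num.min (u + e) (2 * tau n) by rewrite lt_min un andbT ltrDl.
have [q] := rat_in_itvoo lt_u; rewrite in_itv/= lt_min => /and3P[uq qe qn].
rewrite -(He (ratr q))//=; last by rewrite distrC gtr0_norm ?subr_gt0//; lra.
apply/eqP; apply: contra_notT nm => ne; exists q; split => //.
by rewrite (le_trans u0)// ltW.
Qed.

(** Right-continuity at 0 gives convergence without a rate. That is enough, since the event is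
    independent of the first gap and is only met together with an early first gap. *)
Let moved_cvg : fine (P (moved n)) @[n --> \oo] --> 0.
Proof.
rewrite -[X in _ --> X](@expected_cst R _ T P 0).
under eq_fun do rewrite -expected_indic//.
apply: (@expected_bounded_cvg _ _ _ P (fun n => \1_(moved n)) (fun=> 0) 1) => //.
- by apply: aeW => w n; rewrite indicE; case: (_ \in _); rewrite ?normr1 ?normr0.
- apply: filterS (ae_regular_path hH hX) => w reg.
  apply: cvg_near_cst; near=> n; rewrite indicE memNset// => -[q [q0 qn /negP]]; apply.
  have Ji : forall u, 0 <= u <= 2 * tau n -> env X u w = env X 0 w.
    by near: n; exact: env_near0.
  by rewrite Ji ?q0 ?ltW.
Unshelve. all: by end_near.
Qed.

Let rest n w : R := (damp s (W (tau n) w) - damp s (W 0 w)) * g (env X (tau n) w) *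
  (1 - quiet n w) - jump n w.

Let brest n : bounded_measurable (rest n).
Proof.
apply: bounded_measurableB => //; apply: bounded_measurableM; last first.
  by apply: bounded_measurableB => //; exact: bounded_measurable_cst.
apply: bounded_measurableM; last exact/bG/ltW/tau0.
exact: bounded_measurableB.
Qed.

Let early k n w : R := (gap X k w <= lm * tau n)%R%:R.

Let bearly k n : bounded_measurable (early k n).
Proof. by apply: bounded_measurable_bool; exact: measurable_gap_le. Qed.

(** Nothing is left over unless the first gap is early. On that event the remainder is bounded by a
    constant if the environment moves or the second gap is early too; otherwise it only reflects the
    work processed meanwhile. *)
Let error n w : R := early 0 n w *
  (\1_(moved n) w + early 1 n w + s * (cm * tau n)).

Let jumpE n w : jump n w = g (env X 0 w) * (damp s (W 0 w) *
  ((gap X 0 w <= lam (env X 0 w) * tau n)%R%:R * (damp s (req X 0 (env X 0 w) w) - 1))).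
Proof.
rewrite /jump (bigD1 (env X 0 w))//= big1 ?addr0 => [|i].
  by rewrite /arrive eqxx.
by rewrite /arrive eq_sym => /negbTE ->; rewrite /= mul0r !mulr0.
Qed.

Let rest_le n : {ae P, forall w, `|rest n w| <= 2 * Gm * error n w}.
Proof.
apply: filterS ae_good => w [reg W0 Wn]; have [rc ini res gp rq] := reg.
have tn0 := tau0 n; have sc0 : 0 <= s * (cm * tau n) by rewrite !mulr_ge0// ltW.
set i := env X 0 w.
have lamtau : lam i * tau n <= lm * tau n by rewrite ler_wpM2r// ltW.
rewrite /rest /error /quiet /early jumpE -/i.
have [g0|g0] := leP (gap X 0 w) (lm * tau n); last first.
  rewrite [gap X 0 w <= lam i * _]leNgt (le_lt_trans lamtau g0) /=.
  by rewrite subrr !mul0r !mulr0 subrr normr0.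
rewrite /= subr0 mulr1 mul1r.
have ga := g_le (env X (tau n) w); have gi := g_le i.
have /andP[a0 a1] := damp01 (W 0 w); have /andP[b0 b1] := damp01 (W (tau n) w).
have /andP[r0 r1] := damp01 (req X 0 i w).
have crude : `|(damp s (W (tau n) w) - damp s (W 0 w)) * g (env X (tau n) w) -
    g i * (damp s (W 0 w) * ((gap X 0 w <= lam i * tau n)%R%:R *
      (damp s (req X 0 i w) - 1)))| <= 2 * Gm.
  rewrite (le_trans (ler_normB _ _))//.
  have -> : 2 * Gm = 1 * Gm + Gm * 1 by ring.
  rewrite lerD// normrM ler_pM//.
    by rewrite ler_norml; apply/andP; split; lra.
  rewrite normrM -[leRHS]mulr1 ler_pM// ?(ger0_norm a0)//.
  rewrite normrM -[leRHS]mulr1 ler_pM//.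
    by rewrite normr_nat lern1 leq_b1.
  by rewrite ler_norml; apply/andP; split; lra.
have G2 : 0 <= 2 * Gm by rewrite mulr_ge0.
have [mv|nmv] := pselect (moved n w).
  rewrite (le_trans crude)// -[leLHS]mulr1 ler_wpM2l// indicE mem_set//=.
  by rewrite -addrA lerDl addr_ge0.
have [g1|g1] := leP (gap X 1 w) (lm * tau n).
  rewrite (le_trans crude)// -[leLHS]mulr1 ler_wpM2l//.
  by rewrite indicE /= addrAC lerDr addr_ge0.
rewrite indicE memNset//= addr0 add0r.
have Ji := not_moved reg nmv.
have tg : lm * tau n < gap X 0 w + gap X 1 w by rewrite (lt_trans g1)// ltrDr.
have := one_arrival reg tn0 tg Ji; rewrite -/i -Wn -W0.
rewrite (Ji (tau n)); last by rewrite ltW//=; lra.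
have W00 := initial_ge0 reg; rewrite -W0 in W00.
set S := (W 0 w + _) => hS.
have dS : damp s S = damp s (W 0 w) +
    damp s (W 0 w) * ((gap X 0 w <= lam i * tau n)%R%:R * (damp s (req X 0 i w) - 1)).
  rewrite /S; case: ifP => _; last by rewrite addr0 mul0r mulr0 addr0.
  by rewrite dampD//=; ring.
rewrite -/i (_ : _ - _ = g i * (damp s (W (tau n) w) - damp s S)); last by rewrite dS; ring.
rewrite normrM; apply: (@le_trans _ _ (Gm * (s * (cm * tau n)))).
  apply: ler_pM => //; apply: (le_trans (damp_lipschitz _ _ s_ge0)).
  by rewrite ler_wpM2l.
by rewrite ler_wpM2r//; have := Gm_ge0; lra.
Qed.

(** Independence turns the joint probabilities into products, in which the early first gap
    contributes [lm * tau n] and the other factor vanishes in the limit. *)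
Let error_le n : \int[P]_w error n w <=
  lm * tau n * (fine (P (moved n)) + lm * tau n + s * (cm * tau n)).
Proof.
have tn0 := tau0 n; have lt0 : 0 <= lm * tau n by rewrite mulr_ge0// ltW.
have [_ _ ind _] := hX.
pose G k := [set w | gap X k w <= lm * tau n].
have mG k : measurable (G k) by exact: measurable_gap_le.
have eE k w : early k n w = \1_(G k) w.
  by rewrite /early indicE; congr (nat_of_bool _)%:R; apply/idP/idP; rewrite inE.
have sG k : source_events X (Gap D k) (G k) by exists `]-oo, lm * tau n]%classic.
have PG k : fine (P (G k)) <= lm * tau n by exact: (gap_cdf_le hX).
have b1 A : measurable A -> bounded_measurable (\1_A : T -> R).
  exact: bounded_measurable_indic.
have -> : \int[P]_w error n w = fine (P (moved n `&` G 0%N)) + fine (P (G 0%N `&` G 1%N)) +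
    s * (cm * tau n) * fine (P (G 0%N)).
  rewrite -!expected_indic//; try exact: measurableI.
  rewrite -expectedZ; last exact: b1.
  rewrite -!expectedD.
  - by apply: eq_Rintegral => w _; rewrite /error !eE !indicI /=; ring.
  - by apply: bounded_measurableD; apply: b1; exact: measurableI.
  - by apply: bounded_measurableM; [exact: bounded_measurable_cst|exact: b1].
  - by apply: b1; exact: measurableI.
  - by apply: b1; exact: measurableI.
have e01 : P (moved n `&` G 0%N) = (P (moved n) * P (G 0%N))%E.
  by apply: (independent2 ind (i1 := Environment D) (i2 := Gap D 0)) => //;
    exact: moved_info.
have e02 : P (G 0%N `&` G 1%N) = (P (G 0%N) * P (G 1%N))%E.
  by apply: (independent2 ind (i1 := Gap D 0) (i2 := Gap D 1)).
rewrite e01 e02.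
rewrite !fineM ?fin_num_measure//.
have p0 A : 0 <= fine (P A) by exact: fine_ge0.
have h1 : fine (P (moved n)) * fine (P (G 0%N)) <= fine (P (moved n)) * (lm * tau n).
  by rewrite ler_wpM2l.
have h2 : fine (P (G 0%N)) * fine (P (G 1%N)) <= lm * tau n * (lm * tau n).
  exact: ler_pM.
have h3 : s * (cm * tau n) * fine (P (G 0%N)) <= s * (cm * tau n) * (lm * tau n).
  by rewrite ler_wpM2l// !mulr_ge0// ltW.
apply: (le_trans (lerD (lerD h1 h2) h3)); rewrite le_eqVlt; apply/orP; left; apply/eqP; ring.
Qed.

Let rest_term : (tau n)^-1 * \int[P]_w rest n w @[n --> \oo] --> 0.
Proof.
apply: (@cvg_dist_le _ _ (fun n => 2 * Gm * lm *
   (fine (P (moved n)) + lm * tau n + s * (cm * tau n)))); last first.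
  rewrite -[X in _ --> X](mulr0 (2 * Gm * lm)); apply: cvgM; first exact: cvg_cst.
  have -> : 0 = 0 + lm * 0 + s * (cm * 0) :> R by ring.
  apply: cvgD; first apply: cvgD; first exact: moved_cvg.
    by apply: cvgM; [exact: cvg_cst|exact: step_cvg].
  by do 2 (apply: cvgM; first exact: cvg_cst); exact: step_cvg.
apply: nearW => n; have tn0 := tau0 n.
rewrite subr0 normrM normfV (gtr0_norm tn0) mulrC ler_pdivrMr//.
have berr : bounded_measurable (error n).
  apply: bounded_measurableM => //; apply: bounded_measurableD.
    by apply: bounded_measurableD => //; exact: bounded_measurable_indic.
  exact: bounded_measurable_cst.
apply: (@le_trans _ _ (\int[P]_w (2 * Gm * error n w))).
  apply: expected_norm_le => //.
  by apply: bounded_measurableM => //; exact: bounded_measurable_cst.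
rewrite expectedZ// (le_trans (ler_wpM2l _ (error_le n))) ?mulr_ge0//.
by rewrite le_eqVlt; apply/orP; left; apply/eqP; ring.
Qed.

(* The stationary expectation of [damp s (W t) * g (env t)] does not depend on
   [t]; this is its derivative at 0, split according to whether the environment
   moves, work is processed, or a customer arrives. *)
Lemma balance_equation :
  \sum_i damped s i * (\sum_j Q i j * g j) +
  s * (\sum_i c i * g i * (damped s i - idle i)) +
  \sum_i g i * (lam i * (laplace (H i) s - 1) * damped s i) = 0.
Proof.
(* The difference between times [tau n] and 0 is split by the intermediate value with initial
   workload and final environment. The change of workload is then divided according to [quiet], and
   its part with an early gap into [jump] and [rest]. *)
pose F n := (tau n)^-1 * (\int[P]_w (damp s (W 0 w) * g (env X (tau n) w)) -
    \int[P]_w (damp s (W 0 w) * g (env X 0 w))) + \int[P]_w service_integrand n w +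
  (tau n)^-1 * \int[P]_w jump n w + (tau n)^-1 * \int[P]_w rest n w.
have h : F n @[n --> \oo] --> \sum_i damped s i * (\sum_j Q i j * g j) +
    s * (\sum_i c i * g i * (damped s i - idle i)) +
    \sum_i g i * (lam i * (laplace (H i) s - 1) * damped s i) + 0.
  apply: cvgD rest_term; apply: cvgD jump_term.
  exact: cvgD environment_term service_term.
rewrite addr0 (_ : F = fun=> 0) in h; first exact: cvg_unique h (cvg_cst 0).
apply/funext => n; rewrite /F; have tn0 := ltW (tau0 n).
have bGn := bG tn0; have bW0 := bW 0; have bWn := bW (tau n).
have bD : bounded_measurable (fun w => (damp s (W (tau n) w) - damp s (W 0 w)) *
    g (env X (tau n) w)).
  by apply: bounded_measurableM => //; exact: bounded_measurableB.
have bq := bquiet n.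
have b1q : bounded_measurable (fun w => 1 - quiet n w).
  by apply: bounded_measurableB => //; exact: bounded_measurable_cst.
have e1 : \int[P]_w service_integrand n w = (tau n)^-1 *
    \int[P]_w ((damp s (W (tau n) w) - damp s (W 0 w)) * g (env X (tau n) w) * quiet n w).
  rewrite -expectedZ; last exact: bounded_measurableM.
  by apply: eq_Rintegral => w _; rewrite /service_integrand mulrA.
have e2 : \int[P]_w rest n w =
    \int[P]_w ((damp s (W (tau n) w) - damp s (W 0 w)) * g (env X (tau n) w) *
      (1 - quiet n w)) - \int[P]_w jump n w.
  by rewrite expectedB//; exact: bounded_measurableM.
have e3 : \int[P]_w ((damp s (W (tau n) w) - damp s (W 0 w)) * g (env X (tau n) w) * quiet n w)
  + \int[P]_w ((damp s (W (tau n) w) - damp s (W 0 w)) * g (env X (tau n) w) *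
      (1 - quiet n w)) =
    \int[P]_w (damp s (W (tau n) w) * g (env X (tau n) w)) -
    \int[P]_w (damp s (W 0 w) * g (env X (tau n) w)).
  rewrite -expectedD; [|exact: bounded_measurableM|exact: bounded_measurableM].
  rewrite -expectedB; [|exact: bounded_measurableM|exact: bounded_measurableM].
  by apply: eq_Rintegral => w _; ring.
have e4 := E_stationary tn0; have e5 := E_stationary (lexx 0).
rewrite e1 e2 -!mulrDr; apply/eqP; rewrite mulf_eq0; apply/orP; right; apply/eqP.
move: e3; rewrite e4 e5; lra.
Qed.

End fixed_test_function.

End balance.

(** * Heavy traffic *)

Section exponential_law.
Context (R : realType) (r : R).
Hypothesis r_gt0 : 0 < r.
Local Notation leb := (@lebesgue_measure R).

(* [exponential_prob] on the Borel sets of [R] with their default display *)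
Definition exponential_law (V : set R) : \bar R := exponential_prob r V.

Let nu := exponential_distribution_exponential_prob__canonical__probability_measure_Probability
  r_gt0.

Let law0 : exponential_law set0 = 0%E. Proof. exact: (@measure0 _ _ _ nu). Qed.

Let law_ge0 V : (0 <= exponential_law V)%E. Proof. exact: (@measure_ge0 _ _ _ nu). Qed.

Let law_sigma_additive : semi_sigma_additive exponential_law.
Proof. exact: (@measure_semi_sigma_additive _ _ _ nu). Qed.

HB.instance Definition _ := isMeasure.Build _ _ _
  exponential_law law0 law_ge0 law_sigma_additive.

Let law_setT : exponential_law [set: R] = 1%E.
Proof. exact: (@probability_setT _ _ _ nu). Qed.

HB.instance Definition _ :=
  @Measure_isProbability.Build _ _ R exponential_law law_setT.

Definition exponential_probability : probability R R := exponential_law.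

Lemma exponential_probability_lt0 : exponential_probability `]-oo, 0[%classic = 0%E.
Proof.
apply: integral0_eq => x /=; rewrite in_itv/= => x0.
by rewrite lt0_exponential_pdf.
Qed.

(** The Radon-Nikodym derivative of the exponential law is almost everywhere equal to
    [exponential_pdf r], since both have the same integrals over measurable sets; a change of
    measure then gives the formula. *)
Let density (f : R -> R) : measurable_fun setT f -> (forall x, 0 <= f x <= 1) ->
  (\int[exponential_law]_x (f x)%:E = \int[leb]_x (f x * exponential_pdf r x)%:E)%E.
Proof.
move=> mf f01.
have mid : @measurable_fun _ _ (measurableTypeR R) R setT id by move=> _ B mB; rewrite setTI.
transitivity (\int[nu]_x (f x)%:E)%E.
  rewrite (eq_measure_integral (pushforward nu (id : measurableTypeR R -> R)))//.
  by rewrite ge0_integral_pushforward//; [exact/measurable_EFinP|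
    move=> x _; rewrite lee_fin; case/andP: (f01 x)].
have dom : nu `<< leb.
  apply/null_content_dominatesP => A mA A0; apply: null_set_integral => //.
  by apply/measurable_funTS/measurable_EFinP; exact: measurable_exponential_pdf.
have fin : nu.-integrable setT (EFin \o f).
  apply: measurable_bounded_integrable => //.
    by rewrite (le_lt_trans (probability_le1 _ _))// ltry.
  exists 1; split => // y y1 x _ /=; have /andP[h1 h2] := f01 x.
  by rewrite ger0_norm// (le_trans h2)// ltW.
rewrite -(Radon_Nikodym_change_of_variables dom)//=.
under [RHS]eq_integral do rewrite EFinM.
apply: ae_eq_integral => //.
- apply: emeasurable_funM; first exact/measurable_EFinP.
  by apply: (measurable_int leb); apply: Radon_Nikodym_integrable; exact: dom.
- apply: emeasurable_funM; first exact/measurable_EFinP.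
  by apply/measurable_EFinP; exact: measurable_exponential_pdf.
- apply: ae_eqe_mul2l => /=.
  rewrite Radon_NikodymE//=.
  case: cid => /= h [h1 h2 h3].
  apply: integral_ae_eq => //=.
  + by apply/measurable_EFinP; exact: measurable_exponential_pdf.
  + by move=> E E01 mE; rewrite -h3.
Qed.

(** On the half-line, damping the density of rate [r] gives [r / (r + s)] times the density of rate
    [r + s]. *)
Lemma exponential_laplace (s : R) : 0 <= s ->
  \int[exponential_probability]_x damp s x = r / (r + s).
Proof.
move=> s0; have rs0 : 0 < r + s by rewrite ltr_pwDl.
rewrite /Rintegral density; last 2 first.
- exact: measurable_damp.
- by move=> x; rewrite damp_ge0 damp_le1.
have -> : (\int[leb]_x (damp s x * exponential_pdf r x)%:E =
    \int[leb]_x ((r / (r + s))%:E * (exponential_pdf (r + s) x)%:E))%E.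
  apply: eq_integral => x _; rewrite -EFinM; congr EFin.
  have [x0|x0] := ltP x 0; first by rewrite !lt0_exponential_pdf// !mulr0.
  rewrite !exponential_pdfE// /damp ger0_norm// mulrCA -expRD.
  rewrite mulrA divfK ?gt_eqF//; congr (_ * expR _); ring.
rewrite ge0_integralZl//=.
- by rewrite integral_exponential_pdf// mule1.
- by apply/measurable_EFinP; exact: measurable_exponential_pdf.
- by move=> x _; rewrite lee_fin exponential_pdf_ge0// ltW.
- by rewrite lee_fin divr_ge0// ltW.
Qed.

End exponential_law.

Section recentring.
Context (R : realType) (D : nat) (Q : 'M[R]_D) (p : 'rV[R]_D).
Hypotheses (hQ : is_generator Q) (hirr : irreducible_generator Q)
  (hp : invariant_distribution Q p).

(** The indicator of [i] minus [p 0 i] is annihilated by [p], so the Poisson equation has a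
    solution. As a test function it makes the generator term of the balance equation the deviation
    of [phi_i] from [pi_i sum_j phi_j]. *)
Lemma poisson_indicator (i : 'I_D) : exists g : 'I_D -> R, forall (f : 'I_D -> R),
  \sum_k f k * (\sum_j Q k j * g j) = f i - p 0 i * \sum_k f k.
Proof.
have [_ [p1 _]] := hp.
pose v : 'cV[R]_D := \col_k ((k == i)%:R - p 0 i).
have [|g gv] := @poisson_equation R D Q p v hQ hirr hp.
  apply/matrixP => a b; rewrite !mxE.
  under eq_bigr do rewrite mxE mulrBr.
  rewrite sumrB -mulr_suml ord1 p1 mul1r (bigD1 i)//= eqxx mulr1 big1 ?addr0 ?subrr//.
  by move=> k /negbTE ->; rewrite mulr0.
exists (fun j => g j 0) => f.
have gvE k : \sum_j Q k j * g j 0 = (k == i)%:R - p 0 i.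
  by move/matrixP/(_ k 0): gv; rewrite !mxE.
under eq_bigr do rewrite gvE mulrBr.
rewrite sumrB -mulr_suml [_ * p 0 i]mulrC; congr (_ - _).
rewrite (bigD1 i)//= eqxx mulr1 big1 ?addr0//.
by move=> k /negbTE ->; rewrite mulr0.
Qed.

End recentring.

(** * Consequences of the balance equation for one stationary queue *)

Section stationary_identities.
Context (R : realType) (D : nat) (d : measure_display) (T : measurableType d)
  (P : probability T R) (Q : 'M[R]_D) (p : 'rV[R]_D) (lam c : 'I_D -> R)
  (H : 'I_D -> probability R R) (sigma : discipline R) (X : mmqueue D P)
  (W : R -> {RV P >-> R}).
Hypotheses (hQ : is_generator Q) (hirr : irreducible_generator Q)
  (hp : invariant_distribution Q p)
  (hlam : forall i, 0 <= lam i) (hc : forall i, 0 <= c i)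
  (hH : forall i, requirement_distribution (H i)) (hsigma : is_discipline sigma)
  (hW : stationary_workload Q lam H c sigma X W).
Implicit Types (s : R) (i j : 'I_D) (w : T).
Local Notation damped := (damped X W).
Local Notation idle := (idle X W).

Let hX : is_mmqueue Q lam H c sigma X. Proof. by case: hW. Qed.

Let balance s g := @balance_equation R D d T P Q lam c H sigma X W
  hlam hc hH hsigma hW s g.

Let env_eqE i : [set w | env X 0 w == i] = env X 0 @^-1` [set i].
Proof. by apply/seteqP; split => w /eqP. Qed.

Let env_meas i : measurable [set w | env X 0 w == i].
Proof. by rewrite env_eqE; exact: (measurable_env_event hX). Qed.

Let benv i : bounded_measurable (fun w => (env X 0 w == i)%:R : R).
Proof. by apply: bounded_measurable_bool; exact: env_meas. Qed.

Let bdamp s : 0 <= s -> bounded_measurable (fun w => damp s (W 0 w)).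
Proof. by move=> s0; apply: bounded_measurable_damp => //; exact: measurable_funP. Qed.

Let bdenv s i : 0 <= s ->
  bounded_measurable (fun w => damp s (W 0 w) * (env X 0 w == i)%:R).
Proof. by move=> s0; apply: bounded_measurableM => //; exact: bdamp. Qed.

Let bidle i : bounded_measurable (fun w => ((W 0 w == 0) && (env X 0 w == i))%:R : R).
Proof.
apply: bounded_measurable_bool.
have mW : measurable (W 0 @^-1` [set 0]).
  by rewrite -[X in measurable X]setTI; exact: measurable_funP.
have := measurableI _ _ mW (env_meas i).
by congr measurable; apply/seteqP; split => w /=;
  [move=> [-> ->]; rewrite eqxx|move=> /andP[/eqP]].
Qed.

Lemma workload_ae_ge0 : {ae P, forall w, 0 <= W 0 w}.
Proof.
have [_ hw _] := hW.
apply: filterS2 (hw 0 (lexx 0)) (ae_regular_path hH hX) => w -> [rc ini res gp rq].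
pose B (f : 'I_D -> R) := 1 + \sum_i f i.
have fB (f : 'I_D -> R) i : (forall i, 0 <= f i) -> f i <= B f.
  move=> f0; rewrite /B (bigD1 i)//= addrCA lerDl addr_ge0//.
  exact: sumr_ge0.
apply: (@workload_ge0 _ _ _ _ _ lam c sigma X w (B lam) (B c)) => //.
- by move=> i; exact: fB.
- by move=> i; exact: fB.
- by rewrite mulr0 addr_gt0.
Qed.

Lemma damped_ge0 s i : 0 <= s -> 0 <= damped s i.
Proof. by move=> s0; apply: Rintegral_ge0 => w _; rewrite mulr_ge0// damp_ge0. Qed.

Lemma idle_ge0 i : 0 <= idle i.
Proof. exact: Rintegral_ge0. Qed.

Lemma damped_sum s : 0 <= s -> \sum_i damped s i = \int[P]_w damp s (W 0 w).
Proof.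
move=> s0; rewrite -expected_sum => [|i]; last exact: bdenv.
apply: eq_Rintegral => w _; rewrite (bigD1 (env X 0 w))//= eqxx mulr1 big1 ?addr0// => i.
by rewrite eq_sym => /negbTE ->; rewrite mulr0.
Qed.

Lemma damped_sum_le1 s : 0 <= s -> \sum_i damped s i <= 1.
Proof.
move=> s0; rewrite damped_sum// -[leRHS](expected_cst P); apply: expected_ae_le.
- exact: bdamp.
- exact: bounded_measurable_cst.
- by apply: aeW => w; exact: damp_le1.
Qed.

Lemma damped_le1 s i : 0 <= s -> damped s i <= 1.
Proof.
move=> s0; apply: le_trans (damped_sum_le1 s0).
by rewrite (bigD1 i)//= lerDl sumr_ge0// => j _; exact: damped_ge0.
Qed.

Lemma idle_le1 i : idle i <= 1.
Proof.
rewrite -[leRHS](expected_cst P); apply: expected_ae_le.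
- exact: bidle.
- exact: bounded_measurable_cst.
- by apply: aeW => w; rewrite lern1 leq_b1.
Qed.

(** The initial law of the environment is not prescribed: at [s = 0] only the generator term of the
    balance equation survives, and [poisson_indicator] forces this law to be [p]. *)
Lemma damped0 i : damped 0 i = p 0 i.
Proof.
have [g Hg] := poisson_indicator hQ hirr hp i.
have := balance g (lexx 0); rewrite Hg mul0r addr0.
rewrite [X in _ + X]big1 ?addr0 => [|j _]; last first.
  by rewrite laplace0 subrr mulr0 mul0r mulr0.
rewrite damped_sum//; under eq_Rintegral do rewrite damp0l.
by rewrite expected_cst mulr1 => /eqP; rewrite subr_eq0 => /eqP.
Qed.

Lemma damped_cvg0 (u : nat -> R) i : (forall n, 0 < u n) -> u n @[n --> \oo] --> 0 ->
  damped (u n) i @[n --> \oo] --> p 0 i.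
Proof.
move=> u0 cu; rewrite -damped0.
apply: (@expected_bounded_cvg _ _ _ P
  (fun n w => damp (u n) (W 0 w) * (env X 0 w == i)%:R)
  (fun w => damp 0 (W 0 w) * (env X 0 w == i)%:R) 1).
- by move=> n; case: (@bdenv (u n) i (ltW (u0 n))).
- by case: (@bdenv 0 i (lexx 0)).
- apply: aeW => w n; rewrite normrM -[leRHS]mulr1 ler_pM//.
    by rewrite ger0_norm ?damp_ge0// damp_le1// ltW.
  by rewrite normr_nat lern1 leq_b1.
- apply: aeW => w; apply: cvgM; last exact: cvg_cst.
  have h : - (u n * `|W 0 w|) @[n --> \oo] --> - (0 * `|W 0 w|).
    by apply: cvgN; apply: cvgM => //; exact: cvg_cst.
  by rewrite /damp; apply: continuous_cvg h; exact: continuous_expR.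
Qed.

Lemma idle_sum : \sum_i c i * idle i = \sum_i p 0 i * (c i - lam i * moment (H i) 1).
Proof.
have sg0 n := @step_gt0 R n.
have Q1 i : \sum_j Q i j * 1 = 0.
  by have [_ h] := hQ; under eq_bigr do rewrite mulr1; exact: h.
have E n : \sum_i c i * idle i = \sum_i (c i * damped (step R n) i -
    lam i * (moment (H i) 1 - step R n * laplace_rem (H i) (step R n)) * damped (step R n) i).
  have := @balance (step R n) (fun=> 1) (ltW (sg0 n)).
  rewrite [X in X + _ + _]big1 ?add0r => [h|i _]; last by rewrite Q1 mulr0.
  apply: (@mulfI _ (step R n)); first by rewrite gt_eqF.
  apply/eqP; rewrite eq_sym -subr_eq0 -mulrBr -sumrB -[X in _ == X]h; apply/eqP.
  rewrite !mulr_sumr -big_split /=; apply: eq_bigr => i _.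
  have := laplaceE (H i) (sg0 n) => lE.
  have -> : laplace (H i) (step R n) - 1 = - (step R n * moment (H i) 1 -
    step R n ^+ 2 * laplace_rem (H i) (step R n)) by rewrite -lE opprB.
  ring.
have lim : \sum_i (c i * damped (step R n) i -
    lam i * (moment (H i) 1 - step R n * laplace_rem (H i) (step R n)) * damped (step R n) i)
    @[n --> \oo] --> \sum_i (c i * p 0 i -
       lam i * (moment (H i) 1 - 0 * (moment (H i) 2 / 2)) * p 0 i).
  apply: cvg_sumr => i.
  have dc : damped (step R n) i @[n --> \oo] --> p 0 i.
    by apply: damped_cvg0 => //; exact: step_cvg.
  apply: cvgB; first by apply: cvgM => //; exact: cvg_cst.
  apply: cvgM => //; apply: cvgM; first exact: cvg_cst.
  apply: cvgB; first exact: cvg_cst.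
  apply: cvgM; first exact: step_cvg.
  by apply: laplace_rem_cvg => //; exact: step_cvg.
rewrite (_ : (fun n => _) = fun=> \sum_i c i * idle i) in lim; last first.
  by apply/funext => n; rewrite -E.
rewrite -(cvg_unique _ lim (cvg_cst _))//.
by apply: eq_bigr => i _; ring.
Qed.

(** Apart from the generator term, all terms of the balance equation are of order [s]: the service
    term carries the factor explicitly, and [1 - laplace (H j) s] is at most
    [s * moment (H j) 1]. *)
Lemma damped_decoupling s i (g : 'I_D -> R) : 0 < s ->
  (forall f : 'I_D -> R,
    \sum_k f k * (\sum_j Q k j * g j) = f i - p 0 i * \sum_k f k) ->
  `|damped s i - p 0 i * \sum_k damped s k| <=
  s * \sum_j `|g j| * (c j + lam j * moment (H j) 1).
Proof.
move=> s0 Hg; have sge0 := ltW s0; have := balance g sge0; rewrite Hg.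
move=> /eqP; rewrite -addrA addr_eq0 => /eqP ->; rewrite normrN mulr_sumr -big_split /=.
rewrite mulr_sumr; apply: (le_trans (ler_norm_sum _ _ _)); apply: ler_sum => j _.
have -> : s * (`|g j| * (c j + lam j * moment (H j) 1)) =
   s * c j * `|g j| * 1 + `|g j| * (lam j * (s * moment (H j) 1) * 1) by ring.
have /andP[l0 l1] := laplace_bound (hH j) s0.
have d0 := damped_ge0 j sge0; have d1 := damped_le1 j sge0.
have i0 := idle_ge0 j; have i1 := idle_le1 j.
apply: (le_trans (ler_normD _ _)); apply: lerD.
  rewrite mulrA mulrA !normrM (ger0_norm sge0) (ger0_norm (hc j)).
  apply: ler_wpM2l; first by rewrite !mulr_ge0.
  by rewrite ler_norml; apply/andP; split; lra.
rewrite normrM ler_wpM2l// normrM; apply: ler_pM => //; last by rewrite ger0_norm.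
by rewrite normrM (ger0_norm (hlam j)) ler_wpM2l// distrC ger0_norm.
Qed.

(* [balance_equation] for the perturbed test function [1 + s * b]: the choice of
   [b] cancels the terms of order [s]. *)
Lemma perturbed_balance (lh b : 'I_D -> R) (e th : R) : 0 < e -> 0 < th ->
  (forall i, lam i = lh i * (1 - e)) ->
  (forall i, \sum_j Q i j * b j = lh i * moment (H i) 1 - c i) ->
  let s := th * e in
  \sum_i damped s i * (lh i * moment (H i) 1 + th * (c i * b i + lh i * (1 - e) *
    (laplace_rem (H i) s - b i * moment (H i) 1 + s * b i * laplace_rem (H i) s))) =
  e^-1 * \sum_i c i * idle i + th * \sum_i b i * (c i * idle i).
Proof.
move=> e0 th0 lamE Qb s; have s0 : 0 < s by rewrite mulr_gt0.
have Qg i : \sum_j Q i j * (1 + s * b j) = s * (lh i * moment (H i) 1 - c i).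
  have [_ Q1] := hQ; rewrite -Qb.
  transitivity (\sum_j Q i j + s * \sum_j Q i j * b j); last by rewrite Q1 add0r.
  by rewrite mulr_sumr -big_split /=; apply: eq_bigr => j _; ring.
have := balance (fun j => 1 + s * b j) (ltW s0).
under eq_bigr do rewrite Qg.
(* The order [s * e] is what remains after the cancellation: the capacities disappear, and
   [lh i - lam i = lh i * e] leaves the load. *)
move=> h; apply: (@mulfI _ (s * e)); first by rewrite gt_eqF// mulr_gt0.
apply/eqP; rewrite -subr_eq0 -[X in _ == X]h; apply/eqP.
rewrite !mulr_sumr -!big_split /= !mulr_sumr -sumrB; apply: eq_bigr => i _.
rewrite -[laplace (H i) s - 1]opprB (laplaceE (H i) s0) lamE /s.
by field; rewrite gt_eqF.
Qed.

End stationary_identities.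

Section decoupled_limit.
Context (R : realType) (D : nat) (p : 'I_D -> R) (phi x : nat -> 'I_D -> R)
  (xl : 'I_D -> R) (v : 'I_D -> nat -> R) (y : nat -> R) (yl : R).
Hypotheses (phi_p : forall n i, `|phi n i - p i * \sum_j phi n j| <= v i n)
  (v0 : forall i, v i n @[n --> \oo] --> 0)
  (cx : forall i, x n i @[n --> \oo] --> xl i)
  (phixE : forall n, \sum_i phi n i * x n i = y n)
  (cy : y n @[n --> \oo] --> yl) (xl_neq0 : \sum_i p i * xl i != 0).

(** Replacing [phi n i] by [p i] times the total mass costs a vanishing amount because [x n]
    converges. The total mass is then approximately [y n] divided by the average of [x n] under [p],
    whose limit is nonzero. *)
Lemma decoupled_limit :
  \sum_i phi n i @[n --> \oo] --> yl / \sum_i p i * xl i.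
Proof.
pose Y n := \sum_i p i * x n i; pose S n := \sum_i phi n i.
have cY : Y n @[n --> \oo] --> \sum_i p i * xl i.
  by apply: cvg_sumr => i; apply: cvgM => //; exact: cvg_cst.
have cSY : y n - \sum_i (phi n i - p i * S n) * x n i @[n --> \oo] -->
    yl - \sum_i 0 * xl i.
  apply: cvgB => //; apply: cvg_sumr => i; apply: cvgM => //.
  apply: (@cvg_dist_le _ _ (v i)) => //.
  by apply: nearW => n; rewrite subr0; exact: phi_p.
rewrite [X in _ - X]big1 ?subr0 in cSY; last by move=> i _; rewrite mul0r.
have h : (y n - \sum_i (phi n i - p i * S n) * x n i) * (Y n)^-1 @[n --> \oo] -->
    yl / \sum_i p i * xl i by apply: cvgM cSY _; exact: cvgV.
apply: cvg_trans h; apply: near_eq_cvg; near=> n.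
have Yn : Y n != 0.
  near: n; have := cvgr_neq0 _ cY xl_neq0; exact.
rewrite /= -(phixE n) -sumrB.
have -> : \sum_i (phi n i * x n i - (phi n i - p i * S n) * x n i) = S n * Y n.
  by rewrite /Y mulr_sumr; apply: eq_bigr => i _; ring.
by rewrite mulfK.
Unshelve. all: by end_near.
Qed.

End decoupled_limit.

(** * The limiting mean *)

Section heavy_traffic_parameters.
Context (R : realType) (D : nat) (Q : 'M[R]_D) (p : 'rV[R]_D)
  (lam : 'I_D -> R) (H : 'I_D -> probability R R) (c : 'I_D -> R) (a : 'cV[R]_D).
Hypotheses (hQ : is_generator Q) (hp : invariant_distribution Q p)
  (hlam : forall i, 0 <= lam i)
  (hH : forall i, requirement_distribution (H i))
  (hcinf : 0 < c_infty p c) (hrho : 0 < rho_infty p lam H c)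
  (ha : forall i, (Q *m a) i 0 = c i - lam_hat p lam H c i * moment (H i) 1).

Local Notation lh := (lam_hat p lam H c).
Local Notation m := (mean_limit p lam H c a).

Lemma lam_hat_ge0 i : 0 <= lh i.
Proof. by rewrite divr_ge0// ltW. Qed.

Lemma lam_hat_load : \sum_i p 0 i * (lh i * moment (H i) 1) = c_infty p c.
Proof.
have load : \sum_i p 0 i * lam i * moment (H i) 1 = rho_infty p lam H c * c_infty p c.
  by rewrite /rho_infty divfK// gt_eqF.
transitivity ((rho_infty p lam H c)^-1 * \sum_i p 0 i * lam i * moment (H i) 1).
  by rewrite mulr_sumr; apply: eq_bigr => i _; rewrite /lam_hat; ring.
by rewrite load mulKf// gt_eqF.
Qed.

(** By the equation for [a] this is minus the [p]-weighted inner product of [a] and [Q a]. Zero row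
    sums and invariance of [p] turn it into half the sum of [p_i q_ij (a_i - a_j) ^ 2]. *)
Lemma dirichlet_form_ge0 :
  0 <= \sum_i p 0 i * (a i 0 * (lh i * moment (H i) 1 - c i)).
Proof.
have [Qge0 Q1] := hQ; have [p0 [_ pQ]] := hp.
have -> : \sum_i p 0 i * (a i 0 * (lh i * moment (H i) 1 - c i)) =
    2^-1 * \sum_i \sum_j p 0 i * Q i j * (a i 0 - a j 0) ^+ 2.
  have e1 : \sum_i \sum_j p 0 i * Q i j * a i 0 ^+ 2 = 0.
    apply: big1 => i _; rewrite -mulr_suml -mulr_sumr Q1.
    by rewrite mulr0 mul0r.
  have e2 : \sum_i \sum_j p 0 i * Q i j * a j 0 ^+ 2 = 0.
    rewrite exchange_big; apply: big1 => j _; rewrite -mulr_suml.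
    by move/matrixP/(_ 0 j): pQ; rewrite !mxE => ->; rewrite mul0r.
  have e3 : \sum_i p 0 i * (a i 0 * (lh i * moment (H i) 1 - c i)) =
      - \sum_i \sum_j p 0 i * Q i j * (a i 0 * a j 0).
    rewrite -sumrN; apply: eq_bigr => i _.
    have -> : lh i * moment (H i) 1 - c i = - (Q *m a) i 0 by rewrite ha opprB.
    rewrite mxE !mulrN mulr_sumr mulr_sumr; congr (- _); apply: eq_bigr => j _; ring.
  transitivity (2^-1 * (\sum_i \sum_j p 0 i * Q i j * a i 0 ^+ 2 +
      \sum_i \sum_j p 0 i * Q i j * a j 0 ^+ 2 -
      2 * \sum_i \sum_j p 0 i * Q i j * (a i 0 * a j 0))).
    by rewrite e1 e2 e3; field.
  congr (_ * _); rewrite mulr_sumr -big_split -sumrB /=; apply: eq_bigr => i _.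
  rewrite mulr_sumr -big_split -sumrB /=; apply: eq_bigr => j _; ring.
rewrite mulr_ge0//; apply: sumr_ge0 => i _; apply: sumr_ge0 => j _.
have [<-|ij] := eqVneq i j; first by rewrite subrr expr0n mulr0.
by rewrite mulr_ge0 ?sqr_ge0// mulr_ge0// Qge0.
Qed.

(** The part in [a] is nonnegative. If the part in the second moments vanished, then [p_i lh_i]
    would be 0 for every [i] with a positive mean requirement, and the total load, which equals
    [c_infty], would be 0. *)
Lemma mean_limit_gt0 : 0 < m.
Proof.
have [p0 _] := hp.
rewrite /mean_limit mulr_gt0 ?invr_gt0//.
under eq_bigr do rewrite mulrDr.
rewrite big_split /= ltr_pwDl ?dirichlet_form_ge0//.
have t0 i : 0 <= p 0 i * (lh i * moment (H i) 2 / 2).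
  by rewrite mulr_ge0// divr_ge0// mulr_ge0 ?lam_hat_ge0// (moment2_ge0 (hH i)).
rewrite lt_neqAle sumr_ge0 ?andbT// eq_sym; apply: contraTneq hcinf => /eqP.
rewrite psumr_eq0// => /allP t1; rewrite -lam_hat_load big1 ?ltxx// => i _.
have /= /eqP t2 := t1 i (mem_index_enum _).
have := moment1_ge0 (hH i); rewrite le_eqVlt => /predU1P[<-|h1].
  by rewrite !mulr0.
have h2 := moment2_gt0 (hH i) h1.
rewrite mulrA; suff -> : p 0 i * lh i = 0 by rewrite mul0r.
apply: (@mulIf _ (moment (H i) 2 / 2)); first by rewrite gt_eqF// divr_gt0.
by rewrite mul0r -t2; ring.
Qed.

(** The left-hand side is written as the limit of the coefficients in [perturbed_balance], with
    [b = - a] and with 0 in place of [e] and [s]. *)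
Lemma perturbation_limit (th : R) :
  \sum_i p 0 i * (lh i * moment (H i) 1 + th * (c i * - a i 0 + lh i * (1 - 0) *
    (moment (H i) 2 / 2 - - a i 0 * moment (H i) 1 + 0 * - a i 0 * (moment (H i) 2 / 2)))) =
  c_infty p c * (1 + th * m).
Proof.
have -> : c_infty p c * (1 + th * m) = \sum_i p 0 i * (lh i * moment (H i) 1) +
    th * (c_infty p c * m).
  by rewrite lam_hat_load; ring.
rewrite /mean_limit mulVKf ?gt_eqF// mulr_sumr -big_split /=.
by apply: eq_bigr => i _; ring.
Qed.

End heavy_traffic_parameters.

(** * Passage to the limit along a sequence of scalings *)

Section heavy_traffic_limit.
Context (R : realType) (D : nat) (Q : 'M[R]_D) (p : 'rV[R]_D)
  (lam : 'I_D -> R) (H : 'I_D -> probability R R) (c : 'I_D -> R)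
  (sigma : discipline R) (a : 'cV[R]_D) (N : nat -> R)
  (dT : nat -> measure_display) (T : forall n, measurableType (dT n))
  (P : forall n, probability (T n) R) (X : forall n, mmqueue D (P n))
  (W : forall n, R -> {RV (P n) >-> R}).
Hypotheses (hQ : is_generator Q) (hirr : irreducible_generator Q)
  (hp : invariant_distribution Q p)
  (hlam : forall i, 0 <= lam i) (hc : forall i, 0 <= c i)
  (hH : forall i, requirement_distribution (H i))
  (hcinf : 0 < c_infty p c) (hrho : 0 < rho_infty p lam H c)
  (hsigma : is_discipline sigma) (N_gt1 : forall n, 1 < N n)
  (hN : N n @[n --> \oo] --> +oo)
  (hW : forall n, stationary_workload Q (lam_scaled p lam H c (N n)) H c sigma (X n) (W n))
  (ha : forall i, (Q *m a) i 0 = c i - lam_hat p lam H c i * moment (H i) 1).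

Local Notation lh := (lam_hat p lam H c).
Local Notation m := (mean_limit p lam H c a).

Let e n := (N n)^-1.

Let e_gt0 n : 0 < e n. Proof. by rewrite invr_gt0 (lt_trans ltr01). Qed.

Let e_le1 n : e n <= 1. Proof. by rewrite invf_le1 ?ltW// (lt_trans ltr01). Qed.

Let e_cvg : e n @[n --> \oo] --> 0.
Proof.
apply/cvgr0Pnorm_lt => r r0; have /cvgryPgt/(_ r^-1) h := hN.
near=> n; rewrite gtr0_norm ?e_gt0// /e.
rewrite -[ltRHS]invrK ltf_pV2 ?posrE ?invr_gt0//; last exact: lt_trans (N_gt1 n).
by near: n.
Unshelve. all: by end_near.
Qed.

Let lamE n i : lam_scaled p lam H c (N n) i = lh i * (1 - e n).
Proof. by []. Qed.

Let lam_ge0 n i : 0 <= lam_scaled p lam H c (N n) i.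
Proof. by rewrite lamE mulr_ge0 ?lam_hat_ge0 ?subr_ge0. Qed.

Let idle_cvg n : \sum_i c i * idle (X n) (W n) i = e n * c_infty p c.
Proof.
rewrite (idle_sum hQ hirr hp (lam_ge0 n) hc hH hsigma (hW n)).
transitivity (c_infty p c - (1 - e n) * \sum_i p 0 i * (lh i * moment (H i) 1)).
  rewrite mulr_sumr -sumrB; apply: eq_bigr => i _; rewrite lamE; ring.
by rewrite lam_hat_load//; ring.
Qed.

Lemma damped_workload_cvg (th : R) : 0 < th ->
  \int[P n]_w damp (th * e n) (W n 0 w) @[n --> \oo] --> (1 + th * m)^-1.
Proof.
move=> th0; pose s n := th * e n.
have s0 n : 0 < s n by rewrite mulr_gt0.
have cs : s n @[n --> \oo] --> 0.
  by rewrite -[X in _ --> X](mulr0 th); apply: cvgM => //; exact: cvg_cst.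
have m0 : 0 < m by exact: (mean_limit_gt0 hQ hp hlam hH hcinf hrho ha).
pose b i := - a i 0.
have Qb i : \sum_j Q i j * b j = lh i * moment (H i) 1 - c i.
  rewrite -opprB -ha mxE -sumrN; apply: eq_bigr => j _; rewrite /b; ring.
have crem i : laplace_rem (H i) (s n) @[n --> \oo] --> moment (H i) 2 / 2.
  exact: laplace_rem_cvg.
pose x n i := lh i * moment (H i) 1 + th * (c i * b i + lh i * (1 - e n) *
    (laplace_rem (H i) (s n) - b i * moment (H i) 1 +
     s n * b i * laplace_rem (H i) (s n))).
pose xl i := lh i * moment (H i) 1 + th * (c i * b i + lh i * (1 - 0) *
    (moment (H i) 2 / 2 - b i * moment (H i) 1 + 0 * b i * (moment (H i) 2 / 2))).
have cx i : x n i @[n --> \oo] --> xl i.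
  apply: cvgD; first exact: cvg_cst.
  apply: cvgM; first exact: cvg_cst.
  apply: cvgD; first exact: cvg_cst.
  apply: cvgM.
    by apply: cvgM; [exact: cvg_cst|apply: cvgB => //; exact: cvg_cst].
  apply: cvgD; first by apply: cvgB => //; exact: cvg_cst.
  by apply: cvgM => //; apply: cvgM => //; exact: cvg_cst.
pose y n := (e n)^-1 * (\sum_i c i * idle (X n) (W n) i) +
  th * \sum_i b i * (c i * idle (X n) (W n) i).
have cy : y n @[n --> \oo] --> c_infty p c.
  have ci0 n i : 0 <= c i * idle (X n) (W n) i by rewrite mulr_ge0 ?idle_ge0.
  (* The first term of [y n] is exactly [c_infty]. The second is small because each [c i * idle] is
     at most their sum, which is [e n * c_infty p c]. *)
  apply: (@cvg_dist_le _ _ (fun n => th * ((\sum_i `|b i|) * (e n * c_infty p c)))).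
    apply: nearW => n; rewrite /y idle_cvg mulKf ?gt_eqF// addrC addKr.
    rewrite normrM gtr0_norm// ler_wpM2l ?(ltW th0)//.
    apply: (le_trans (ler_norm_sum _ _ _)); rewrite -idle_cvg mulr_suml.
    apply: ler_sum => i _; rewrite normrM ler_wpM2l// ger0_norm//.
    by rewrite [leRHS](bigD1 i)//= lerDl sumr_ge0.
  rewrite -[X in _ --> X](mulr0 th); apply: cvgM; first exact: cvg_cst.
  rewrite -[X in _ --> X](mulr0 (\sum_i `|b i|)); apply: cvgM; first exact: cvg_cst.
  by rewrite -[X in _ --> X](mul0r (c_infty p c)); apply: cvgM => //; exact: cvg_cst.
have xlE : \sum_i p 0 i * xl i = c_infty p c * (1 + th * m).
  exact: perturbation_limit.
have den0 : 0 < 1 + th * m by rewrite ltr_wpDr// mulr_ge0// ltW.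
(* The generator is not rescaled, so these test functions do not depend on [n]. Together with the
   bound of the scaled rates by [lh], this makes the decoupling estimate a constant times [s n]. *)
have [g Hg] : exists g : 'I_D -> 'I_D -> R, forall i (f : 'I_D -> R),
    \sum_k f k * (\sum_j Q k j * g i j) = f i - p 0 i * \sum_k f k.
  have [g Hg] := choice (poisson_indicator hQ hirr hp); by exists g.
pose v i n := s n * \sum_j `|g i j| * (c j + lh j * moment (H j) 1).
have cv i : v i n @[n --> \oo] --> 0.
  rewrite -[X in _ --> X](mul0r (\sum_j `|g i j| * (c j + lh j * moment (H j) 1))).
  by apply: cvgM => //; exact: cvg_cst.
have dv n i : `|damped (X n) (W n) (s n) i -
    p 0 i * \sum_k damped (X n) (W n) (s n) k| <= v i n.
  apply: (le_trans (damped_decoupling (lam_ge0 n) hc hH hsigma (hW n) (s0 n) (Hg i))).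
  rewrite ler_wpM2l ?(ltW (s0 n))//; apply: ler_sum => j _; rewrite ler_wpM2l//.
  rewrite lerD2l lamE ler_wpM2r ?moment1_ge0//.
  by rewrite ler_piMr ?lam_hat_ge0// gerBl ltW.
have phixE n : \sum_i damped (X n) (W n) (s n) i * x n i = y n.
  exact: (perturbed_balance hQ (lam_ge0 n) hc hH hsigma (hW n) (e_gt0 n) th0 (lamE n) Qb).
have xl0 : \sum_i p 0 i * xl i != 0 by rewrite xlE gt_eqF// mulr_gt0.
have := @decoupled_limit R D (fun i => p 0 i) (fun n => damped (X n) (W n) (s n)) x xl v y
  (c_infty p c) dv cv cx phixE cy xl0.
rewrite xlE invfM mulVKf ?gt_eqF//.
rewrite (_ : (fun n => \sum_i _) = fun n => \int[P n]_w damp (th * e n) (W n 0 w))//.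
apply/funext => n; rewrite (damped_sum (hW n))//; exact: ltW.
Qed.

Lemma scaled_workload_cdf_cvg (x : R) :
  {for x, continuous (fun y => exponential_prob m^-1 `]-oo, y]%classic)} ->
  cdf (scale_mfun (N n)^-1 (W n 0) : {RV P n >-> R}) x @[n --> \oo] -->
  exponential_prob m^-1 `]-oo, x]%classic.
Proof.
move=> cx; have m0 : 0 < m by exact: (mean_limit_gt0 hQ hp hlam hH hcinf hrho ha).
have im0 : 0 < m^-1 by rewrite invr_gt0.
have iN n : 0 < (N n)^-1 by exact: e_gt0.
apply: (@laplace_continuity R
  (fun n => distribution (P n) (scale_mfun (N n)^-1 (W n 0)))
  (exponential_probability im0)) => //.
- move=> n; have [A [mA A0 sA]] := workload_ae_ge0 (lam_ge0 n) hc hH hsigma (hW n).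
  apply: (subset_measure0 _ mA _ A0).
    by rewrite -[X in measurable X]setTI; exact: measurable_funP.
  move=> w /= wn; apply: sA => /=; apply/negP; rewrite -ltNge.
  by move: wn; rewrite in_itv/= pmulr_llt0.
- exact: exponential_probability_lt0.
- move=> k k0; have kR : (0 : R) < k%:R by rewrite ltr0n.
  rewrite exponential_laplace//.
  have -> : m^-1 / (m^-1 + k%:R) = (1 + k%:R * m)^-1.
    have h1 : 0 < 1 + k%:R * m by rewrite ltr_wpDr// mulr_ge0// ltW.
    have h2 : 0 < m^-1 + k%:R by rewrite addr_gt0.
    by field; rewrite !gt_eqF//; nra.
  have := damped_workload_cvg kR.
  rewrite (_ : (fun n => _) =
    fun n => \int[distribution (P n) (scale_mfun (N n)^-1 (W n 0))]_w damp k%:R w)//.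
  apply/funext => n; rewrite /Rintegral ge0_integral_distribution//.
  + congr fine; apply: eq_integral => w _; congr EFin.
    transitivity (damp k%:R (W n 0 w * (N n)^-1)); last by [].
    by rewrite [W n 0 w * _]mulrC damp_scale ?(ltW (iN n)).
  + by apply/measurable_EFinP; exact: measurable_damp.
  + by move=> y; rewrite lee_fin damp_ge0.
Qed.

End heavy_traffic_limit.

Theorem theorem3p3 (R : realType) (D : nat)
    (Q : 'M[R]_D) (p : 'rV[R]_D)
    (lam : 'I_D -> R) (H : 'I_D -> probability R R) (c : 'I_D -> R)
    (sigma : discipline R) (a : 'cV[R]_D)
    (dT : R -> measure_display) (T : forall N : R, measurableType (dT N))
    (P : forall N : R, probability (T N) R)
    (X : forall N : R, mmqueue D (P N))
    (W : forall N : R, R -> {RV (P N) >-> R})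
    (hQ : is_generator Q) (hirr : irreducible_generator Q)
    (hp : invariant_distribution Q p)
    (hlam : forall d, 0 <= lam d) (hc : forall d, 0 <= c d)
    (hH : forall d, requirement_distribution (H d))
    (hcinf : 0 < c_infty p c) (hrho : 0 < rho_infty p lam H c)
    (hsigma : is_discipline sigma)
    (hW : forall N : R, 1 < N ->
       stationary_workload Q (lam_scaled p lam H c N) H c sigma (X N) (W N))
    (ha : forall d, (Q *m a) d 0 = c d - lam_hat p lam H c d * moment (H d) 1) :
  0 < mean_limit p lam H c a /\
  cvg_in_distribution P (fun N : R => scale_mfun N^-1 (W N 0))
    (exponential_prob (mean_limit p lam H c a)^-1).
Proof.
split; first exact: (mean_limit_gt0 hQ hp hlam hH hcinf hrho ha).
move=> x cx; apply/cvge_pinftyP => u cu.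
(* An arbitrary sequence tending to infinity may begin with values at which no stationary queue is
   given. The value 2 replaces these finitely many terms. *)
pose N n := if 1 < u n then u n else 2.
have N_gt1 n : 1 < N n by rewrite /N; case: ifP => // _; rewrite ltr1n.
have uN : \forall n \near \oo, N n = u n.
  by have /cvgryPgt/(_ 1) := cu; apply: filterS => n; rewrite /N => ->.
have cN : N n @[n --> \oo] --> +oo.
  by apply: cvg_trans cu; apply: near_eq_cvg; apply: filterS uN => n ->.
have := @scaled_workload_cdf_cvg R D Q p lam H c sigma a N
  (fun n => dT (N n)) (fun n => T (N n)) (fun n => P (N n)) (fun n => X (N n))
  (fun n => W (N n)) hQ hirr hp hlam hc hH hcinf hrho hsigma N_gt1 cN
  (fun n => hW (N n) (N_gt1 n)) ha x cx.
apply: cvg_trans; apply: near_eq_cvg; apply: filterS uN => n; by rewrite /= => ->.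
Qed.
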